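(* Let $\alpha\ge0$ and let $a,b>0$. Then there is a constant $c>0$, depending only on $a,b,\alpha$, such that for every $f\in L^2(\mathbb{K})$, $$\|f\|_2^{a+b}\le c\,\big\|\,|(x,t)|^a f\,\big\|_2^{b}\;\big\|\,|(\lambda,m)|^{b/2}\,\hat f\,\big\|_2^{a}.$$
   Context: Let $\alpha\ge 0$. The Laguerre hypergroup is $\mathbb{K}=[0,\infty)\times\mathbb{R}$ with the measure $dm_\alpha(x,t)=\frac{1}{\pi\,\Gamma(\alpha+1)}x^{2\alpha+1}\,dx\,dt$; $L^p(\mathbb{K})$ is the complex Lebesgue space with respect to $m_\alpha$, with norm $\|\cdot\|_p$. The homogeneous norm on $\mathbb{K}$ is $|(x,t)|=(x^4+4t^2)^{1/4}$. The dual is $\widehat{\mathbb{K}}=\mathbb{R}\times\mathbb{N}$, $\mathbb{N}=\{0,1,2,\dots\}$, with the Plancherel measure $\gamma_\alpha$ given by $$\int_{\widehat{\mathbb{K}}}g\,d\gamma_\alpha=\sum_{m\ge0}L_m^\alpha(0)\int_{\mathbb{R}}g(\lambda,m)\,|\lambda|^{\alpha+1}\,d\lambda,$$ where $L_m^\alpha$ is the Laguerre polynomial of degree $m$ and order $\alpha$ (so $L_m^\alpha(0)=\frac{\Gamma(m+\alpha+1)}{m!\,\Gamma(\alpha+1)}$). Norms $\|\cdot\|_q$ of functions on $\widehat{\mathbb{K}}$ are $L^q$ norms with respect to $\gamma_\alpha$. The quasi-norm on $\widehat{\mathbb{K}}$ is $|(\lambda,m)|=4|\lambda|\left(m+\frac{\alpha+1}{2}\right)$.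 For $(\lambda,m)\in\mathbb{R}\times\mathbb{N}$ let $$\varphi_{(\lambda,m)}(x,t)=\frac{m!\,\Gamma(\alpha+1)}{\Gamma(m+\alpha+1)}\,e^{i\lambda t}\,e^{-|\lambda|x^2/2}\,L_m^\alpha(|\lambda|x^2).$$ The Fourier--Laguerre transform of $f\in L^1(\mathbb{K})$ is $\hat f(\lambda,m)=\int_{\mathbb{K}}f(x,t)\,\varphi_{(-\lambda,m)}(x,t)\,dm_\alpha(x,t)$. It satisfies $\|\hat f\|_\infty\le\|f\|_1$ and the Plancherel identity $\|\hat f\|_2=\|f\|_2$ for $f\in L^1(\mathbb{K})\cap L^2(\mathbb{K})$, and extends to an isometric isomorphism $L^2(\mathbb{K})\to L^2(\widehat{\mathbb{K}})$; for $f\in L^2(\mathbb{K})$, $\hat f$ denotes this extension. The norms on the right-hand side of the inequality are allowed to be $+\infty$. *)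

(* Defs.v *)
From HB Require Import structures.
From mathcomp Require Export all_boot all_order all_algebra.
From mathcomp Require Export complex.
From mathcomp Require Export all_classical all_reals all_analysis.
From mathcomp Require Export measurable_realfun.

Set Implicit Arguments.
Unset Strict Implicit.
Unset Printing Implicit Defensive.
Import Order.TTheory GRing.Theory Num.Theory.
Import numFieldNormedType.Exports.

Local Open Scope classical_set_scope.
Local Open Scope ring_scope.

Definition Gamma {R : realType} (s : R) : R :=
  \int[lebesgue_measure]_(t in `]0, +oo[) (t `^ (s - 1) * expR (- t)).

(* $L_m^\alpha(x) = \sum_{k=0}^m
     \frac{(-1)^k\,\Gamma(m+\alpha+1)}{\Gamma(k+\alpha+1)\,k!\,(m-k)!} x^k$ *)
Definition laguerre {R : realType} (alpha : R) (m : nat) : {poly R} :=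
  \poly_(k < m.+1) ((-1) ^+ k * Gamma (m%:R + alpha + 1)
    / (Gamma (k%:R + alpha + 1) * k`!%:R * (m - k)`!%:R)).

Section ComplexLp.
Context d (T : measurableType d) (R : realType).
Variable mu : {measure set T -> \bar R}.
Implicit Types f : T -> R[i].

Definition complex_measurable_fun f :=
  measurable_fun setT (fun x => complex.Re (f x)) /\
  measurable_fun setT (fun x => complex.Im (f x)).

Definition complex_integral f : R[i] :=
  Complex (\int[mu]_x complex.Re (f x)) (\int[mu]_x complex.Im (f x)).

Definition complex_Lnorm (p : \bar R) f : \bar R :=
  'N[mu]_p[EFin \o (ComplexField.Normc.normc (R := R) \o f)]%E.

Definition complex_Lp (p : \bar R) : set (T -> R[i]) :=
  [set f | complex_measurable_fun f /\ (complex_Lnorm p f < +oo)%E].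

End ComplexLp.

Section LaguerreMeasure.
Context {R : realType}.
Variable alpha : R.
Local Notation GR := (measurableTypeR R).
Local Open Scope ereal_scope.

(* The hypergroup $[0,\infty)\times\mathbb{R}$ is embedded in $R \times R$: the
   measure $m_\alpha$ lives on $R \times R$ and is carried by the half-plane
   $x \ge 0$, so that functions are determined by their values there up to
   a.e. equality. *)
Definition hypergroup : set (GR * GR) := [set z | (0 <= z.1)%R].

Definition laguerre_measure (A : set (GR * GR)) : \bar R :=
  \int[lebesgue_measure \x lebesgue_measure]_(z in A `&` hypergroup)
    (z.1 `^ (2 * alpha + 1) / (pi * Gamma (alpha + 1)))%:E.

Definition plancherel_measure (A : set (GR * nat)) : \bar R :=
  \sum_(0 <= m <oo) ((laguerre alpha m).[0]%:E *
    \int[lebesgue_measure]_(l in ysection A m) (`|l| `^ (alpha + 1))%:E).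

Lemma Gamma_ge0 (s : R) : (0 <= Gamma s)%R.
Proof.
apply: fine_ge0; apply: integral_ge0 => t _.
by rewrite lee_fin mulr_ge0 ?powR_ge0 ?expR_ge0.
Qed.

Lemma laguerre_at0 m : (laguerre alpha m).[0%R] =
  (Gamma (m%:R + alpha + 1) / (Gamma (alpha + 1) * m`!%:R))%R.
Proof.
by rewrite horner_coef0 coef_poly/= expr0 mul1r subn0 fact0 mulr1 add0r.
Qed.

Lemma laguerre_at0_ge0 m : (0 <= (laguerre alpha m).[0%R])%R.
Proof. by rewrite laguerre_at0 divr_ge0 ?mulr_ge0 ?Gamma_ge0. Qed.

Lemma measurable_hypergroup : measurable hypergroup.
Proof.
rewrite (_ : hypergroup = `[0%R, +oo[%classic `*` setT); last first.
  by apply/seteqP; split => [[x t]|[x t] []] /=; rewrite in_itv/= ?andbT.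
exact: measurableX.
Qed.

Let density (z : GR * GR) : \bar R :=
  (z.1 `^ (2 * alpha + 1) / (pi * Gamma (alpha + 1)))%:E.

Let density_ge0 (z : GR * GR) : 0 <= density z.
Proof.
by rewrite lee_fin divr_ge0 ?powR_ge0// mulr_ge0 ?pi_ge0 ?Gamma_ge0.
Qed.

Let measurable_density : measurable_fun setT density.
Proof.
apply/measurable_EFinP; apply: measurable_funM => //.
exact: (measurableT_comp (measurable_powR _)).
Qed.

Let laguerre_measure0 : laguerre_measure set0 = 0.
Proof. by rewrite /laguerre_measure set0I integral_set0. Qed.

Let laguerre_measure_ge0 A : 0 <= laguerre_measure A.
Proof. by apply: integral_ge0 => z _; exact: density_ge0. Qed.

Let laguerre_measure_semi_sigma_additive : semi_sigma_additive laguerre_measure.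
Proof.
have -> : laguerre_measure = fun A =>
    \int[lebesgue_measure \x lebesgue_measure]_(z in A)
      (density \_ hypergroup) z.
  by apply/funext => A; rewrite -integral_mkcondr.
apply: (@semi_sigma_additive_nng_induced _ _ R
  (lebesgue_measure \x lebesgue_measure) (density \_ hypergroup)).
- apply/(measurable_restrictT _ measurable_hypergroup).
  exact: measurable_funTS.
- by move=> z; apply: erestrict_ge0 => ? _; exact: density_ge0.
Qed.

HB.instance Definition _ := isMeasure.Build _ _ _ laguerre_measure
  laguerre_measure0 laguerre_measure_ge0 laguerre_measure_semi_sigma_additive.

Let term_ge0 (A : set (GR * nat)) m : 0 <= (laguerre alpha m).[0%R]%:E *
  \int[lebesgue_measure]_(l in ysection A m) (`|l| `^ (alpha + 1))%:E.
Proof.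
rewrite mule_ge0 ?lee_fin ?laguerre_at0_ge0//.
by apply: integral_ge0 => l _; rewrite lee_fin powR_ge0.
Qed.

Let plancherel_measure0 : plancherel_measure set0 = 0.
Proof.
by apply: eseries0 => m _ _; rewrite ysection0 integral_set0 mule0.
Qed.

Let plancherel_measure_ge0 A : 0 <= plancherel_measure A.
Proof. by apply: nneseries_ge0 => m _ _; exact: term_ge0. Qed.

Let plancherel_measure_semi_sigma_additive :
  semi_sigma_additive plancherel_measure.
Proof.
move=> F mF tF mUF.
have -> : plancherel_measure (\bigcup_n F n) =
    \sum_(0 <= n <oo) plancherel_measure (F n).
  rewrite /plancherel_measure nneseries_interchange; last first.
    by move=> *; exact: term_ge0.
  apply: eq_eseriesr => m _; rewrite nneseriesZl; last first.
    by move=> n _; apply: integral_ge0 => l _; rewrite lee_fin powR_ge0.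
  congr (_ * _); rewrite ysection_bigcup ge0_integral_bigcup//.
  - by move=> n; exact: measurable_ysection.
  - apply: measurable_funTS; apply/measurable_EFinP.
    exact: (measurableT_comp (measurable_powR _)).
  - exact: trivIset_ysection.
apply: is_cvg_ereal_nneg_natsum_cond => n _ _.
exact: plancherel_measure_ge0.
Qed.

HB.instance Definition _ := isMeasure.Build _ _ _ plancherel_measure
  plancherel_measure0 plancherel_measure_ge0
  plancherel_measure_semi_sigma_additive.

End LaguerreMeasure.

Section FourierLaguerre.
Context {R : realType}.
Variable alpha : R.

Definition hypergroup_norm (z : R * R) : R :=
  (z.1 ^+ 4 + 4 * z.2 ^+ 2) `^ 4^-1.

Definition dual_norm (w : R * nat) : R :=
  4 * `|w.1| * (w.2%:R + (alpha + 1) / 2).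

Definition laguerre_character (w : R * nat) (z : R * R) : R[i] :=
  real_complex R (w.2`!%:R * Gamma (alpha + 1) / Gamma (w.2%:R + alpha + 1)
    * expR (- (`|w.1| * z.1 ^+ 2 / 2))
    * (laguerre alpha w.2).[`|w.1| * z.1 ^+ 2])
  * Complex (cos (w.1 * z.2)) (sin (w.1 * z.2)).

Definition fourier_laguerre (f : R * R -> R[i]) (w : R * nat) : R[i] :=
  complex_integral (laguerre_measure alpha)
    (fun z => f z * laguerre_character (- w.1, w.2) z).

(* [F] represents $\hat f$ for $f \in L^2$: the $L^2$ limit of the transforms of
   functions of $L^1 \cap L^2$ approximating [f] in $L^2$. *)
Definition is_fourier_laguerre_L2 (f : R * R -> R[i]) (F : R * nat -> R[i]) :=
  complex_Lp (plancherel_measure alpha) 2%:E F /\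
  exists u : nat -> R * R -> R[i],
    [/\ forall n, complex_Lp (laguerre_measure alpha) 1%:E (u n),
        forall n, complex_Lp (laguerre_measure alpha) 2%:E (u n),
        complex_Lnorm (laguerre_measure alpha) 2%:E
          (fun z => u n z - f z) @[n --> \oo] --> 0%E
      & complex_Lnorm (plancherel_measure alpha) 2%:E
          (fun w => fourier_laguerre (u n) w - F w) @[n --> \oo] --> 0%E].

End FourierLaguerre.

(* Main.v *)
From HB Require Import structures.
Require Import Defs.
From mathcomp Require Import ring lra.
From mathcomp Require finmap.

(** The inequality is an uncertainty principle, and it is proved by cutting at
    a radius r, first in space and then in frequency.

    Write X, A and B for the squares of the three norms: of f, of |(x,t)|^a f
    and of |(l,m)|^(b/2) F.  Let f1 be f restricted to the ball |z| <= r.  The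
    tail f - f1 has squared norm at most r^(-2a) A, so by the Plancherel
    theorem F is as close to the transform of f1.  In the dual ball
    |w| <= s the characters are bounded, uniformly over the ball of radius r,
    as soon as s r^2 <= 1; the transform of f1 is therefore bounded there by
    the L1 norm of f1, hence by a multiple of m(ball)^(1/2) X^(1/2).  The ball
    has volume O(r^(2 alpha + 4)) and the dual ball has volume
    O(s^(alpha + 2)), so with s = e / r^2 the energy of the transform of f1 in
    the dual ball is O(e X), and a small e makes it absorbable in X.  What is
    left of F lives outside the dual ball and has energy at most s^(-b) B.
    This gives X <= K (r^(-2a) A + r^(2b) B) for every r > 0
    ([dilated_uncertainty]), and the theorem is the optimal choice of r
    ([optimise_dilation]).  If A or B vanishes then so does X, because both
    homogeneous norms vanish only on null sets; if one of them is infinite and the other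
    is not 0, the right-hand side is infinite.

    Only two-sided bounds between the energies of a function and of its
    transform are used, not the exact constant of the Plancherel theorem; they
    are [plancherel_frame].  They come from an explicit computation on the span
    of the functions exp(-j x^2) exp(-k (t+N)), with x >= 0, t >= -N and
    j, k >= 1.  The transform of such an atom is explicit and depends on m only
    through the m-th power of a ratio, of modulus smaller than 1 if l is not 0,
    so the sum over m is the binomial series
    sum_m L_m(0) z^m = (1-z)^(-alpha-1), the integral over l is a Poisson
    integral, and Parseval holds exactly ([parseval_atom_sum]).  The span is an
    algebra under pointwise multiplication, so polynomials in the atoms
    approximate indicators of rectangles; a Dynkin class argument and truncation
    then give density in L1 /\ L2, and frame bounds pass to limits
    ([frame_closure]).

    The transform of real functions is handled through its cosine and sine
    parts.  For f = u + i v the two parts mix, but the mixed terms are odd in l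
    and disappear on integrating against the even Plancherel measure
    ([csq_fourier_laguerre]). *)

Set Implicit Arguments.
Unset Strict Implicit.
Unset Printing Implicit Defensive.
Import Order.TTheory GRing.Theory Num.Theory.
Import numFieldNormedType.Exports.
Local Open Scope classical_set_scope.
Local Open Scope ring_scope.

(** * Integration against the two measures *)

Section DensityMeasure.
Context d (T : measurableType d) (R : realType).
Variables (mu : {measure set T -> \bar R}) (f : T -> R).
Hypotheses (mf : measurable_fun setT f) (f_ge0 : forall x, 0 <= f x).
Local Open Scope ereal_scope.

(** The measurability and positivity proofs are arguments so that the measure
    structure can be attached to the constant. *)
Definition density_measure of measurable_fun setT f & (forall x, (0 <= f x)%R) :=
  fun A : set T => \int[mu]_(x in A) (f x)%:E.

Local Notation nu := (density_measure mf f_ge0).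

Let nu0 : nu set0 = 0.
Proof. by rewrite /density_measure integral_set0. Qed.

Let nu_ge0 A : 0 <= nu A.
Proof. by apply: integral_ge0 => x _; rewrite lee_fin. Qed.

Let nu_sigma_additive : semi_sigma_additive nu.
Proof.
apply: semi_sigma_additive_nng_induced; first exact/measurable_EFinP.
by move=> x; rewrite lee_fin.
Qed.

HB.instance Definition _ := isMeasure.Build _ _ _ nu nu0 nu_ge0
  nu_sigma_additive.

Import HBNNSimple.

Let integral_density_nnsfun (h : {nnsfun T >-> R}) :
  \int[nu]_x (h x)%:E = \int[mu]_x (h x * f x)%:E.
Proof.
rewrite integralT_nnsfun sintegralE.
transitivity (\int[mu]_x (\sum_(r \in range h)
    (r * (\1_(h @^-1` [set r]) x * f x))%:E)); last first.
  apply: eq_integral => x _. rewrite [in RHS](fimfunE h x).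
  rewrite fsbig_finite// fsbig_finite//= mulr_suml -sumEFin.
  by apply: eq_bigr => r _; rewrite mulrA.
rewrite ge0_integral_fsum//=; last 2 first.
- move=> r; apply/measurable_EFinP; apply: measurable_funM => //.
  by apply: measurable_funM => //; exact: measurable_indic.
- move=> r x _; rewrite lee_fin indicE.
  case: (boolP (x \in _)) => [|_]; last by rewrite mul0r mulr0.
  by rewrite inE/= => <-; rewrite mul1r mulr_ge0.
apply: eq_fsbigr => r _.
have [r0|r0] := leP 0%R r; last first.
  rewrite preimage_nnfun0// measure0 mule0; apply/esym/integral0_eq => x _.
  by rewrite indic0 mul0r mulr0.
under eq_integral do rewrite EFinM.
rewrite ge0_integralZl//=; last 2 first.
- apply/measurable_EFinP; apply: measurable_funM => //; exact: measurable_indic.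
- by move=> x _; rewrite lee_fin mulr_ge0// indicE.
congr (_ * _); rewrite /density_measure integral_mkcond.
apply: eq_integral => x _; rewrite patchE indicE.
by case: ifPn => _; rewrite ?mul1r ?mul0r.
Qed.

(** Monotone convergence reduces the formula to simple functions. *)
Lemma ge0_integral_density (g : T -> \bar R) :
  measurable_fun setT g -> (forall x, 0 <= g x) ->
  \int[nu]_x g x = \int[mu]_x (g x * (f x)%:E).
Proof.
move=> mg g0.
pose h := nnsfun_approx measurableT mg.
have hg x : (h n x)%:E @[n --> \oo] --> g x.
  by apply: cvg_nnsfun_approx => // *; exact: g0.
have h_nd x : {homo (fun n => (h n x)%:E) : a b / (a <= b)%N >-> a <= b}.
  by move=> a b ab; rewrite lee_fin; exact/(lefP _ _ (nd_nnsfun_approx _ _ ab)).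
have mhf n : measurable_fun setT (fun x => (h n x * f x)%:E).
  by apply/measurable_EFinP; exact: measurable_funM.
transitivity (limn (fun n => \int[nu]_x (h n x)%:E)).
  rewrite -monotone_convergence//=.
  - by apply: eq_integral => x _; apply/esym/cvg_lim.
  - by move=> n; exact/measurable_EFinP.
  - by move=> n x _; rewrite lee_fin.
transitivity (limn (fun n => \int[mu]_x (h n x * f x)%:E)); last first.
  rewrite -monotone_convergence//=.
  - apply: eq_integral => x _; apply/cvg_lim => //.
    under eq_fun do rewrite EFinM.
    by apply: cvgeZr => //; exact: hg.
  - by move=> n x _; rewrite lee_fin mulr_ge0.
  - move=> x _ a b ab; rewrite lee_fin ler_wpM2r//.
    by have := h_nd x _ _ ab; rewrite lee_fin.
by congr (limn _); apply/funext => n; exact: integral_density_nnsfun.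
Qed.

End DensityMeasure.

Section HypergroupIntegrals.
Context {R : realType}.
Variable alpha : R.
Local Notation GR := (measurableTypeR R).
Local Notation mu := (@lebesgue_measure R).
Local Open Scope ereal_scope.

(** The density of the measure in x, normalisation and half-line included; the
    variable t carries plain Lebesgue measure. *)
Definition radial_weight (x : GR) : R :=
  (\1_[set x | (0 <= x)%R] x * (x `^ (2 * alpha + 1) / (pi * Gamma (alpha + 1))))%R.

Lemma radial_weight_ge0 x : (0 <= radial_weight x)%R.
Proof.
by rewrite mulr_ge0 ?indicE// divr_ge0 ?powR_ge0// mulr_ge0 ?pi_ge0 ?Gamma_ge0.
Qed.

Lemma measurable_radial_weight : measurable_fun [set: GR] radial_weight.
Proof.
apply: measurable_funM.
  by apply: measurable_indic; rewrite -set_itvcy; exact: measurable_itv.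
by apply: measurable_funM => //; exact: measurable_powR.
Qed.

Let radial_weight_fst_ge0 (z : GR * GR) : (0 <= (radial_weight \o fst) z)%R.
Proof. exact: radial_weight_ge0. Qed.

Let measurable_radial_weight_fst :
  measurable_fun [set: GR * GR] (radial_weight \o fst).
Proof. exact: measurableT_comp measurable_radial_weight _. Qed.

Lemma ge0_integral_laguerre_measure (g : GR * GR -> \bar R) :
  measurable_fun setT g -> (forall z, 0 <= g z) ->
  \int[laguerre_measure alpha]_z g z =
  \int[mu]_x \int[mu]_t (g (x, t) * (radial_weight x)%:E).
Proof.
move=> mg g0.
rewrite (eq_measure_integral (density_measure (mu \x mu)%E
    measurable_radial_weight_fst radial_weight_fst_ge0)); last first.
  move=> A mA _; rewrite /= /laguerre_measure /density_measure integral_mkcondr.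
  apply: eq_integral => z _; rewrite patchE /radial_weight/= indicE.
  have -> : (z.1 \in [set x : R | (0 <= x)%R]) = (z \in hypergroup).
    by apply/idP/idP; rewrite !inE.
  by case: ifPn => _; rewrite ?mul1r ?mul0r.
rewrite ge0_integral_density// fubini_tonelli1//=.
- apply: emeasurable_funM => //; exact/measurable_EFinP.
- by move=> z; rewrite mule_ge0// lee_fin radial_weight_ge0.
Qed.

Definition dual_weight (l : GR) : R := `|l| `^ (alpha + 1).

Lemma dual_weight_ge0 l : (0 <= dual_weight l)%R.
Proof. exact: powR_ge0. Qed.

Lemma measurable_dual_weight : measurable_fun [set: GR] dual_weight.
Proof. exact: measurableT_comp (measurable_powR _) _. Qed.

Definition multiplicity m : R := (laguerre alpha m).[0%R].

Lemma multiplicity_ge0 m : (0 <= multiplicity m)%R.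
Proof. exact: laguerre_at0_ge0. Qed.

Let mpair (m : nat) : measurable_fun [set: GR] (pair^~ m : GR -> GR * nat).
Proof. by apply/measurable_fun_pair => /=. Qed.

Lemma ge0_integral_plancherel_measure (g : GR * nat -> \bar R) :
  measurable_fun setT g -> (forall w, 0 <= g w) ->
  \int[plancherel_measure alpha]_w g w =
  \sum_(0 <= m <oo) ((multiplicity m)%:E *
     \int[mu]_l (g (l, m) * (dual_weight l)%:E)).
Proof.
move=> mg g0.
pose nu := density_measure mu measurable_dual_weight dual_weight_ge0.
pose nu_ m : {measure set (GR * nat)%type -> \bar R} :=
  mscale (NngNum (multiplicity_ge0 m)) (pushforward nu (pair^~ m)).
rewrite (eq_measure_integral (mseries (nu_ mpair) 0)); last first.
  move=> A mA _; rewrite /= /plancherel_measure /mseries.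
  apply: eq_eseriesr => m _; rewrite /nu_ /mscale/= /pushforward.
  by rewrite /nu /density_measure ysectionE.
rewrite ge0_integral_measure_series//.
apply: eq_eseriesr => m _.
rewrite ge0_integral_mscale//= ge0_integral_pushforward//=.
congr (_ * _); rewrite preimage_setT ge0_integral_density//.
exact: measurableT_comp.
Qed.

End HypergroupIntegrals.

(** * Improper integrals and the Gamma function *)

Section ImproperIntegrals.
Context {R : realType}.
Local Notation mu := (@lebesgue_measure R).

Lemma cvg_ge0_integral_cbnd (f : R -> R) (a : R) (b : nat -> R) :
  (forall x, a <= x -> 0 <= f x) -> measurable_fun `[a, +oo[ f ->
  nondecreasing_seq b -> b n @[n --> \oo] --> +oo ->
  (\int[mu]_(x in `[a, b n]) (f x)%:E @[n --> \oo] -->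
   \int[mu]_(x in `[a, +oo[) (f x)%:E)%E.
Proof.
move=> f0 mf nd_b by_.
have -> : `[a, +oo[%classic = \bigcup_n `[a, b n]%classic.
  apply/seteqP; split=> [x|x [n _]]/=; rewrite !in_itv/= ?andbT;
    last by move=> /andP[].
  move=> ax.
  have /cvgryPge/(_ x)[n _ bn] := by_.
  by exists n => //=; rewrite in_itv/= ax bn/=.
have sub n : `[a, b n]%classic `<=` `[a, +oo[%classic.
  by move=> x /=; rewrite !in_itv/= => /andP[->].
apply: ge0_nondecreasing_set_cvg_integral => //.
- move=> m n mn; apply/subsetPset => x/=; rewrite !in_itv/= => /andP[-> xb]/=.
  by rewrite (le_trans xb)// nd_b.
- by move=> n; apply/measurable_EFinP; exact: measurable_funS (sub n) mf.
- by move=> n x /=; rewrite in_itv/= lee_fin => /andP[ax _]; exact: f0.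
Qed.

(** A fundamental theorem of calculus on a half-line when the derivative is a
    difference f - g of nonnegative functions.  Moving the boundary terms across
    avoids any integrability assumption, so that both integrals may be infinite;
    finiteness of one gives that of the other. *)
Lemma ge0_FTC2y_diff (f g F : R -> R) (a l : R) :
  (forall x, a <= x -> 0 <= f x) -> (forall x, a <= x -> 0 <= g x) ->
  {within `[a, +oo[, continuous f} -> {within `[a, +oo[, continuous g} ->
  F x @[x --> +oo] --> l ->
  (forall x, a < x -> is_derive x 1 F (f x - g x)) ->
  F x @[x --> a^'+] --> F a ->
  (\int[mu]_(x in `[a, +oo[) (f x)%:E + (F a)%:E =
   \int[mu]_(x in `[a, +oo[) (g x)%:E + l%:E)%E.
Proof.
move=> f0 g0 cf cg Fl dF Fa.
have meas (h : R -> R) : {within `[a, +oo[, continuous h} -> measurable_fun `[a, +oo[ h.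
  by move=> ch; apply: subspace_continuous_measurable_fun.
pose b n : R := a + n.+1%:R.
have ab n : a < b n by rewrite ltrDl.
have nd_b : nondecreasing_seq b by move=> m n mn; rewrite lerD2l ler_nat.
have by_ : b n @[n --> \oo] --> +oo.
  apply/cvgryPge => A; near=> n; rewrite /b -lerBlDl (le_trans (ler_norm _))//.
  near: n; exists (Num.truncn `|A - a|) => // n /= le_n.
  by rewrite ltW// (lt_le_trans (truncnS_gt _))// ler_nat.
have sub n : `[a, b n]%classic `<=` `[a, +oo[%classic.
  by move=> x /=; rewrite !in_itv/= => /andP[->].
have cvgF := cvg_ge0_integral_cbnd f0 (meas _ cf) nd_b by_.
have cvgG := cvg_ge0_integral_cbnd g0 (meas _ cg) nd_b by_.
have Fb : (F (b n))%:E @[n --> \oo] --> l%:E.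
  by apply: cvg_EFin; [exact: nearW|exact: (cvg_comp _ _ by_ Fl)].
have FTCn n : (\int[mu]_(x in `[a, b n]) (f x)%:E + (F a)%:E =
   \int[mu]_(x in `[a, b n]) (g x)%:E + (F (b n))%:E)%E.
  have If (h : R -> R) : {within `[a, +oo[, continuous h} ->
      mu.-integrable `[a, b n] (EFin \o h).
    move=> ch; apply: continuous_compact_integrable; first exact: segment_compact.
    exact: continuous_subspaceW ch.
  have := @continuous_FTC2 R (f \- g) F a (b n) (ab n).
  have -> : (\int[mu]_(x in `[a, b n]) ((f \- g) x)%:E =
    \int[mu]_(x in `[a, b n]) (f x)%:E - \int[mu]_(x in `[a, b n]) (g x)%:E)%E.
    by rewrite -integralB_EFin//; [exact: If|exact: If].
  move=> FTC; have {}FTC := FTC _ _ _.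
  have ff : (\int[mu]_(x in `[a, b n]) (f x)%:E \is a fin_num)%E.
    by apply: integrable_fin_num => //; exact: If.
  have gg : (\int[mu]_(x in `[a, b n]) (g x)%:E \is a fin_num)%E.
    by apply: integrable_fin_num => //; exact: If.
  move: ff gg FTC => /=.
  case: (\int[mu]_(x in `[a, b n]) (f x)%:E)%E => // u _.
  case: (\int[mu]_(x in `[a, b n]) (g x)%:E)%E => // v _.
  move=> FTC; rewrite -!EFinD; congr EFin.
  suff : u - v = F (b n) - F a by move=> uv; rewrite -[u](subrK v) uv; ring.
  apply: EFin_inj; apply: FTC.
  - apply: continuous_subspaceW (sub n) _ => x.
    by apply: continuousB; [exact: cf|exact: cg].
  - split => [x| |].
    + by rewrite in_itv/= => /andP[ax _]; have [] := dF x ax.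
    + exact: Fa.
    + apply: cvg_at_left_filter.
      by have [/derivable1_diffP/differentiable_continuous] := dF _ (ab n).
  - by move=> x; rewrite in_itv/= => /andP[ax _]; rewrite derive1E; have [] := dF x ax.
have cF : ((\int[mu]_(x in `[a, b n]) (f x)%:E + (F a)%:E)%E @[n --> \oo] -->
    (\int[mu]_(x in `[a, +oo[) (f x)%:E + (F a)%:E)%E).
  by apply: cvgeD => //; [rewrite fin_num_adde_defl|exact: cvg_cst].
have cG : ((\int[mu]_(x in `[a, b n]) (f x)%:E + (F a)%:E)%E @[n --> \oo] -->
    (\int[mu]_(x in `[a, +oo[) (g x)%:E + l%:E)%E).
  under eq_fun do rewrite FTCn.
  by apply: cvgeD => //; rewrite fin_num_adde_defl.
by rewrite -(cvg_lim _ cF)//; exact: cvg_lim.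
Unshelve. all: end_near. Qed.

End ImproperIntegrals.

Section GammaFunction.
Context {R : realType}.
Local Notation mu := (@lebesgue_measure R).
Implicit Types (s x b c : R).

(** From ln y <= y at y = x / (2 s), multiplied by s and exponentiated. *)
Lemma powR_le_expR s x : 0 < s -> 0 <= x ->
  x `^ s <= (2 * s) `^ s * expR (x / 2).
Proof.
move=> s0; rewrite le_eqVlt => /predU1P[<-|x0].
  by rewrite powR0 ?gt_eqF// mulr_ge0 ?powR_ge0 ?expR_ge0.
have xs0 : 0 < x / (2 * s) by rewrite divr_gt0// mulr_gt0.
have -> : x `^ s = (2 * s) `^ s * (x / (2 * s)) `^ s.
  rewrite -powRM ?(ltW xs0) ?mulr_ge0 ?(ltW s0)// mulrC divfK//.
  by rewrite gt_eqF// mulr_gt0.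
rewrite ler_wpM2l ?powR_ge0//.
rewrite /powR gt_eqF// ler_expR (le_trans (y := s * (x / (2 * s))))//.
  by rewrite ler_wpM2l ?(ltW s0)//; exact/ltW/ln_sublinear.
by rewrite le_eqVlt; apply/orP; left; apply/eqP; field; rewrite gt_eqF.
Qed.

Lemma cvg_expR_half : expR (- (x / 2)) @[x --> +oo] --> (0 : R).
Proof.
apply: (@cvg_comp _ _ _ (fun x : R => x / 2) (fun x => expR (- x)) _ (pinfty_nbhs R)).
  by apply: gt0_cvgMly => //; rewrite invr_gt0.
exact: cvgr_expR.
Qed.

Lemma cvg_powR_expR0 s : 0 < s -> x `^ s * expR (- x) @[x --> +oo] --> 0.
Proof.
move=> s0.
apply: (@squeeze_cvgr _ _ _ _ (cst 0) (fun x => (2 * s) `^ s * expR (- (x / 2)))).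
- near=> x; rewrite mulr_ge0 ?powR_ge0 ?expR_ge0//=.
  have x0 : 0 <= x by near: x; exact: nbhs_pinfty_ge.
  rewrite [X in expR (- X)](splitr x) opprD expRD mulrA ler_wpM2r ?expR_ge0//.
  rewrite -(@ler_pM2r _ (expR (x / 2))) ?expR_gt0// -!mulrA -expRD addNr expR0.
  by rewrite mulr1 powR_le_expR.
- exact: cvg_cst.
- by rewrite -[X in _ --> X](mulr0 ((2 * s) `^ s)); apply: cvgMr; exact: cvg_expR_half.
Unshelve. all: end_near. Qed.

Lemma continuous_powR_gt0 s x : 0 < x -> {for x, continuous (fun y : R => y `^ s)}.
Proof.
move=> x0; apply: differentiable_continuous; apply/derivable1_diffP.
by apply: derivable_powR; rewrite in_itv/= x0.
Qed.

Lemma cvg_powR_at_right0 s : 0 <= s -> x `^ s @[x --> 0^'+] --> 0 `^ s.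
Proof.
rewrite le_eqVlt => /predU1P[<-|s0].
  by under eq_fun do rewrite powRr0; rewrite powRr0; exact: cvg_cst.
by rewrite powR0 ?gt_eqF//; exact: powR_cvg0.
Qed.

Lemma within_continuous_powR s : 0 <= s ->
  {within `[0, +oo[, continuous (fun y : R => y `^ s)}.
Proof.
move=> s0; apply/continuous_within_itvcyP; split.
  by move=> x; rewrite in_itv/= andbT => x0; exact: continuous_powR_gt0.
exact: cvg_powR_at_right0.
Qed.

Lemma within_continuous_gamma s : 0 <= s ->
  {within `[0, +oo[, continuous (fun t => t `^ s * expR (- t))}.
Proof.
move=> s0 x; apply: cvgM; first exact: within_continuous_powR.
apply: continuous_subspaceT => y; apply: continuous_comp; first exact: continuousN.
exact: continuous_expR.
Qed.

Lemma measurable_gamma (D : set (measurableTypeR R)) s :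
  measurable_fun D (fun t : measurableTypeR R => t `^ s * expR (- t)).
Proof.
apply: measurable_funTS; apply: measurable_funM; first exact: measurable_powR.
by apply: measurableT_comp => //; exact: measurable_expR.
Qed.

Lemma integral_expR_half : (\int[mu]_(x in `[0%R, +oo[) (expR (- (x / 2)))%:E = 2%:E)%E.
Proof.
have dF x : is_derive x (1:R) (fun x => - (2 * expR (- (x / 2)))) (expR (- (x / 2))).
  apply: is_derive_eq; rewrite /GRing.scale/=; by field.
have cF : continuous (fun x : R => - (2 * expR (- (x / 2)))).
  by move=> x; apply: differentiable_continuous; apply/derivable1_diffP; have [] := dF x.
rewrite (@ge0_continuous_FTC2y _ (fun x => expR (- (x / 2))) (fun x => - (2 * expR (- (x / 2)))) 0 0)//.
- by rewrite mul0r oppr0 expR0 mulr1 EFinN oppeK add0e.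
- apply: continuous_subspaceT => x.
  apply: differentiable_continuous; apply/derivable1_diffP; exact: ex_derive.
- rewrite -oppr0; apply: cvgN; rewrite -[X in _ --> X](mulr0 2).
  by apply: cvgMr; exact: cvg_expR_half.
- by apply: cvg_at_right_filter; exact: cF.
- by move=> x _; rewrite derive1E; have [] := dF x.
Qed.

(** The integral defining Gamma is finite, by comparison with exp(-t/2); this is
    what turns the real-valued definition into an identity of extended reals. *)
Lemma integral_Gamma s : 0 <= s ->
  (\int[mu]_(t in `[0%R, +oo[) (t `^ s * expR (- t))%:E = (Gamma (s + 1))%:E)%E.
Proof.
move=> s0.
rewrite /Gamma /Rintegral addrK integral_itv_obnd_cbnd; last first.
  by apply/measurable_EFinP; exact: measurable_gamma.
rewrite fineK// fin_numElt (lt_le_trans (ltNyr 0))/=; last first.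
  by apply: integral_ge0 => x _; rewrite lee_fin mulr_ge0 ?powR_ge0 ?expR_ge0.
have [C C0 HC] : exists2 C : R, 0 <= C & forall x, 0 <= x -> x `^ s <= C * expR (x / 2).
  move: s0; rewrite le_eqVlt => /predU1P[<-|s0].
    exists 1 => // x x0; rewrite powRr0 mul1r.
    by rewrite (le_trans _ (expR_ge1Dx _))// lerDl divr_ge0.
  by exists ((2 * s) `^ s); [exact: powR_ge0|move=> x; exact: powR_le_expR].
apply: (@le_lt_trans _ _ (\int[mu]_(t in `[0%R, +oo[) (C%:E * (expR (- (t / 2)))%:E))%E).
  apply: ge0_le_integral => //=.
  - by move=> x _; rewrite lee_fin mulr_ge0 ?powR_ge0 ?expR_ge0.
  - by apply/measurable_EFinP; exact: measurable_gamma.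
  - apply/measurable_EFinP; apply: measurable_funM => //.
    apply/measurable_funTS/measurableT_comp; first exact: measurable_expR.
    by apply: measurableT_comp => //; exact: measurable_funM.
  - move=> x; rewrite in_itv/= andbT => x0; rewrite -EFinM lee_fin.
    rewrite [X in expR (- X)](splitr x) opprD expRD mulrA ler_wpM2r ?expR_ge0//.
    rewrite -(@ler_pM2r _ (expR (x / 2))) ?expR_gt0// -!mulrA -expRD addNr expR0.
    by rewrite mulr1 HC.
rewrite ge0_integralZl//=.
- by rewrite integral_expR_half -EFinM ltry.
- apply/measurable_EFinP.
  apply/measurable_funTS/measurableT_comp; first exact: measurable_expR.
  by apply: measurableT_comp => //; exact: measurable_funM.
Qed.

(** Integration by parts: (s+1) t^s e^(-t) - t^(s+1) e^(-t) is the derivative of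
    t^(s+1) e^(-t), which vanishes at both ends. *)
Lemma GammaS s : 0 <= s -> Gamma (s + 1 + 1) = (s + 1) * Gamma (s + 1).
Proof.
move=> s0; have s1 : 0 < s + 1 by rewrite ltr_wpDl.
apply: EFin_inj; rewrite EFinM -!integral_Gamma// ?ltW//.
rewrite -ge0_integralZl//=; last 3 first.
- by apply/measurable_EFinP; exact: measurable_gamma.
- by move=> x _; rewrite lee_fin mulr_ge0 ?powR_ge0 ?expR_ge0.
- by rewrite lee_fin ltW.
apply/esym.
have := @ge0_FTC2y_diff R (fun t => (s + 1) * (t `^ s * expR (- t)))
  (fun t => t `^ (s + 1) * expR (- t)) (fun t => t `^ (s + 1) * expR (- t)) 0 0.
rewrite powR0 ?gt_eqF// mul0r !adde0; apply => //.
- by move=> x _; rewrite mulr_ge0 ?(ltW s1)// mulr_ge0 ?powR_ge0 ?expR_ge0.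
- by move=> x _; rewrite mulr_ge0 ?powR_ge0 ?expR_ge0.
- by move=> x; apply: cvgM; [exact: cvg_cst|exact: within_continuous_gamma].
- by apply: within_continuous_gamma; exact: ltW.
- exact: cvg_powR_expR0.
- move=> x x0.
  have dp : is_derive x 1 (fun y : R => y `^ (s + 1)) ((s + 1) * x `^ s).
    apply: DeriveDef; first by apply: derivable_powR; rewrite in_itv/= x0.
    by rewrite -derive1E powR_derive1 ?in_itv/= ?x0// addrK.
  apply: is_derive_eq; rewrite /GRing.scale/=; ring.
- rewrite -[X in _ --> X](mul0r (expR (- 0))); apply: cvgM.
    by rewrite -[X in _ --> X](@powR0 R (s + 1)) ?gt_eqF//; apply: cvg_powR_at_right0; exact: ltW.
  apply: cvg_at_right_filter; apply: continuous_comp; first exact: continuousN.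
  exact: continuous_expR.
Qed.

Lemma Gamma_gt0 s : 0 <= s -> 0 < Gamma (s + 1).
Proof.
move=> s0; rewrite -lte_fin -integral_Gamma//.
apply: (@lt_le_trans _ _ (\int[mu]_(t in `[1%R, 2%R]) (expR (- 2))%:E)%E).
  rewrite integral_cst//= lebesgue_measure_itv/= lte_fin ltr1n/= -EFinD.
  by rewrite -EFinM lte_fin mulr_gt0 ?expR_gt0//; lra.
apply: (@le_trans _ _ (\int[mu]_(t in `[1%R, 2%R]) (t `^ s * expR (- t))%:E)%E).
  apply: ge0_le_integral => //=.
  - by apply/measurable_EFinP; exact: measurable_gamma.
  - move=> x; rewrite in_itv/= lee_fin => /andP[x1 x2].
    rewrite -[leLHS]mul1r ler_pM ?expR_ge0 ?ler_expR ?lerN2//.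
    by rewrite -(powRr0 x) ler_powR.
apply: ge0_subset_integral => //=.
- by apply/measurable_EFinP; exact: measurable_gamma.
- by move=> x _; rewrite lee_fin mulr_ge0 ?powR_ge0 ?expR_ge0.
- by move=> x /=; rewrite !in_itv/= andbT => /andP[x1 _]; rewrite (le_trans _ x1).
Qed.

(** Substitute y = c x^2 in the Gamma integral, on segments [0, n] first. *)
Lemma integral_gaussian_moment s c : 0 <= s -> 0 < c ->
  (\int[mu]_(x in `[0%R, +oo[) (x `^ (2 * s + 1) * expR (- (c * x ^+ 2)))%:E =
   (Gamma (s + 1) / (2 * c `^ (s + 1)))%:E)%E.
Proof.
move=> s0 c0.
have cs0 : 0 < 2 * c `^ (s + 1) by rewrite mulr_gt0// powR_gt0.
pose G (y : R) := y `^ s * expR (- y).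
pose F (x : R) := c * x ^+ 2.
pose g (x : measurableTypeR R) := (x `^ (2 * s + 1) * expR (- (c * x ^+ 2))).
have mg D : measurable_fun D g.
  apply: measurable_funTS; apply: measurable_funM; first exact: measurable_powR.
  apply: measurableT_comp; first exact: measurable_expR.
  apply: measurableT_comp => //; exact: measurable_funM.
have g0 x : 0 <= g x by rewrite mulr_ge0 ?powR_ge0 ?expR_ge0.
have dF x : is_derive x (1 : R) F (2 * c * x).
  by apply: is_derive_eq; rewrite /GRing.scale/=; ring.
have F'E : F^`()%classic = (fun x => 2 * c * x).
  by apply/funext => x; rewrite derive1E; have [] := dF x.
have cF' : continuous (fun x => 2 * c * x).
  by move=> x; apply: cvgM; [exact: cvg_cst|exact: cvg_id].
have cF : continuous F.
  by move=> x; apply: differentiable_continuous; apply/derivable1_diffP; have [] := dF x.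
pose b n : R := n%:R.
have by_ : b n @[n --> \oo] --> +oo by exact: cvgr_idn.
have Fby : F (b n) @[n --> \oo] --> +oo.
  apply: (@ger_cvgy _ _ _ _ (fun n => c * n%:R)).
    apply: nearW => n; rewrite /F /b ler_wpM2l ?(ltW c0)// -natrX ler_nat.
    by case: n => // n; rewrite expnS expn1 leq_pmulr.
  apply: (@cvg_comp _ _ _ (fun n : nat => n%:R : R) (fun x : R => c * x) _ (pinfty_nbhs R)); first exact: cvgr_idn.
  by apply: gt0_cvgMry => //; exact: cvg_id.
have nd_b : nondecreasing_seq b by move=> m n; rewrite ler_nat.
have nd_Fb : nondecreasing_seq (F \o b).
  move=> m n mn /=; rewrite /F ler_wpM2l ?(ltW c0)// ler_pXn2r ?nnegrE ?ler0n//.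
  by rewrite ler_nat.
have c1 := @cvg_ge0_integral_cbnd R G 0 (F \o b) _ _ nd_Fb Fby.
have c2 := @cvg_ge0_integral_cbnd R (fun x => 2 * c `^ (s + 1) * g x) 0 b _ _ nd_b by_.
have sub n : (\int[mu]_(x in `[0%R, F (b n)]) (G x)%:E =
    \int[mu]_(x in `[0%R, b n]) (2 * c `^ (s + 1) * g x)%:E)%E.
  have := @integration_by_substitution_increasing R F G 0 (b n).
  have F0 : F 0 = 0 by rewrite /F expr0n mulr0.
  rewrite F0 => -> //; last 6 first.
  - move=> x y; rewrite !in_itv/= => /andP[x0 _] /andP[y0 _] xy.
    by rewrite /F ltr_pM2l// ltr_pXn2r.
  - by rewrite F'E => x _; exact: cF'.
  - by rewrite F'E; apply/cvg_ex; eexists; apply: cvg_at_right_filter; exact: cF'.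
  - by rewrite F'E; apply/cvg_ex; eexists; apply: cvg_at_left_filter; exact: cF'.
  - split.
    + by move=> x _; have [] := dF x.
    + by apply: cvg_at_right_filter; exact: cF.
    + by apply: cvg_at_left_filter; exact: cF.
  - apply: continuous_subspaceW (within_continuous_gamma s0) => x /=.
    by rewrite !in_itv/= andbT => /andP[].
  apply: eq_integral => x; rewrite inE/= in_itv/= => /andP[x0 _]; congr EFin.
  rewrite F'E fctE /= /G /F /g powRM ?(ltW c0) ?sqr_ge0//.
  have -> : (x ^+ 2) `^ s = x `^ (2 * s) by rewrite powRrM powR_mulrn.
  have -> : x `^ (2 * s + 1) = x `^ (2 * s) * x.
    rewrite powRD ?powRr1//; apply/implyP => /eqP H; exfalso; lra.
  have -> : c `^ (s + 1) = c `^ s * c.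
    by rewrite powRD ?powRr1 ?(ltW c0)// (gt_eqF c0) implybT.
  by ring.
have {}c1 := c1 (fun x _ => mulr_ge0 (powR_ge0 _ _) (expR_ge0 _)) (@measurable_gamma _ s).
have {}c2 : ((\int[mu]_(x in `[0%R, b n]) (2 * c `^ (s + 1) * g x)%:E)%E @[n --> \oo] -->
    (\int[mu]_(x in `[0%R, +oo[) (2 * c `^ (s + 1) * g x)%:E)%E).
  apply: c2 => [x _|]; first by rewrite mulr_ge0// ltW.
  by apply: measurable_funM => //; exact: mg.
have KI : ((2 * c `^ (s + 1))%:E * \int[mu]_(x in `[0%R, +oo[) (g x)%:E =
    (Gamma (s + 1))%:E)%E.
  rewrite -ge0_integralZl//=; last 3 first.
  - by apply/measurable_EFinP; exact: mg.
  - by move=> x _; rewrite lee_fin.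
  - by rewrite lee_fin ltW.
  rewrite -integral_Gamma// -(cvg_lim _ c1)//; apply/esym.
  by under eq_fun do rewrite /= sub; exact/cvg_lim.
transitivity (((2 * c `^ (s + 1))^-1)%:E * (Gamma (s + 1))%:E)%E.
  by rewrite -KI muleA -EFinM mulVf ?gt_eqF// mul1e.
by rewrite -EFinM mulrC.
Qed.

End GammaFunction.

(** * Multiplicities and the binomial series *)

Section RadialTransform.
Context {R : realType}.
Variable alpha : R.
Hypothesis alpha_ge0 : 0 <= alpha.
Local Notation mu := (@lebesgue_measure R).

Let natalpha_ge0 m : 0 <= m%:R + alpha. Proof. by rewrite addr_ge0. Qed.

Lemma multiplicityE m : multiplicity alpha m =
  Gamma (m%:R + alpha + 1) / (Gamma (alpha + 1) * m`!%:R).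
Proof. exact: laguerre_at0. Qed.

Lemma multiplicity0 : multiplicity alpha 0 = 1.
Proof. by rewrite multiplicityE add0r fact0 mulr1 divff// gt_eqF// Gamma_gt0. Qed.

Lemma multiplicityS m :
  multiplicity alpha m.+1 = multiplicity alpha m * (1 + alpha / m.+1%:R).
Proof.
rewrite !multiplicityE.
have -> : m.+1%:R + alpha + 1 = m%:R + alpha + 1 + 1 by rewrite -natr1; ring.
rewrite GammaS// factS natrM -natr1.
have G0 : Gamma (alpha + 1) != 0 by rewrite gt_eqF// Gamma_gt0.
have f0 : m`!%:R != 0 :> R by rewrite pnatr_eq0 -lt0n fact_gt0.
have m0 : m%:R + 1 != 0 :> R by rewrite natr1 pnatr_eq0.
by field; rewrite G0 f0 m0.
Qed.

(** The exponent 2 s + 1 is that of the radial measure of order s. *)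
Definition gaussian_moment (s c x : R) : R :=
  x `^ (2 * s + 1) * expR (- (c * x ^+ 2)).

Lemma measurable_gaussian_moment s c (D : set (measurableTypeR R)) :
  measurable_fun D (gaussian_moment s c : measurableTypeR R -> R).
Proof.
apply: measurable_funTS; apply: measurable_funM; first exact: measurable_powR.
apply: measurableT_comp; first exact: measurable_expR.
by apply: measurableT_comp => //; exact: measurable_funM.
Qed.

Lemma gaussian_moment_ge0 s c x : 0 <= gaussian_moment s c x.
Proof. by rewrite mulr_ge0 ?powR_ge0 ?expR_ge0. Qed.

Lemma integrable_gaussian_moment s c : 0 <= s -> 0 < c ->
  mu.-integrable `[0, +oo[ (EFin \o gaussian_moment s c).
Proof.
move=> s0 c0; apply/integrableP; split.
  by apply/measurable_EFinP; exact: measurable_gaussian_moment.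
under eq_integral do rewrite /= ger0_norm ?gaussian_moment_ge0//.
by rewrite integral_gaussian_moment// ltry.
Qed.

Lemma gaussian_momentD s c m x : 0 <= s -> 0 <= x ->
  gaussian_moment (m%:R + s) c x = x ^+ 2 ^+ m * gaussian_moment s c x.
Proof.
move=> s0 x0; rewrite /gaussian_moment [RHS]mulrA; congr (_ * _).
have -> : 2 * (m%:R + s) + 1 = m%:R * 2 + (2 * s + 1) by ring.
rewrite powRD; last by apply/implyP => /eqP; have := ler0n R m; lra.
have -> : m%:R * 2 = (2 * m)%:R :> R by rewrite natrM mulrC.
by rewrite powR_mulrn// exprM.
Qed.

Lemma normr_series_exp_coeff_le (y : R) n :
  `|series (exp_coeff y) n| <= expR `|y|.
Proof.
apply: (@le_trans _ _ (series (exp_coeff `|y|) n)).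
  rewrite /series/= (le_trans (ler_norm_sum _ _ _))//; apply: ler_sum => m _.
  by rewrite /exp_coeff/= normrM normrX normfV normr_nat.
apply: nondecreasing_cvgn_le; last exact: is_cvg_series_exp_coeff.
apply/nondecreasing_seqP => k; rewrite /series/= big_nat_recr//= lerDl.
exact: exp_coeff_ge0.
Qed.

(** Expand exp(z x^2) in x^(2 alpha + 1) exp(-x^2) exp(z x^2): the m-th term
    integrates to a multiple of L_m(0) z^m, the whole to a Gaussian moment with
    parameter 1 - z.  The convergence is dominated by the same function with |z| for z. *)
Lemma multiplicity_series (z : R) : `|z| < 1 ->
  [series multiplicity alpha m * z ^+ m]_m @ \oo -->
  (1 - z) `^ (- (alpha + 1)).
Proof.
move=> z1.
have z1' : 0 < 1 - z by rewrite subr_gt0 (le_lt_trans (ler_norm _)).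
have a1 : 0 < alpha + 1 by rewrite ltr_wpDl.
have Ga := Gamma_gt0 alpha_ge0.
pose S n (x : measurableTypeR R) : R := \sum_(0 <= m < n) (z ^+ m / m`!%:R * gaussian_moment (m%:R + alpha) 1 x).
have ISn n : (\int[mu]_(x in `[0%R, +oo[) (S n x)%:E =
    (Gamma (alpha + 1) / 2 * \sum_(0 <= m < n) multiplicity alpha m * z ^+ m)%:E)%E.
  rewrite /S; under eq_integral do rewrite -sumEFin.
  rewrite integral_sum//=; last first.
    move=> m; have I := integrable_gaussian_moment (natalpha_ge0 m) (@ltr01 R).
    have := @integrableZl _ _ _ mu _ (measurable_itv `[0, +oo[) (z ^+ m / m`!%:R) _ I.
    apply: eq_integrable => //.
  rewrite mulr_sumr -sumEFin; apply: eq_bigr => m _.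
  under eq_integral do rewrite EFinM.
  rewrite integralZl//; last exact: integrable_gaussian_moment.
  rewrite integral_gaussian_moment// powR1 mulr1 -EFinM; congr EFin.
  rewrite multiplicityE.
  have f0 : m`!%:R != 0 :> R by rewrite pnatr_eq0 -lt0n fact_gt0.
  by field; rewrite f0 (gt_eqF Ga).
have mS n : measurable_fun (`[0%R, +oo[%classic : set (measurableTypeR R)) (S n).
  apply: measurable_sum => m; apply: measurable_funM => //.
  exact: measurable_gaussian_moment.
have SE n x : 0 <= x -> S n x = gaussian_moment alpha 1 x * series (exp_coeff (z * x ^+ 2)) n.
  move=> x0; rewrite /S /series/= mulr_sumr; apply: eq_bigr => m _.
  rewrite gaussian_momentD// exp_coeffE; move: (x ^+ 2) => y; rewrite exprMn; ring.
have gE y x : gaussian_moment alpha 1 x * expR (y * x ^+ 2) = gaussian_moment alpha (1 - y) x.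
  by rewrite /gaussian_moment -mulrA -expRD; congr (_ * expR _); ring.
have mg c : measurable_fun (`[0%R, +oo[%classic : set (measurableTypeR R)) (EFin \o gaussian_moment alpha c).
  by apply/measurable_EFinP; exact: measurable_gaussian_moment.
have cv : ((\int[mu]_(x in `[0%R, +oo[) (S n x)%:E)%E @[n --> \oo] -->
    (\int[mu]_(x in `[0%R, +oo[) (gaussian_moment alpha (1 - z) x)%:E)%E).
  apply: (@dominated_cvg _ _ _ mu `[0%R, +oo[ _ _ _ (EFin \o gaussian_moment alpha (1 - `|z|))) => //=.
  - by move=> n; apply/measurable_EFinP; exact: mS.
  - move=> x; rewrite in_itv/= andbT => x0.
    apply: cvg_EFin; first exact: nearW.
    under eq_fun do rewrite /= SE//.
    rewrite -gE; apply: cvgM; first exact: cvg_cst.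
    exact: is_cvg_series_exp_coeff.
  - by apply: integrable_gaussian_moment => //; rewrite subr_gt0.
  - move=> n x; rewrite in_itv/= andbT lee_fin => x0.
    rewrite SE// normrM ger0_norm ?gaussian_moment_ge0// -gE.
    rewrite ler_wpM2l ?gaussian_moment_ge0//.
    by rewrite (le_trans (normr_series_exp_coeff_le _ _))// normrM [`|x ^+ 2|]ger0_norm ?sqr_ge0.
rewrite integral_gaussian_moment// in cv.
move: cv; under eq_fun do rewrite ISn; move=> /fine_cvg/=.
move=> /(cvgM (cvg_cst (2 / Gamma (alpha + 1)))).
rewrite powRN.
have -> : 2 / Gamma (alpha + 1) * (Gamma (alpha + 1) / (2 * (1 - z) `^ (alpha + 1))) =
    ((1 - z) `^ (alpha + 1))^-1.
  by field; rewrite (gt_eqF Ga) gt_eqF// powR_gt0.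
apply: cvg_trans; apply: near_eq_cvg; apply: nearW => n /=.
by rewrite /series/= mulrA; field; rewrite (gt_eqF Ga).
Qed.

End RadialTransform.

(** * The radial part of the characters *)

Section RadialCharacter.
Context {R : realType}.
Variable alpha : R.
Hypothesis alpha_ge0 : 0 <= alpha.
Local Notation mu := (@lebesgue_measure R).

Let natalpha_ge0 m : 0 <= m%:R + alpha. Proof. by rewrite addr_ge0. Qed.

Let Gamma_neq0 m : Gamma (m%:R + alpha + 1) != 0.
Proof. by rewrite gt_eqF// Gamma_gt0. Qed.

(** The character of parameter (l, m) is this real factor, at |l|, times a phase
    in t. *)
Definition radial_character (l : R) (m : nat) (x : R) : R :=
  m`!%:R * Gamma (alpha + 1) / Gamma (m%:R + alpha + 1)
    * expR (- (l * x ^+ 2 / 2)) * (laguerre alpha m).[l * x ^+ 2].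

Lemma normalized_laguerreE m u :
  m`!%:R * Gamma (alpha + 1) / Gamma (m%:R + alpha + 1) * (laguerre alpha m).[u] =
  \sum_(k < m.+1) 'C(m, k)%:R * (Gamma (alpha + 1) / Gamma (k%:R + alpha + 1)) * (- u) ^+ k.
Proof.
rewrite horner_poly mulr_sumr; apply: eq_bigr => k _.
have km : (k <= m)%N by rewrite -ltnS.
rewrite -(bin_fact km) !natrM -[- u]mulN1r exprMn.
have f0 n : n`!%:R != 0 :> R by rewrite pnatr_eq0 -lt0n fact_gt0.
by field; rewrite !f0 !Gamma_neq0.
Qed.

(** Gamma (s + 1) >= Gamma s as soon as s >= 1, which alpha >= 0 guarantees. *)
Lemma Gamma_ratio_itv k : 0 <= Gamma (alpha + 1) / Gamma (k%:R + alpha + 1) <= 1.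
Proof.
rewrite divr_ge0 ?Gamma_ge0//= ler_pdivrMr ?Gamma_gt0// mul1r.
elim: k => [|k IH]; first by rewrite add0r.
have -> : k.+1%:R + alpha + 1 = k%:R + alpha + 1 + 1 by rewrite -natr1; ring.
rewrite GammaS// (le_trans IH)// ler_peMl ?Gamma_ge0//.
by rewrite lerDr.
Qed.

Lemma normalized_laguerre_le m u : 0 <= u ->
  `|m`!%:R * Gamma (alpha + 1) / Gamma (m%:R + alpha + 1) * (laguerre alpha m).[u]| <=
  (1 + u) ^+ m.
Proof.
move=> u0; rewrite normalized_laguerreE (le_trans (ler_norm_sum _ _ _))//.
rewrite exprDn; apply: ler_sum => k _; rewrite expr1n mul1r -[leRHS]mulr_natl.
have /andP[g0 g1] := Gamma_ratio_itv k.
rewrite normrM normrX normrN (ger0_norm u0) ger0_norm ?(mulr_ge0 _ g0)//.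
by rewrite ler_wpM2r ?exprn_ge0// ler_piMr.
Qed.

(** The normalised coefficients of L_m are bounded by binomial coefficients, so
    |L_m(u)| / L_m(0) <= (1 + u)^m.  The bound is crude for large u but is within
    a constant of 1 when m l x^2 is bounded, which is the case in the dual ball
    of radius r^(-2) when x <= r. *)
Lemma radial_character_le_exp l m x : 0 <= l ->
  `|radial_character l m x| <= expR (m%:R * (l * x ^+ 2)).
Proof.
move=> l0; set u := l * x ^+ 2.
have u0 : 0 <= u by rewrite mulr_ge0 ?sqr_ge0.
rewrite /radial_character mulrAC normrM (ger0_norm (expR_ge0 _)).
rewrite -[leRHS]mulr1 ler_pM//; last by rewrite expR_le1 oppr_le0 divr_ge0.
rewrite (le_trans (normalized_laguerre_le _ u0))// expRM_natl.
by rewrite lerXn2r ?nnegrE ?expR_ge0 ?addr_ge0 ?expR_ge1Dx.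
Qed.

(** For fixed m the Gaussian factor absorbs the polynomial growth. *)
Lemma radial_character_bounded m :
  exists2 C, 0 <= C & forall l x, 0 <= l -> `|radial_character l m x| <= C.
Proof.
exists (2 ^+ m * m`!%:R * expR (2^-1)).
  by rewrite !mulr_ge0 ?exprn_ge0 ?expR_ge0.
move=> l x l0; set u := l * x ^+ 2.
have u0 : 0 <= u by rewrite mulr_ge0 ?sqr_ge0.
rewrite /radial_character mulrAC normrM (ger0_norm (expR_ge0 _)).
rewrite (le_trans (ler_wpM2r (expR_ge0 _) (normalized_laguerre_le _ u0)))//.
rewrite -(@ler_pM2r _ (expR (u / 2))) ?expR_gt0// -[leLHS]mulrA -expRD addNr expR0 mulr1.
rewrite -[leRHS]mulrA -expRD.
have -> : 2^-1 + u / 2 = (1 + u) / 2 by ring.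
have v0 : 0 <= (1 + u) / 2 by rewrite divr_ge0// addr_ge0.
have -> : (1 + u) ^+ m = 2 ^+ m * m`!%:R * (((1 + u) / 2) ^+ m / m`!%:R).
  have f0 : m`!%:R != 0 :> R by rewrite pnatr_eq0 -lt0n fact_gt0.
  rewrite exprMn exprVn; field.
  by rewrite f0 expf_neq0//.
rewrite ler_wpM2l ?mulr_ge0 ?exprn_ge0//.
case: m => [|m]; first by rewrite expr0 fact0 divr1 -[leLHS]addr0 (le_trans _ (expR_ge1Dx _))// lerD2l.
by rewrite (le_trans _ (expR_ge1Dxn m v0))// lerDr.
Qed.

Lemma measurable_radial_character l m (D : set (measurableTypeR R)) :
  measurable_fun D (radial_character l m : measurableTypeR R -> R).
Proof.
apply: measurable_funTS.
apply: continuous_measurable_fun => x; apply: cvgM.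
  apply: cvgM; first exact: cvg_cst.
  apply: continuous_comp; last exact: continuous_expR.
  apply: cvgN; apply: cvgM; last exact: cvg_cst.
  by apply: cvgM; [exact: cvg_cst|exact: exprn_continuous].
apply: (cvg_comp (fun x : R => l * x ^+ 2) (fun u => (laguerre alpha m).[u])).
  by apply: cvgM; [exact: cvg_cst|exact: exprn_continuous].
exact: continuous_horner.
Qed.

(** Integrate the polynomial L_m term by term; the Gamma factors cancel those of
    the coefficients, and the binomial theorem collects (1 - l / (j + l/2))^m. *)
Lemma radial_transform_gaussian j l m : 0 < j -> 0 <= l ->
  let f x := expR (- (j * x ^+ 2)) * radial_character l m x * x `^ (2 * alpha + 1) in
  mu.-integrable `[0, +oo[ (EFin \o f) /\
  (\int[mu]_(x in `[0%R, +oo[) (f x)%:E =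
   (Gamma (alpha + 1) / 2 * ((j - l / 2) / (j + l / 2)) ^+ m / (j + l / 2) `^ (alpha + 1))%:E)%E.
Proof.
move=> j0 l0 f; set c := j + l / 2.
have c0 : 0 < c by rewrite ltr_pwDl// divr_ge0.
pose a k := 'C(m, k)%:R * (Gamma (alpha + 1) / Gamma (k%:R + alpha + 1)) * (- l) ^+ k.
have fE x : 0 <= x ->
    f x = \sum_(k < m.+1) a k * gaussian_moment (k%:R + alpha) c x.
  move=> x0; rewrite /f /radial_character mulrAC.
  transitivity (gaussian_moment alpha c x *
      (m`!%:R * Gamma (alpha + 1) / Gamma (m%:R + alpha + 1) * (laguerre alpha m).[l * x ^+ 2])).
    rewrite /gaussian_moment.
    have -> : expR (- (c * x ^+ 2)) = expR (- (j * x ^+ 2)) * expR (- (l * x ^+ 2 / 2)).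
      by rewrite -expRD; congr expR; rewrite /c; field.
    by ring.
  rewrite normalized_laguerreE mulr_sumr; apply: eq_bigr => k _.
  rewrite gaussian_momentD// /a -[- (l * _)]mulNr exprMn; ring.
have If k : mu.-integrable `[0, +oo[ (EFin \o (fun x => a k * gaussian_moment (k%:R + alpha) c x)).
  have I := integrable_gaussian_moment (natalpha_ge0 k) c0.
  have := @integrableZl _ _ _ mu _ (measurable_itv `[0, +oo[) (a k) _ I.
  exact: eq_integrable.
split.
  apply: (@eq_integrable _ _ _ mu _ (measurable_itv _) (fun x => \sum_(k < m.+1) (a k * gaussian_moment (k%:R + alpha) c x)%:E)%E).
    by move=> x; rewrite inE/= in_itv/= andbT => x0; rewrite sumEFin fE.
  by apply: integrable_sum => // k _; exact: If.
transitivity (\int[mu]_(x in `[0%R, +oo[) (\sum_(k < m.+1) (a k * gaussian_moment (k%:R + alpha) c x)%:E))%E.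
  by apply: eq_integral => x; rewrite inE/= in_itv/= andbT => x0; rewrite sumEFin fE.
rewrite integral_sum//=; last by move=> k; exact: If.
have aI k : (\int[mu]_(x in `[0%R, +oo[) (a k * gaussian_moment (k%:R + alpha) c x)%:E =
    (Gamma (alpha + 1) / (2 * c `^ (alpha + 1)) * ('C(m, k)%:R * (- (l / c)) ^+ k))%:E)%E.
  under eq_integral do rewrite EFinM.
  rewrite integralZl//; last exact: integrable_gaussian_moment.
  rewrite integral_gaussian_moment// -EFinM; congr EFin.
  have -> : c `^ (k%:R + alpha + 1) = c ^+ k * c `^ (alpha + 1).
    rewrite -addrA [LHS]powRD; last by apply/implyP => _; rewrite gt_eqF.
    by rewrite powR_mulrn ?(ltW c0).
  rewrite /a -mulNr exprMn exprVn.
  field; rewrite Gamma_neq0 expf_neq0 ?gt_eqF//= ?powR_gt0//.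
under eq_bigr do rewrite aI.
rewrite sumEFin -mulr_sumr; congr EFin.
have -> : (j - l / 2) / c = 1 - l / c by rewrite /c; field; rewrite -/c gt_eqF//; rewrite /c in c0; lra.
rewrite exprDn.
under [in RHS]eq_bigr do rewrite expr1n mul1r -[_ *+ 'C(_, _)]mulr_natl.
by field; rewrite gt_eqF// powR_gt0.
Qed.

End RadialCharacter.

(** * Damped oscillations and the Poisson integral *)

Section DampedOscillations.
Context {R : realType}.
Local Notation mu := (@lebesgue_measure R).
Variables (k N : R).
Hypothesis k_gt0 : 0 < k.

Definition damping (t : R) : R := expR (- (k * (t + N))).

Lemma damping_gt0 t : 0 < damping t. Proof. exact: expR_gt0. Qed.

#[local] Instance is_derive_damping (t : R) : is_derive t 1 damping (- k * damping t).
Proof. by apply: is_derive_eq; rewrite /GRing.scale/= /damping; ring. Qed.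

Lemma continuous_damping : continuous damping.
Proof.
move=> t; apply: differentiable_continuous; apply/derivable1_diffP.
by have [] := is_derive_damping t.
Qed.

Lemma cvg_damping : damping t @[t --> +oo] --> 0.
Proof.
apply: (@cvg_comp _ _ _ (fun t : R => k * (t + N)) (fun x => expR (- x)) _ (pinfty_nbhs R)).
  apply: gt0_cvgMry => //; apply/cvgryPge => A; near=> t.
  by rewrite -lerBlDr; near: t; exact: nbhs_pinfty_ge.
exact: cvgr_expR.
Unshelve. all: end_near. Qed.

Let dampingN : damping (- N) = 1.
Proof. by rewrite /damping addNr mulr0 oppr0 expR0. Qed.

Lemma integral_damping : (\int[mu]_(t in `[(- N)%R, +oo[) (damping t)%:E = k^-1%:E)%E.
Proof.
have dF (t : R) : is_derive t 1 (fun t => - (k^-1 * damping t)) (damping t).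
  apply: is_derive_eq; rewrite /GRing.scale/=; field; by rewrite gt_eqF.
have cF : continuous (fun t => - (k^-1 * damping t)).
  by move=> x; apply: differentiable_continuous; apply/derivable1_diffP; have [] := dF x.
rewrite (@ge0_continuous_FTC2y _ damping (fun t => - (k^-1 * damping t)) _ 0)//.
- by rewrite dampingN mulr1 EFinN oppeK add0e.
- by move=> x _; exact/ltW/damping_gt0.
- exact/continuous_subspaceT/continuous_damping.
- rewrite -oppr0; apply: cvgN; rewrite -[X in _ --> X](mulr0 k^-1).
  by apply: cvgM; [exact: cvg_cst|exact: cvg_damping].
- by apply: cvg_at_right_filter; exact: cF.
- by move=> x _; rewrite derive1E; have [] := dF x.
Qed.

(** Adding the damping itself to damping * h, with |h| <= 1, makes the integrand
    nonnegative, so that [ge0_FTC2y_diff] applies. *)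
Lemma integral_damping_bounded (h F : R -> R) :
  continuous h -> (forall t, `|h t| <= 1) ->
  (forall t : R, is_derive t 1 F (damping t * h t)) -> F t @[t --> +oo] --> 0 ->
  mu.-integrable `[- N, +oo[ (fun t => (damping t * h t)%:E) /\
  (\int[mu]_(t in `[(- N)%R, +oo[) (damping t * h t)%:E = (- F (- N)%R)%:E)%E.
Proof.
move=> ch h1 dF F0.
(* f and damping are nonnegative, and f - damping is the function to integrate. *)
pose f t := damping t * (1 + h t).
have f0 t : 0 <= f t.
  rewrite mulr_ge0 ?(ltW (damping_gt0 _))//.
  by have := h1 t; rewrite ler_norml => /andP[]; lra.
have cF : continuous F.
  by move=> x; apply: differentiable_continuous; apply/derivable1_diffP; have [] := dF x.
have cf : continuous f.
  move=> x; apply: cvgM; first exact: continuous_damping.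
  by apply: cvgD; [exact: cvg_cst|exact: ch].
have mcont (g : R -> R) D : continuous g -> measurable_fun D (g : measurableTypeR R -> R).
  by move=> cg; apply: measurable_funTS; exact: continuous_measurable_fun.
have := @ge0_FTC2y_diff R f damping F (- N) 0.
rewrite integral_damping adde0 => FTC.
have {}FTC : (\int[mu]_(x in `[(- N)%R, +oo[) (f x)%:E + (F (- N)%R)%:E = k^-1%:E)%E.
  apply: FTC => //.
  - by move=> t _; exact/ltW/damping_gt0.
  - exact: continuous_subspaceT.
  - exact/continuous_subspaceT/continuous_damping.
  - move=> x _; have -> : f x - damping x = damping x * h x by rewrite /f; ring.
    exact: dF.
  - by apply: cvg_at_right_filter; exact: cF.
have If : (\int[mu]_(x in `[(- N)%R, +oo[) (f x)%:E = (k^-1 - F (- N)%R)%:E)%E.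
  by rewrite EFinB -FTC addeK.
have if_ : mu.-integrable `[- N, +oo[ (EFin \o f).
  apply/integrableP; split; first by apply/measurable_EFinP; exact: mcont.
  under eq_integral do rewrite /= ger0_norm//.
  by rewrite If ltry.
have ig : mu.-integrable `[- N, +oo[ (EFin \o damping).
  apply/integrableP; split.
    by apply/measurable_EFinP; apply: mcont; exact: continuous_damping.
  under eq_integral do rewrite /= ger0_norm ?(ltW (damping_gt0 _))//.
  by rewrite integral_damping ltry.
have E t : ((damping t * h t)%:E = (EFin \o f) t - (EFin \o damping) t)%E.
  by rewrite /= -EFinB /f; congr EFin; ring.
split.
  apply: eq_integrable (integrableB _ if_ ig) => //.
under eq_integral do rewrite E.
rewrite integralB// If integral_damping -EFinB; congr EFin; ring.
Qed.

Let cvg_damping_bounded (g : R -> R) M : (forall t, `|g t| <= M) ->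
  damping t * g t @[t --> +oo] --> 0.
Proof.
move=> gM; have M1 : 0 < M + 1 by rewrite ltr_wpDl// (le_trans _ (gM 0)).
apply/cvgr0Pnorm_lt => e e0; near=> t.
rewrite normrM (ger0_norm (ltW (damping_gt0 _))).
rewrite (le_lt_trans (y := damping t * (M + 1)))//.
  by rewrite ler_wpM2l ?(ltW (damping_gt0 _))// (le_trans (gM _))// lerDl.
rewrite -ltr_pdivlMr// -[ltLHS]ger0_norm ?(ltW (damping_gt0 _))//.
near: t; move/cvgr0_norm_lt: cvg_damping; apply; exact: divr_gt0.
Unshelve. all: end_near. Qed.

Variable l : R.

Let den_gt0 : 0 < k ^+ 2 + l ^+ 2.
Proof. by rewrite ltr_pwDl ?exprn_gt0// sqr_ge0. Qed.

Let bounded_trigo (a b : R) t : `|a * cos t + b * sin t| <= `|a| + `|b|.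
Proof.
rewrite (le_trans (ler_normD _ _))// !normrM lerD//.
  by rewrite ler_piMr// ler_norml cos_geN1 cos_le1.
by rewrite ler_piMr// ler_norml sin_geN1 sin_le1.
Qed.

Lemma integral_damping_cos :
  mu.-integrable `[- N, +oo[ (fun t => (damping t * cos (l * t))%:E) /\
  (\int[mu]_(t in `[(- N)%R, +oo[) (damping t * cos (l * t))%:E =
   ((k * cos (l * N) + l * sin (l * N)) / (k ^+ 2 + l ^+ 2))%:E)%E.
Proof.
pose F t := damping t * (- (k / (k ^+ 2 + l ^+ 2)) * cos (l * t) + l / (k ^+ 2 + l ^+ 2) * sin (l * t)).
have [|t|t||If ->] := @integral_damping_bounded (fun t => cos (l * t)) F.
- move=> x; apply: continuous_comp; last exact: continuous_cos.
  by apply: cvgM; [exact: cvg_cst|exact: cvg_id].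
- by rewrite ler_norml cos_geN1 cos_le1.
- rewrite /F; apply: is_derive_eq; rewrite /GRing.scale/=.
  by field; rewrite gt_eqF.
- by apply: cvg_damping_bounded => t; exact: bounded_trigo.
split=> //; congr EFin; rewrite /F dampingN mulrN cosN sinN; field.
by rewrite gt_eqF.
Qed.

Lemma integral_damping_sin :
  mu.-integrable `[- N, +oo[ (fun t => (damping t * sin (l * t))%:E) /\
  (\int[mu]_(t in `[(- N)%R, +oo[) (damping t * sin (l * t))%:E =
   ((l * cos (l * N) - k * sin (l * N)) / (k ^+ 2 + l ^+ 2))%:E)%E.
Proof.
pose F t := damping t * (- (l / (k ^+ 2 + l ^+ 2)) * cos (l * t) + - (k / (k ^+ 2 + l ^+ 2)) * sin (l * t)).
have [|t|t||If ->] := @integral_damping_bounded (fun t => sin (l * t)) F.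
- move=> x; apply: continuous_comp; last exact: continuous_sin.
  by apply: cvgM; [exact: cvg_cst|exact: cvg_id].
- by rewrite ler_norml sin_geN1 sin_le1.
- rewrite /F; apply: is_derive_eq; rewrite /GRing.scale/=.
  by field; rewrite gt_eqF.
- by apply: cvg_damping_bounded => t; exact: bounded_trigo.
split=> //; congr EFin; rewrite /F dampingN mulrN cosN sinN; field.
by rewrite gt_eqF.
Qed.

End DampedOscillations.

Section PoissonIntegral.
Context {R : realType}.
Local Notation mu := (@lebesgue_measure R).

Lemma integral_poisson_kernel (k : R) : 0 < k ->
  (\int[mu]_l (k / (k ^+ 2 + l ^+ 2))%:E = pi%:E)%E.
Proof.
move=> k0.
have den0 l : 0 < k ^+ 2 + l ^+ 2 by rewrite ltr_pwDl ?exprn_gt0// sqr_ge0.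
have ge0 l : 0 <= k / (k ^+ 2 + l ^+ 2) by rewrite divr_ge0 ?ltW.
have cont : continuous (fun l : R => k / (k ^+ 2 + l ^+ 2)).
  move=> l; apply: cvgM; first exact: cvg_cst.
  apply: cvgV; first by rewrite gt_eqF.
  by apply: cvgD; [exact: cvg_cst|exact: exprn_continuous].
rewrite ge0_symfun_integralT//; last by move=> l; rewrite /= sqrrN.
rewrite -set_itvcy.
have dF (l : R) : is_derive l 1 (fun l => atan (l / k)) (k / (k ^+ 2 + l ^+ 2)).
  apply: is_derive_eq; rewrite /GRing.scale/=; field.
  by rewrite !gt_eqF//= ltr_pwDl ?exprn_gt0// sqr_ge0.
have cF : continuous (fun l : R => atan (l / k)).
  by move=> x; apply: differentiable_continuous; apply/derivable1_diffP; have [] := dF x.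
rewrite (@ge0_continuous_FTC2y _ (fun l => k / (k ^+ 2 + l ^+ 2)) (fun l => atan (l / k)) _ (pi / 2))//.
- by rewrite mul0r atan0 sube0 -EFinM; congr EFin; field.
- exact/continuous_subspaceT.
- apply: (@cvg_comp _ _ _ (fun l : R => l / k) atan _ (pinfty_nbhs R)).
    by apply: gt0_cvgMly => //; rewrite invr_gt0.
  exact: cvgy_atan.
- by apply: cvg_at_right_filter; exact: cF.
- by move=> x _; rewrite derive1E; have [] := dF x.
Qed.

End PoissonIntegral.

(** * Frame bounds and their stability under limits *)

Section SquareIntegral.
Context d (T : measurableType d) (R : realType).
Variable m : {measure set T -> \bar R}.
Implicit Types (u v w : T -> R).
Local Open Scope ereal_scope.

(** The L1 norm, and below it the square of the L2 norm: squares avoid all roots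
    at the price of a factor 2 in the triangle inequality. *)
Definition nrm1 u := \int[m]_z (`|u z|%R)%:E.
Definition nrm2 u := \int[m]_z ((u z) ^+ 2)%:E.

(** Membership in L1 /\ L2: the transform is defined as an integral by L1, and the
    energy estimates are about L2. *)
Definition integrable12 u :=
  [/\ measurable_fun setT u, nrm1 u < +oo & nrm2 u < +oo].

Lemma nrm1_ge0 u : 0 <= nrm1 u.
Proof. by apply: integral_ge0 => z _; rewrite lee_fin. Qed.

Lemma nrm2_ge0 u : 0 <= nrm2 u.
Proof. by apply: integral_ge0 => z _; rewrite lee_fin sqr_ge0. Qed.

Lemma integral_le2D u v w : measurable_fun setT u -> measurable_fun setT v ->
  measurable_fun setT w ->
  (forall z, 0 <= u z)%R -> (forall z, 0 <= v z)%R -> (forall z, 0 <= w z)%R ->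
  (forall z, u z <= 2 * v z + 2 * w z)%R ->
  \int[m]_z (u z)%:E <= 2%:E * \int[m]_z (v z)%:E + 2%:E * \int[m]_z (w z)%:E.
Proof.
move=> mu mv mw u0 v0 w0 uvw.
have mE (f : T -> R) : measurable_fun setT f -> measurable_fun setT (fun z => (f z)%:E).
  by move=> mf; exact/measurable_EFinP.
rewrite -!ge0_integralZl//=; try (by exact: mE); try (by move=> z _; rewrite lee_fin).
rewrite -ge0_integralD//=.
- apply: ge0_le_integral => //=.
  + by move=> z _; rewrite lee_fin.
  + exact: mE.
  + by apply: emeasurable_funD; apply: measurable_funeM; exact: mE.
  + by move=> z _; rewrite -!EFinM -EFinD lee_fin.
- by move=> z _; rewrite mule_ge0 ?lee_fin.
- by apply: measurable_funeM; exact: mE.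
- by move=> z _; rewrite mule_ge0 ?lee_fin.
- by apply: measurable_funeM; exact: mE.
Qed.

Lemma nrm2_le2D u v w : measurable_fun setT u -> measurable_fun setT v ->
  measurable_fun setT w -> (forall z, u z = v z + w z)%R ->
  nrm2 u <= 2%:E * nrm2 v + 2%:E * nrm2 w.
Proof.
move=> mu mv mw uvw; apply: integral_le2D => //; try exact: measurable_funX.
- by move=> z; exact: sqr_ge0.
- by move=> z; exact: sqr_ge0.
- by move=> z; exact: sqr_ge0.
- move=> z; rewrite uvw -subr_ge0.
  by rewrite (_ : _ - _ = (v z - w z) ^+ 2)%R ?sqr_ge0//; ring.
Qed.

Lemma nrm2_le2B u v w : measurable_fun setT u -> measurable_fun setT v ->
  measurable_fun setT w -> (forall z, u z = v z - w z)%R ->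
  nrm2 u <= 2%:E * nrm2 v + 2%:E * nrm2 w.
Proof.
move=> mu mv mw uvw; apply: integral_le2D => //; try exact: measurable_funX.
- by move=> z; exact: sqr_ge0.
- by move=> z; exact: sqr_ge0.
- by move=> z; exact: sqr_ge0.
- move=> z; rewrite uvw -subr_ge0.
  by rewrite (_ : _ - _ = (v z + w z) ^+ 2)%R ?sqr_ge0//; ring.
Qed.

Lemma nrm1_leD u v w : measurable_fun setT u -> measurable_fun setT v ->
  measurable_fun setT w -> (forall z, u z = v z + w z)%R ->
  nrm1 u <= nrm1 v + nrm1 w.
Proof.
move=> mu mv mw uvw.
have mE (f : T -> R) : measurable_fun setT f -> measurable_fun setT (fun z => (`|f z|%R)%:E).
  by move=> mf; apply/measurable_EFinP; exact: measurableT_comp.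
rewrite /nrm1 -ge0_integralD//=; [|exact: mE|exact: mE].
apply: ge0_le_integral => //=; [exact: mE| |].
  by apply: emeasurable_funD; exact: mE.
by move=> z _; rewrite -EFinD lee_fin uvw ler_normD.
Qed.

Lemma nrm1Z (a : R) u : measurable_fun setT u ->
  nrm1 (fun z => a * u z)%R = (`|a|%R)%:E * nrm1 u.
Proof.
move=> mu; rewrite /nrm1 -ge0_integralZl//=.
- by apply: eq_integral => z _; rewrite normrM EFinM.
- by apply/measurable_EFinP; exact: measurableT_comp.
Qed.

Lemma nrm2Z (a : R) u : measurable_fun setT u ->
  nrm2 (fun z => a * u z)%R = (a ^+ 2)%:E * nrm2 u.
Proof.
move=> mu; rewrite /nrm2 -ge0_integralZl//=.
- by apply: eq_integral => z _; rewrite exprMn EFinM.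
- by apply/measurable_EFinP; exact: measurable_funX.
- by move=> z _; rewrite lee_fin sqr_ge0.
- by rewrite lee_fin sqr_ge0.
Qed.

Lemma integrable12D u v : integrable12 u -> integrable12 v ->
  integrable12 (fun z => u z + v z)%R.
Proof.
move=> [mu u1 u2] [mv v1 v2].
have muv : measurable_fun setT (fun z => u z + v z)%R by exact: measurable_funD.
split=> //.
  by rewrite (le_lt_trans (nrm1_leD muv mu mv _))// lte_add_pinfty.
rewrite (le_lt_trans (nrm2_le2D muv mu mv _))// lte_add_pinfty// lte_mul_pinfty//.
Qed.

Lemma integrable12Z (a : R) u : integrable12 u -> integrable12 (fun z => a * u z)%R.
Proof.
move=> [mu u1 u2]; split; first exact: measurable_funM.
  by rewrite nrm1Z// lte_mul_pinfty// lee_fin.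
by rewrite nrm2Z// lte_mul_pinfty// lee_fin sqr_ge0.
Qed.

Lemma integrable12B u v : integrable12 u -> integrable12 v ->
  integrable12 (fun z => u z - v z)%R.
Proof.
move=> Iu Iv.
have -> : (fun z => u z - v z)%R = (fun z => u z + (-1) * v z)%R.
  by apply/funext => z; rewrite mulN1r.
by apply: integrable12D => //; exact: integrable12Z.
Qed.

(** The same v has to work in both norms: L1 closeness controls the transform
    pointwise, L2 closeness controls the energy. *)
Definition approximable (V : (T -> R) -> Prop) u :=
  forall e : R, (0 < e)%R -> exists v,
    [/\ V v, nrm1 (fun z => u z - v z)%R < e%:E & nrm2 (fun z => u z - v z)%R < e%:E].

Lemma ge0_fatou_le (f : nat -> T -> R) (g : T -> R) (K : \bar R) :
  (forall n, measurable_fun setT (f n)) -> (forall n z, 0 <= f n z)%R ->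
  (forall z, f n z @[n --> \oo] --> g z) ->
  (forall n, \int[m]_z (f n z)%:E <= K) -> \int[m]_z (g z)%:E <= K.
Proof.
move=> mf f0 fg fK.
have := @fatou _ _ _ m setT measurableT (fun n z => (f n z)%:E).
move=> /(_ (fun n => proj2 (measurable_EFinP _ _) (mf n)))/(_ (fun n z _ => f0 n z)).
have -> : \int[m]_z limn_einf (fun n => (f n z)%:E) = \int[m]_z (g z)%:E.
  apply: eq_integral => z _.
  have fgz : (f n z)%:E @[n --> \oo] --> (g z)%:E by apply: cvg_EFin; [exact: nearW|exact: fg].
  rewrite is_cvg_limn_einfE; last by apply/cvg_ex; exists (g z)%:E.
  exact/cvg_lim.
move=> /le_trans; apply; rewrite limn_einf_lim; apply: lime_le.
  exact: is_cvg_einfs.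
apply: nearW => n; apply: le_trans (fK n); apply: ereal_inf_lbound.
by exists n => /=.
Qed.

End SquareIntegral.

Section FrameClosure.
Context d d' (T : measurableType d) (T' : measurableType d') (R : realType).
Variables (m : {measure set T -> \bar R}) (g : {measure set T' -> \bar R}).
Local Notation nrm1 := (nrm1 m).
Local Notation nrm2 := (nrm2 m).
Local Open Scope ereal_scope.

Definition bounded_kernel (k : T' -> T -> R) := forall w,
  measurable_fun setT (k w) /\ exists2 C, (0 <= C)%R & forall z, (`|k w z| <= C)%R.

Definition transform (k : T' -> T -> R) (u : T -> R) (w : T') : R :=
  (\int[m]_z (u z * k w z))%R.

Lemma integrable_transform k u w : bounded_kernel k -> integrable12 m u ->
  m.-integrable setT (fun z => (u z * k w z)%:E).
Proof.
move=> bk [mu u1 _]; have [mk [C C0 kC]] := bk w.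
have muk : measurable_fun setT (fun z => u z * k w z)%R by exact: measurable_funM.
apply/integrableP; split; first exact/measurable_EFinP.
apply: (@le_lt_trans _ _ (C%:E * nrm1 u)); last by rewrite lte_mul_pinfty.
rewrite -ge0_integralZl//=; last by apply/measurable_EFinP; exact: measurableT_comp.
apply: ge0_le_integral => //=.
- by apply/measurable_EFinP; exact: measurableT_comp.
- by apply/measurable_EFinP; apply: measurable_funM => //; exact: measurableT_comp.
- by move=> z _; rewrite -EFinM lee_fin normrM mulrC ler_wpM2r.
Qed.

Lemma transformB k u v w : bounded_kernel k -> integrable12 m u -> integrable12 m v ->
  transform k (fun z => u z - v z)%R w = (transform k u w - transform k v w)%R.
Proof.
move=> bk Iu Iv; rewrite /transform -RintegralB//=; [|exact: integrable_transform|exact: integrable_transform].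
by apply: eq_Rintegral => z _; rewrite mulrBl.
Qed.

Lemma transform_le_nrm1 k u w C : bounded_kernel k -> integrable12 m u ->
  (0 <= C)%R -> (forall z, `|u z * k w z| <= C * `|u z|)%R ->
  (`|transform k u w|%R)%:E <= C%:E * nrm1 u.
Proof.
move=> bk Iu C0 kC; have [mu u1 _] := Iu; have [mk _] := bk w.
have muk : measurable_fun setT (fun z => u z * k w z)%R by exact: measurable_funM.
rewrite /transform EFin_normr_Rintegral//; last exact: integrable_transform.
apply: le_trans (le_abse_integral _ _ _) _ => //; first exact/measurable_EFinP.
rewrite -ge0_integralZl//=; last by apply/measurable_EFinP; exact: measurableT_comp.
apply: ge0_le_integral => //=.
- by apply/measurable_EFinP; exact: measurableT_comp.
- by apply/measurable_EFinP; apply: measurable_funM => //; exact: measurableT_comp.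
- by move=> z _; rewrite -EFinM lee_fin.
Qed.

Lemma cvg_transform k u (v : nat -> T -> R) w : bounded_kernel k ->
  integrable12 m u -> (forall n, integrable12 m (v n)) ->
  nrm1 (fun z => u z - v n z)%R @[n --> \oo] --> 0 ->
  transform k (v n) w @[n --> \oo] --> transform k u w.
Proof.
move=> bk Iu Iv uv0; have [_ [C C0 kC]] := bk w.
apply/cvgrPdist_le => e e0.
have C1 : (0 < C + 1)%R by rewrite ltr_wpDl.
have e' : (0 < e / (C + 1))%R by rewrite divr_gt0.
have : \forall n \near \oo, nrm1 (fun z => u z - v n z)%R < (e / (C + 1))%:E.
  by apply: (uv0 [set y | y < (e / (C + 1))%:E]); apply: open_ereal_lt'; rewrite lte_fin.
apply: filterS => n un.
rewrite -transformB// -lee_fin.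
have kC' z : (`|(u z - v n z) * k w z| <= C * `|u z - v n z|)%R.
  by rewrite normrM mulrC ler_wpM2r.
apply: le_trans (transform_le_nrm1 bk (integrable12B Iu (Iv n)) C0 kC') _.
apply: (@le_trans _ _ (C%:E * (e / (C + 1))%:E)).
  by apply: lee_wpmul2l; [rewrite lee_fin|exact: ltW].
by rewrite -EFinM lee_fin mulrA ler_pdivrMr// mulrC ler_wpM2l ?(ltW e0)// lerDl.
Qed.

Variables k1 k2 : T' -> T -> R.
Hypotheses (bk1 : bounded_kernel k1) (bk2 : bounded_kernel k2).

Definition energy (u : T -> R) : \bar R :=
  \int[g]_w ((transform k1 u w) ^+ 2 + (transform k2 u w) ^+ 2)%:E.

(** Two-sided Plancherel bounds for the pair of real kernels; with C = 1 they are
    the Plancherel identity. *)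
Definition frame (C : R) (u : T -> R) :=
  [/\ measurable_fun setT (transform k1 u), measurable_fun setT (transform k2 u),
      energy u <= C%:E * nrm2 u & nrm2 u <= C%:E * energy u].

Lemma energy_ge0 u : 0 <= energy u.
Proof. by apply: integral_ge0 => w _; rewrite lee_fin addr_ge0 ?sqr_ge0. Qed.

Variables (V : (T -> R) -> Prop) (C : R).
Hypotheses (C_gt0 : (0 < C)%R) (VB : forall u v, V u -> V v -> V (fun z => u z - v z)%R).
Hypotheses (V12 : forall v, V v -> integrable12 m v) (frameV : forall v, V v -> frame C v).

(** L1 convergence gives pointwise convergence of the transforms, so Fatou bounds
    the energy of the limit by the energies of the approximants. *)
Lemma bessel_closure u : integrable12 m u -> approximable m V u ->
  [/\ measurable_fun setT (transform k1 u), measurable_fun setT (transform k2 u) &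
      energy u <= (2 * C)%:E * nrm2 u].
Proof.
move=> Iu Au.
have seqv (e : R) : (0 < e)%R -> exists v : nat -> T -> R, forall n,
    [/\ V (v n), nrm1 (fun z => u z - v n z)%R < (e / n.+1%:R)%:E &
        nrm2 (fun z => u z - v n z)%R < (e / n.+1%:R)%:E].
  move=> e0; have /choice[v vP] : forall n : nat, exists v,
    [/\ V v, nrm1 (fun z => u z - v z)%R < (e / n.+1%:R)%:E &
        nrm2 (fun z => u z - v z)%R < (e / n.+1%:R)%:E].
    by move=> n; apply: Au; rewrite divr_gt0.
  by exists v.
have cvgv (e : R) (v : nat -> T -> R) : (forall n,
    [/\ V (v n), nrm1 (fun z => u z - v n z)%R < (e / n.+1%:R)%:E &
        nrm2 (fun z => u z - v n z)%R < (e / n.+1%:R)%:E]) ->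
    forall k w, bounded_kernel k -> transform k (v n) w @[n --> \oo] --> transform k u w.
  move=> vP k w bk; apply: cvg_transform => //.
    by move=> n; apply: V12; have [] := vP n.
  apply: (@squeeze_cvge _ _ _ _ (cst 0) _ (fun n => (e / n.+1%:R)%:E)).
  - by apply: nearW => n; rewrite nrm1_ge0 ltW//; have [] := vP n.
  - exact: cvg_cst.
  - apply: cvg_EFin; first exact: nearW.
    rewrite -[X in _ --> X](mulr0 e); apply: cvgM; first exact: cvg_cst.
    exact: cvg_harmonic.
have mT k : bounded_kernel k -> (forall v, V v -> measurable_fun setT (transform k v)) ->
    measurable_fun setT (transform k u).
  move=> bk mk; have [v vP] := seqv 1%R ltr01.
  apply: (@measurable_fun_cvg _ _ _ _ (fun n => transform k (v n))).
    by move=> n; apply: mk; have [] := vP n.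
  by move=> w _; exact: (cvgv _ _ vP).
split.
- by apply: mT => // v /frameV[].
- by apply: mT => // v /frameV[].
apply/lee_addgt0Pr => e e0.
have e' : (0 < e / (2 * C))%R by rewrite divr_gt0// mulr_gt0.
have [v vP] := seqv _ e'.
have [mu _ _] := Iu.
apply: (@ge0_fatou_le _ _ _ g (fun n w => (transform k1 (v n) w) ^+ 2 + (transform k2 (v n) w) ^+ 2)%R).
- move=> n; have [/frameV[m1 m2 _ _] _ _] := vP n.
  by apply: measurable_funD; exact: measurable_funX.
- by move=> n w; rewrite addr_ge0 ?sqr_ge0.
- by move=> w; apply: cvgD; apply: cvgM; exact: (cvgv _ _ vP).
move=> n; have [Vn _ n2] := vP n; have [_ _ En _] := frameV Vn; have [mv _ _] := V12 Vn.
apply: (le_trans En); apply: (@le_trans _ _ (C%:E * (2%:E * nrm2 u + 2%:E * nrm2 (fun z => u z - v n z)%R))).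
  apply: lee_wpmul2l; first by rewrite lee_fin ltW.
  apply: nrm2_le2B => //; first exact: measurable_funB.
  by move=> z; ring.
rewrite ge0_muleDr ?mule_ge0 ?nrm2_ge0// !muleA -!EFinM [(C * 2)%R]mulrC leeD2l//.
apply: (@le_trans _ _ ((2 * C)%:E * (e / (2 * C) / n.+1%:R)%:E)).
  by apply: lee_wpmul2l; [rewrite lee_fin mulr_ge0// ltW|exact: ltW].
rewrite -EFinM lee_fin mulrA mulrCA divff ?mulr1 ?gt_eqF ?mulr_gt0//.
by rewrite ler_pdivrMr// ler_peMr ?(ltW e0)// ler1n.
Qed.

(** For the lower bound, the approximant v has an energy comparable to that of u,
    because the energy of u - v is controlled by the upper bound, already proved
    for all approximable functions and hence for u - v. *)
Lemma frame_closure u : integrable12 m u -> approximable m V u ->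
  frame (4 * C) u.
Proof.
move=> Iu Au; have [m1 m2 Eu] := bessel_closure Iu Au.
split=> //.
  by rewrite (le_trans Eu)// lee_wpmul2r ?nrm2_ge0// lee_fin ler_wpM2r ?(ltW C_gt0)// ler_nat.
apply/lee_addgt0Pr => e e0.
have K0 : (0 < 2 + 8 * C ^+ 2)%R by rewrite ltr_pwDl// mulr_ge0// sqr_ge0.
have [e' e'0 eE] : exists2 e' : R, (0 < e')%R & e = ((2 + 8 * C ^+ 2) * e')%R.
  exists (e / (2 + 8 * C ^+ 2))%R; first exact: divr_gt0.
  by rewrite mulrC divfK// gt_eqF.
have [v [Vv v1 v2]] := Au _ e'0.
have Iv := V12 Vv; have [mv _ _] := Iv; have [mu _ _] := Iu.
have Iuv := integrable12B Iu Iv; have [muv _ _] := Iuv.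
have Auv : approximable m V (fun z => u z - v z)%R.
  move=> d0 d0_gt0; have [v' [Vv' v'1 v'2]] := Au _ d0_gt0.
  exists (fun z => v' z - v z)%R; split; first exact: VB.
    by under eq_fun do rewrite opprB addrA subrK.
  by under eq_fun do rewrite opprB addrA subrK.
have [_ _ Euv] := bessel_closure Iuv Auv.
have [mv1 mv2 _ lov] := frameV Vv.
have Ev : energy v <= 2%:E * energy u + 2%:E * energy (fun z => u z - v z)%R.
  have mE (a b : T' -> R) : measurable_fun setT a -> measurable_fun setT b ->
    measurable_fun setT (fun w => a w ^+ 2 + b w ^+ 2)%R.
    by move=> ma mb; apply: measurable_funD; exact: measurable_funX.
  have [m1' m2' _] := bessel_closure Iuv Auv.
  apply: integral_le2D; try exact: mE; try (by move=> w; rewrite addr_ge0 ?sqr_ge0).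
  move=> w; rewrite !transformB// -subr_ge0.
  set a := transform k1 u w; set b := transform k2 u w.
  set a' := transform k1 v w; set b' := transform k2 v w.
  rewrite (_ : _ - _ = (2 * a - a') ^+ 2 + (2 * b - b') ^+ 2)%R ?addr_ge0 ?sqr_ge0//.
  ring.
have uD z : u z = (v z + (u z - v z))%R by rewrite addrC subrK.
apply: (le_trans (nrm2_le2D m mu mv muv uD)).
apply: (@le_trans _ _ (2%:E * (C%:E * (2%:E * energy u + 2%:E * ((2 * C)%:E * e'%:E))) + 2%:E * e'%:E)).
  apply: leeD; last by apply: lee_wpmul2l => //; exact: ltW.
  apply: lee_wpmul2l => //; apply: (le_trans lov).
  apply: lee_wpmul2l; first by rewrite lee_fin ltW.
  apply: (le_trans Ev); apply: leeD2l; apply: lee_wpmul2l => //.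
  apply: (le_trans Euv); apply: lee_wpmul2l; first by rewrite lee_fin mulr_ge0// ltW.
  exact: ltW.
rewrite ge0_muleDr ?mule_ge0 ?energy_ge0 ?lee_fin ?mulr_ge0 ?(ltW C_gt0) ?(ltW e'0)//.
rewrite ge0_muleDr ?mule_ge0 ?energy_ge0 ?lee_fin ?mulr_ge0 ?(ltW C_gt0) ?(ltW e'0)//.
rewrite !muleA -!EFinM -addeA -EFinD leeD//.
- by rewrite (_ : 2 * C * 2 = 4 * C)%R //; ring.
- by rewrite lee_fin eE le_eqVlt; apply/orP; left; apply/eqP; ring.
Qed.

End FrameClosure.

(** * Approximation in L1 and L2 simultaneously *)

Section Approximation.
Context d (T : measurableType d) (R : realType).
Variable m : {measure set T -> \bar R}.
Local Notation nrm1 := (nrm1 m).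
Local Notation nrm2 := (nrm2 m).
Implicit Types (u v : T -> R).
Local Open Scope ereal_scope.

Lemma dominated_nrm_lt (D u : T -> R) (v : nat -> T -> R) (e : R) :
  integrable12 m D -> measurable_fun setT u -> (forall n, measurable_fun setT (v n)) ->
  (forall n z, `|v n z| <= D z)%R -> (forall z, v n z @[n --> \oo] --> u z) ->
  (0 < e)%R ->
  exists n, nrm1 (fun z => u z - v n z)%R < e%:E /\ nrm2 (fun z => u z - v n z)%R < e%:E.
Proof.
move=> [mD D1 D2] mu mv vD vu e0.
have D0 z : (0 <= D z)%R by apply: le_trans (vD 0%N z).
have uD z : (`|u z| <= D z)%R.
  rewrite -(cvg_lim _ (cvg_norm (vu z)))//; apply: limr_le.
    by apply/cvg_ex; eexists; exact: cvg_norm (vu z).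
  exact: nearW.
(* The same majorant serves for both norms: 2 D for the first, 4 D^2 for the
   second. *)
have uvD n z : (`|u z - v n z| <= 2 * D z)%R.
  by rewrite (le_trans (ler_normB _ _))// mulrDl mul1r lerD.
have uv0 z : (u z - v n z)%R @[n --> \oo] --> (0 : R)%R.
  by rewrite -(subrr (u z)); apply: cvgB; [exact: cvg_cst|exact: vu].
have muv n : measurable_fun setT (fun z => u z - v n z)%R by exact: measurable_funB.
have c1 : nrm1 (fun z => u z - v n z)%R @[n --> \oo] --> 0.
  rewrite -(@integral0 _ _ _ m setT).
  apply: (@dominated_cvg _ _ _ m setT measurableT _ (cst 0) (fun z => (2 * D z)%:E)) => //=.
  - by move=> n; apply/measurable_EFinP; exact: measurableT_comp.
  - move=> z _; apply: cvg_EFin; first exact: nearW.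
    by rewrite -(@normr0 R R^o); apply: cvg_norm; exact: uv0.
  - apply/integrableP; split; first by apply/measurable_EFinP; exact: measurable_funM.
    under eq_integral do rewrite /= ger0_norm ?mulr_ge0// EFinM.
    rewrite ge0_integralZl//=; [|exact/measurable_EFinP|by move=> z _; rewrite lee_fin].
    rewrite lte_mul_pinfty//; move: D1; congr (_ < _).
    by apply: eq_integral => z _; rewrite ger0_norm.
  - by move=> n z _; rewrite lee_fin normr_id.
have c2 : nrm2 (fun z => u z - v n z)%R @[n --> \oo] --> 0.
  rewrite -(@integral0 _ _ _ m setT).
  apply: (@dominated_cvg _ _ _ m setT measurableT _ (cst 0) (fun z => (4 * (D z) ^+ 2)%:E)) => //=.
  - by move=> n; apply/measurable_EFinP; exact: measurable_funX.
  - move=> z _; apply: cvg_EFin; first exact: nearW.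
    by rewrite -(mul0r 0%R); apply: cvgM; exact: uv0.
  - apply/integrableP; split.
      by apply/measurable_EFinP; apply: measurable_funM => //; exact: measurable_funX.
    under eq_integral do rewrite /= ger0_norm ?mulr_ge0 ?sqr_ge0// EFinM.
    rewrite ge0_integralZl//=; last 2 first.
    + by apply/measurable_EFinP; exact: measurable_funX.
    + by move=> z _; rewrite lee_fin sqr_ge0.
    by rewrite lte_mul_pinfty.
  - move=> n z _; rewrite lee_fin ger0_norm ?sqr_ge0//.
    rewrite -[leLHS]ger0_norm ?sqr_ge0// normrX.
    rewrite (_ : 4 * D z ^+ 2 = (2 * D z) ^+ 2)%R; last by ring.
    by rewrite lerXn2r ?nnegrE ?mulr_ge0.
have n1 : \forall n \near \oo, nrm1 (fun z => u z - v n z)%R < e%:E.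
  by apply: (c1 [set y | y < e%:E]); apply: open_ereal_lt'; rewrite lte_fin.
have n2 : \forall n \near \oo, nrm2 (fun z => u z - v n z)%R < e%:E.
  by apply: (c2 [set y | y < e%:E]); apply: open_ereal_lt'; rewrite lte_fin.
have [N _ HN] : \forall n \near \oo, nrm1 (fun z => u z - v n z)%R < e%:E /\
    nrm2 (fun z => u z - v n z)%R < e%:E.
  near=> n; split; near: n; [exact: n1|exact: n2].
by exists N; apply: HN => /=.
Unshelve. all: end_near. Qed.

Variable V : (T -> R) -> Prop.
Hypothesis VM : forall u, V u -> measurable_fun setT u.
Hypothesis VB : forall u v, V u -> V v -> V (fun z => u z - v z)%R.
Hypothesis VZ : forall (a : R) u, V u -> V (fun z => a * u z)%R.

Lemma approximable_sub u : V u -> approximable m V u.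
Proof.
move=> Vu e e0; exists u; rewrite /nrm1 /nrm2; split=> //.
  by rewrite integral0_eq ?lte_fin// => z _; rewrite subrr normr0.
by rewrite integral0_eq ?lte_fin// => z _; rewrite subrr expr0n.
Qed.

Lemma approximable_trans (V' : (T -> R) -> Prop) u : measurable_fun setT u ->
  (forall v, V' v -> measurable_fun setT v) -> (forall v, V' v -> approximable m V v) ->
  approximable m V' u -> approximable m V u.
Proof.
move=> mu mV' V'V Au e e0.
have e4 : (0 < e / 4)%R by rewrite divr_gt0.
have [v' [Vv' u1 u2]] := Au _ e4; have mv' := mV' _ Vv'.
have [v [Vv v1 v2]] := V'V _ Vv' _ e4; have mv := VM Vv.
have muv : measurable_fun setT (fun z => u z - v z)%R by exact: measurable_funB.
have muv' : measurable_fun setT (fun z => u z - v' z)%R by exact: measurable_funB.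
have mv'v : measurable_fun setT (fun z => v' z - v z)%R by exact: measurable_funB.
have E z : (u z - v z = (u z - v' z) + (v' z - v z))%R by rewrite addrA subrK.
exists v; split=> //.
  rewrite (le_lt_trans (nrm1_leD m muv muv' mv'v E))//.
  rewrite (lt_le_trans (lteD u1 v1))// -EFinD lee_fin; lra.
rewrite (le_lt_trans (nrm2_le2D m muv muv' mv'v E))//.
rewrite (@lt_le_trans _ _ (2%:E * (e / 4)%:E + 2%:E * (e / 4)%:E))//.
  by apply: lteD; rewrite lte_pmul2l.
by rewrite -!EFinM -EFinD lee_fin; lra.
Qed.

Lemma approximable_dominated (D u : T -> R) (v : nat -> T -> R) :
  integrable12 m D -> measurable_fun setT u -> (forall n, measurable_fun setT (v n)) ->
  (forall n z, `|v n z| <= D z)%R -> (forall z, v n z @[n --> \oo] --> u z) ->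
  (forall n, approximable m V (v n)) -> approximable m V u.
Proof.
move=> ID mu mv vD vu Av.
apply: (@approximable_trans (fun w => exists n, w = v n)) => //.
- by move=> _ [n ->].
- by move=> _ [n ->].
- move=> e e0; have [n [n1 n2]] := dominated_nrm_lt ID mu mv vD vu e0.
  by exists (v n); split=> //; exists n.
Qed.

Lemma approximableB u v : measurable_fun setT u -> measurable_fun setT v ->
  approximable m V u -> approximable m V v -> approximable m V (fun z => u z - v z)%R.
Proof.
move=> mu mv Au Av e e0.
have e4 : (0 < e / 4)%R by rewrite divr_gt0.
have [u' [Vu' u1 u2]] := Au _ e4; have mu' := VM Vu'.
have [v' [Vv' v1 v2]] := Av _ e4; have mv' := VM Vv'.
have muu' : measurable_fun setT (fun z => u z - u' z)%R by exact: measurable_funB.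
have mvv' : measurable_fun setT (fun z => v z - v' z)%R by exact: measurable_funB.
have mNvv' : measurable_fun setT (fun z => (-1) * (v z - v' z))%R by exact: measurable_funM.
have mw : measurable_fun setT (fun z => (u z - v z) - (u' z - v' z))%R.
  by apply: measurable_funB; exact: measurable_funB.
have E z : ((u z - v z) - (u' z - v' z) = (u z - u' z) + (-1) * (v z - v' z))%R by ring.
have E' z : ((u z - v z) - (u' z - v' z) = (u z - u' z) - (v z - v' z))%R by ring.
exists (fun z => u' z - v' z)%R; split; first exact: VB.
  rewrite (le_lt_trans (nrm1_leD m mw muu' mNvv' E))// nrm1Z// normrN1 mul1e.
  rewrite (lt_le_trans (lteD u1 v1))// -EFinD lee_fin; lra.
rewrite (le_lt_trans (nrm2_le2B m mw muu' mvv' E'))//.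
rewrite (@lt_le_trans _ _ (2%:E * (e / 4)%:E + 2%:E * (e / 4)%:E))//.
  by apply: lteD; rewrite lte_pmul2l.
by rewrite -!EFinM -EFinD lee_fin; lra.
Qed.

Lemma approximableZ a u : measurable_fun setT u ->
  approximable m V u -> approximable m V (fun z => a * u z)%R.
Proof.
move=> mu Au e e0.
have a1 : (0 < `|a| + a ^+ 2 + 1)%R by rewrite ltr_wpDl// addr_ge0// sqr_ge0.
have e' : (0 < e / (`|a| + a ^+ 2 + 1))%R by rewrite divr_gt0.
have [u' [Vu' u1 u2]] := Au _ e'; have mu' := VM Vu'.
have muu' : measurable_fun setT (fun z => u z - u' z)%R by exact: measurable_funB.
have E : (fun z => a * u z - a * u' z)%R = (fun z => a * (u z - u' z))%R.
  by apply/funext => z; rewrite mulrBr.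
have bound (c : R) x : (0 <= c)%R -> (c <= `|a| + a ^+ 2)%R ->
    x < (e / (`|a| + a ^+ 2 + 1))%:E -> c%:E * x < e%:E.
  move=> c0 ca xe.
  apply: (@le_lt_trans _ _ (c%:E * (e / (`|a| + a ^+ 2 + 1))%:E)).
    by apply: lee_wpmul2l; [rewrite lee_fin|exact: ltW].
  rewrite -EFinM lte_fin mulrA ltr_pdivrMr// mulrC ltr_pM2l//.
  by rewrite (le_lt_trans ca)// ltrDl.
exists (fun z => a * u' z)%R; split; first exact: VZ.
  by rewrite E nrm1Z//; apply: bound => //; rewrite lerDl sqr_ge0.
by rewrite E nrm2Z//; apply: bound; rewrite ?sqr_ge0// lerDr.
Qed.

Lemma approximableD u v : measurable_fun setT u -> measurable_fun setT v ->
  approximable m V u -> approximable m V v -> approximable m V (fun z => u z + v z)%R.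
Proof.
move=> mu mv Au Av.
have -> : (fun z => u z + v z)%R = (fun z => u z - (-1) * v z)%R.
  by apply/funext => z; rewrite mulN1r opprK.
by apply: approximableB => //; [exact: measurable_funM|exact: approximableZ].
Qed.

Lemma approximable_sum (I : Type) (s : seq I) (u : I -> T -> R) :
  V (fun=> 0%R) ->
  (forall i, measurable_fun setT (u i)) -> (forall i, approximable m V (u i)) ->
  approximable m V (fun z => \sum_(i <- s) u i z)%R.
Proof.
move=> V0 mu Au; elim: s => [|i s IH].
  under eq_fun do rewrite big_nil.
  exact: approximable_sub.
under eq_fun do rewrite big_cons.
by apply: approximableD => //; exact: measurable_sum.
Qed.

Variable W : set T.
Hypotheses (mW : measurable W) (W_fin : m W < +oo).

Lemma integrable12_indic (A : set T) : measurable A -> m A < +oo ->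
  integrable12 m (\1_A : T -> R).
Proof.
move=> mA A_fin; split; first exact: measurable_indic.
  rewrite /nrm1 (_ : (fun z => (`|\1_A z|%R)%:E) = (fun z => (\1_A z : R)%:E)); last first.
    by apply/funext => z; rewrite ger0_norm// indicE.
  by rewrite integral_indic// setIT.
rewrite /nrm2 (_ : (fun z => ((\1_A z : R) ^+ 2)%:E) = (fun z => (\1_A z : R)%:E)); last first.
  by apply/funext => z; rewrite indicE; case: (_ \in _); rewrite ?expr1n ?expr0n.
by rewrite integral_indic// setIT.
Qed.

(** The sets A such that 1_(A /\ W) is approximable form a Dynkin class; the finite
    measure of W provides the dominating function for disjoint unions. *)
Lemma approximable_dynkin (G : set (set T)) :
  @measurable _ T = <<s G >> -> setI_closed G ->
  approximable m V (\1_W : T -> R) ->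
  (forall A, G A -> approximable m V (\1_(A `&` W) : T -> R)) ->
  forall A, measurable A -> approximable m V (\1_(A `&` W) : T -> R).
Proof.
move=> GE GI AW AG A mA.
have mI (B : set T) : measurable B -> measurable_fun setT (\1_(B `&` W) : T -> R).
  by move=> mB; apply: measurable_indic; exact: measurableI.
suff : <<s G >> `<=` [set A | approximable m V (\1_(A `&` W) : T -> R)].
  by rewrite -GE; apply.
apply: dynkin_induction => //=.
- by rewrite setTI.
- move=> B mB AB.
  rewrite (_ : \1_(~` B `&` W) = (fun z => \1_W z - \1_(B `&` W) z)%R :> (T -> R)).
    by apply: approximableB => //; exact: mI.
  apply/funext => z; rewrite !indicE !in_setI in_setC.
  by case: (z \in B); case: (z \in W); rewrite /= ?subrr ?subr0.
- move=> F mF tF AF.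
  apply: (@approximable_dominated (\1_W) _ (fun n => \1_(\big[setU/set0]_(i < n) F i `&` W))).
  + exact: integrable12_indic.
  + by apply: mI; exact: bigcup_measurable.
  + by move=> n; apply: mI; exact: bigsetU_measurable.
  + move=> n z; rewrite !indicE in_setI; case: (z \in W); last by rewrite andbF normr0.
    by rewrite andbT; case: (_ \in _); rewrite ?normr1 ?normr0.
  + move=> z; apply/cvgrPdist_le => e e0.
    have [zF|zF] := pselect ((\bigcup_k F k) z); last first.
      apply: nearW => n; have zFn : ~ (\big[setU/set0]_(i < n) F i) z.
        by move=> zFn; apply: zF; exact: bigsetU_bigcup zFn.
      by rewrite !indicE !in_setI (memNset zF) (memNset zFn) subrr normr0 ltW.
    have [k _ Fkz] := zF.
    exists k.+1 => // n /= kn; have zFn : (\big[setU/set0]_(i < n) F i) z.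
      by rewrite -bigcup_mkord; exists k.
    by rewrite !indicE !in_setI (mem_set zF) (mem_set zFn) subrr normr0 ltW.
  + elim => [|n IH].
      rewrite big_ord0 set0I (_ : \1_set0 = (fun z => \1_W z - \1_W z)%R :> (T -> R)).
        by apply: approximableB => //; exact: measurable_indic.
      by apply/funext => z; rewrite subrr indic0.
    rewrite big_ord_recr/=.
    rewrite (_ : \1_((_ `|` _) `&` _) = (fun z => \1_(\big[setU/set0]_(i < n) F i `&` W) z
       + \1_(F n `&` W) z)%R :> (T -> R)).
      by apply: approximableD => //; apply: mI => //; exact: bigsetU_measurable.
    apply/funext => z; rewrite !indicE !in_setI in_setU.
    case: (z \in W); rewrite ?andbF ?addr0// !andbT.
    case: (boolP (z \in F n)) => zFn; last by rewrite orbF addr0.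
    rewrite orbT memNset ?add0r// -bigcup_mkord => -[k /= kn Fkz].
    move/set_mem in zFn.
    have kn' : k = n by apply: tF => //; exists z.
    by rewrite /= kn' ltnn in kn.
Qed.

Import HBNNSimple.

Let approximable_ge0_bounded : 
  (forall A, measurable A -> approximable m V (\1_(A `&` W) : T -> R)) ->
  V (fun=> 0%R) ->
  forall (M : R) u, measurable_fun setT u -> (forall z, 0 <= u z <= M)%R ->
    (forall z, ~ W z -> u z = 0%R) -> approximable m V u.
Proof.
move=> AW V0 M u mu uM u0.
have mEu : measurable_fun setT (EFin \o u) by exact/measurable_EFinP.
pose h := nnsfun_approx measurableT mEu.
have hu z : (h n z)%:E @[n --> \oo] --> (u z)%:E.
  by apply: cvg_nnsfun_approx => // x _; rewrite lee_fin; have /andP[] := uM x.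
have h_nd z : {homo (fun n => (h n z)%:E) : a b / (a <= b)%N >-> a <= b}.
  by move=> a b ab; rewrite lee_fin; exact/(lefP _ _ (nd_nnsfun_approx _ _ ab)).
have h_le n z : (h n z <= u z)%R.
  rewrite -lee_fin -(cvg_lim _ (hu z))//.
  apply: lime_ge; first by apply/cvg_ex; eexists; exact: hu.
  by exists n => // k /= nk; exact: h_nd.
have mA (B : set T) : measurable B -> measurable_fun setT (\1_(B `&` W) : T -> R).
  by move=> mB; apply: measurable_indic; exact: measurableI.
apply: (@approximable_dominated (fun z => M * \1_W z)%R _ (fun n z => h n z * \1_W z)%R) => //.
- by apply: integrable12Z; exact: integrable12_indic.
- by move=> n; apply: measurable_funM => //; exact: measurable_indic.
- move=> n z; rewrite normrM !ger0_norm ?indicE// ler_wpM2r//.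
  by rewrite (le_trans (h_le n z))//; have /andP[] := uM z.
- move=> z; rewrite (_ : u z = u z * \1_W z)%R.
    apply: cvgM; last exact: cvg_cst.
    exact: (fine_cvg (hu z)).
  rewrite indicE; case: (boolP (z \in W)) => zW; first by rewrite mulr1.
  by rewrite mulr0 u0//; move/negP: zW; apply: contra_not => /mem_set.
- move=> n.
  have -> : (fun z => h n z * \1_W z)%R =
      (fun z => \sum_(r <- finmap.enum_fset (fset_set (range (h n)))) r * \1_((h n @^-1` [set r]) `&` W) z)%R.
    apply/funext => z; rewrite (fimfunE (h n) z) fsbig_finite//= mulr_suml.
    by apply: eq_bigr => r _; rewrite indicI mulrA.
  apply: approximable_sum => // r.
    by apply: measurable_funM => //; exact: mA.
  by apply: approximableZ; [exact: mA|exact: AW].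
Qed.

(** Split into positive and negative parts, and approximate each by simple functions. *)
Lemma approximable_bounded :
  (forall A, measurable A -> approximable m V (\1_(A `&` W) : T -> R)) ->
  V (fun=> 0%R) ->
  forall (M : R) u, measurable_fun setT u -> (forall z, `|u z| <= M)%R ->
    (forall z, ~ W z -> u z = 0%R) -> approximable m V u.
Proof.
move=> AW V0 M u mu uM u0.
rewrite (_ : u = (fun z => Num.max (u z) 0 - Num.max (- u z) 0)%R); last first.
  apply/funext => z; have [z0|/ltW z0] := leP 0%R (u z).
    by rewrite (max_idPr _) ?subr0// oppr_le0.
  by rewrite (max_idPl _) ?sub0r ?opprK// oppr_ge0.
have mp : measurable_fun setT (fun z => Num.max (u z) 0)%R by exact: measurable_maxr.
have mn : measurable_fun setT (fun z => Num.max (- u z) 0)%R.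
  by apply: measurable_maxr => //; exact: measurableT_comp.
apply: approximableB => //; apply: (approximable_ge0_bounded AW V0 (M := M)) => //.
- move=> z; rewrite le_max lexx orbT/= ge_max (le_trans (ler_norm _) (uM z))/=.
  by rewrite (le_trans _ (uM z)).
- by move=> z /u0 ->; rewrite maxxx.
- move=> z; rewrite le_max lexx orbT/= ge_max (le_trans _ (uM z)) ?andbT//=; last first.
    by rewrite -normrN ler_norm.
  by rewrite (le_trans _ (uM z)).
- by move=> z /u0 ->; rewrite oppr0 maxxx.
Qed.

End Approximation.

(** * Product functions on the half-plane *)

Section TensorIntegrals.
Context {R : realType}.
Variable alpha : R.
Local Notation GR := (measurableTypeR R).
Local Notation mu := (@lebesgue_measure R).
Local Notation m := (laguerre_measure alpha).
Local Notation rho := (radial_weight alpha).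
Implicit Types p q : GR -> R.

Definition tensor p q (z : GR * GR) : R := p z.1 * q z.2.

Lemma measurable_tensor p q : measurable_fun setT p -> measurable_fun setT q ->
  measurable_fun setT (tensor p q).
Proof.
by move=> mp mq; apply: measurable_funM; apply: measurableT_comp.
Qed.

Lemma ge0_integral_tensor p q : measurable_fun setT p -> measurable_fun setT q ->
  (forall x, 0 <= p x) -> (forall t, 0 <= q t) ->
  (\int[m]_z (tensor p q z)%:E = \int[mu]_x (p x * rho x)%:E * \int[mu]_t (q t)%:E)%E.
Proof.
move=> mp mq p0 q0.
have pr0 x : 0 <= p x * rho x by rewrite mulr_ge0 ?radial_weight_ge0.
have mpr : measurable_fun setT (fun x => p x * rho x).
  by apply: measurable_funM => //; exact: measurable_radial_weight.
rewrite ge0_integral_laguerre_measure; last 2 first.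
- by apply/measurable_EFinP; exact: measurable_tensor.
- by move=> z; rewrite lee_fin mulr_ge0.
transitivity (\int[mu]_x ((p x * rho x)%:E * \int[mu]_t (q t)%:E))%E.
  apply: eq_integral => x _; rewrite -ge0_integralZl//=.
  - by apply: eq_integral => t _; rewrite /tensor/= -!EFinM; congr EFin; ring.
  - exact/measurable_EFinP.
  - by move=> t _; rewrite lee_fin.
  - by rewrite lee_fin.
rewrite ge0_integralZr//=.
- exact/measurable_EFinP.
- by move=> x _; rewrite lee_fin.
- by apply: integral_ge0 => t _; rewrite lee_fin.
Qed.

Let ge0_tensor p q : measurable_fun setT p -> measurable_fun setT q ->
  (forall x, 0 <= p x) -> (forall t, 0 <= q t) ->
  mu.-integrable setT (fun x => (p x * rho x)%:E) ->
  mu.-integrable setT (fun t => (q t)%:E) ->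
  m.-integrable setT (fun z => (tensor p q z)%:E) /\
  \int[m]_z (tensor p q z) = (\int[mu]_x (p x * rho x)) * (\int[mu]_t (q t)).
Proof.
move=> mp mq p0 q0 ip iq.
have E := ge0_integral_tensor mp mq p0 q0.
have fp := integrable_fin_num measurableT ip.
have fq := integrable_fin_num measurableT iq.
split; last by rewrite /Rintegral E fineM.
apply/integrableP; split; first by apply/measurable_EFinP; exact: measurable_tensor.
under eq_integral do rewrite /= ger0_norm ?mulr_ge0//.
by rewrite E -(fineK fp) -(fineK fq) -EFinM ltry.
Qed.

Lemma Rintegral_tensor p q : measurable_fun setT p -> measurable_fun setT q ->
  mu.-integrable setT (fun x => (p x * rho x)%:E) ->
  mu.-integrable setT (fun t => (q t)%:E) ->
  m.-integrable setT (fun z => (tensor p q z)%:E) /\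
  \int[m]_z (tensor p q z) = (\int[mu]_x (p x * rho x)) * (\int[mu]_t (q t)).
Proof.
move=> mp mq ip iq.
pose pos (f : GR -> R) x := Num.max (f x) 0.
pose neg (f : GR -> R) x := Num.max (- f x) 0.
have pn f x : f x = pos f x - neg f x.
  rewrite /pos /neg; have [z0|/ltW z0] := leP 0 (f x).
    by rewrite (max_idPr _) ?subr0// oppr_le0.
  by rewrite (max_idPl _) ?sub0r ?opprK// oppr_ge0.
have pos0 f x : 0 <= pos f x by rewrite le_max lexx orbT.
have neg0 f x : 0 <= neg f x by rewrite le_max lexx orbT.
have pos_le f x : pos f x <= `|f x| by rewrite ge_max ler_norm normr_ge0.
have neg_le f x : neg f x <= `|f x| by rewrite ge_max -normrN ler_norm normr_ge0.
have mpos f : measurable_fun setT f -> measurable_fun setT (pos f).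
  by move=> mf; exact: measurable_maxr.
have mneg f : measurable_fun setT f -> measurable_fun setT (neg f).
  by move=> mf; apply: measurable_maxr => //; exact: measurableT_comp.
have mrho : measurable_fun setT rho := measurable_radial_weight alpha.
have ip' (f : GR -> R) : measurable_fun setT f -> (forall x, 0 <= f x) -> (forall x, f x <= `|p x|) ->
    mu.-integrable setT (fun x => (f x * rho x)%:E).
  move=> mf f0 fp; apply: le_integrable ip => //.
    by apply/measurable_EFinP; exact: measurable_funM.
  move=> x _; rewrite /= lee_fin !normrM ler_wpM2r//.
  by rewrite ger0_norm.
have iq' (f : GR -> R) : measurable_fun setT f -> (forall x, 0 <= f x) -> (forall x, f x <= `|q x|) ->
    mu.-integrable setT (fun x => (f x)%:E).
  move=> mf f0 fp; apply: le_integrable iq => //; first exact/measurable_EFinP.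
  by move=> x _; rewrite /= lee_fin ger0_norm.
have ipp := ip' _ (mpos _ mp) (pos0 p) (pos_le p).
have ipn := ip' _ (mneg _ mp) (neg0 p) (neg_le p).
have iqp := iq' _ (mpos _ mq) (pos0 q) (pos_le q).
have iqn := iq' _ (mneg _ mq) (neg0 q) (neg_le q).
have [i1 E1] := ge0_tensor (mpos _ mp) (mpos _ mq) (pos0 p) (pos0 q) ipp iqp.
have [i2 E2] := ge0_tensor (mneg _ mp) (mneg _ mq) (neg0 p) (neg0 q) ipn iqn.
have [i3 E3] := ge0_tensor (mpos _ mp) (mneg _ mq) (pos0 p) (neg0 q) ipp iqn.
have [i4 E4] := ge0_tensor (mneg _ mp) (mpos _ mq) (neg0 p) (pos0 q) ipn iqp.
have E z : tensor p q z = (tensor (pos p) (pos q) z + tensor (neg p) (neg q) z) -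
    (tensor (pos p) (neg q) z + tensor (neg p) (pos q) z).
  by rewrite /tensor (pn p) (pn q); ring.
have i12 : m.-integrable setT (fun z => (tensor (pos p) (pos q) z + tensor (neg p) (neg q) z)%:E).
  by apply: eq_integrable (integrableD _ i1 i2).
have i34 : m.-integrable setT (fun z => (tensor (pos p) (neg q) z + tensor (neg p) (pos q) z)%:E).
  by apply: eq_integrable (integrableD _ i3 i4).
split.
  by apply: eq_integrable (integrableB _ i12 i34) => // z _; rewrite E.
transitivity (\int[m]_z ((tensor (pos p) (pos q) z + tensor (neg p) (neg q) z) -
    (tensor (pos p) (neg q) z + tensor (neg p) (pos q) z))).
  by apply: eq_Rintegral => z _; exact: E.
rewrite RintegralB// RintegralD// RintegralD// E1 E2 E3 E4.
have -> : \int[mu]_x (p x * rho x) = \int[mu]_x (pos p x * rho x) - \int[mu]_x (neg p x * rho x).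
  rewrite -RintegralB//; apply: eq_Rintegral => x _.
  by rewrite {1}(pn p) mulrBl.
have -> : \int[mu]_x (q x) = \int[mu]_x (pos q x) - \int[mu]_x (neg q x).
  by rewrite -RintegralB//; apply: eq_Rintegral => x _; exact: pn.
ring.
Qed.

End TensorIntegrals.

(** * Polynomials converging to a step function *)

Section StepPolynomials.
Context {R : realType}.
Variable y0 : R.
Hypothesis y0_itv : 0 < y0 <= 1.

Let y0_gt0 : 0 < y0. Proof. by have /andP[] := y0_itv. Qed.

Definition step_exponent (n : nat) : nat :=
  (n.+1 * (Num.truncn (y0^-1 ^+ n.+1)).+1)%N.

(** A polynomial in y that tends to the indicator of y >= y0 on [0, 1].  With
    exponent K = n / y0^n, the quantity (1 - y^n)^K is about exp(-n (y / y0)^n). *)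
Definition step_poly (n : nat) (y : R) : R :=
  1 - (1 - y ^+ n.+1) ^+ step_exponent n.

Let pow_itv (y : R) n : 0 <= y <= 1 -> 0 <= y ^+ n <= 1.
Proof. by move=> /andP[y_ge0 y_le1]; rewrite exprn_ge0//= exprn_ile1. Qed.

Lemma step_poly_itv n (y : R) : 0 <= y <= 1 -> 0 <= step_poly n y <= 1.
Proof.
move=> /(pow_itv n.+1)/andP[a0 a1].
have b0 : 0 <= 1 - y ^+ n.+1 by rewrite subr_ge0.
have b1 : 1 - y ^+ n.+1 <= 1 by rewrite lerBlDr lerDl.
by rewrite /step_poly subr_ge0 exprn_ile1//= lerBlDr lerDl exprn_ge0.
Qed.

Let bernoulli (a : R) K : 0 <= a <= 1 -> 1 - K%:R * a <= (1 - a) ^+ K.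
Proof.
move=> /andP[a0 a1]; elim: K => [|K IH]; first by rewrite mul0r subr0 expr0.
rewrite exprS (le_trans _ (ler_wpM2l _ IH)) ?subr_ge0//.
rewrite -natr1 -subr_ge0 (_ : _ - _ = K%:R * a ^+ 2); last by ring.
by rewrite mulr_ge0 ?sqr_ge0.
Qed.

Let step_exponent_le n : (step_exponent n)%:R <= 2 * n.+1%:R * y0^-1 ^+ n.+1.
Proof.
have y1 : 1 <= y0^-1 ^+ n.+1.
  by rewrite exprn_ege1// invf_ge1//; have /andP[] := y0_itv.
rewrite /step_exponent natrM [2 * _]mulrC -mulrA ler_wpM2l// -natr1.
by have /andP[t1 _] := truncn_itv (le_trans ler01 y1); lra.
Qed.

Let step_exponent_ge n : n.+1%:R * y0^-1 ^+ n.+1 <= (step_exponent n)%:R.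
Proof. by rewrite /step_exponent natrM ler_wpM2l// ltW// truncnS_gt. Qed.

Lemma step_poly_le_geometric n (y : R) : 0 <= y <= 1 ->
  step_poly n y <= 2 * (n.+1%:R * (y / y0) ^+ n.+1).
Proof.
move=> y01; have a01 := pow_itv n.+1 y01; have /andP[a0 a1] := a01.
have B := bernoulli (step_exponent n) a01.
have E := ler_wpM2r a0 (step_exponent_le n).
have -> : 2 * (n.+1%:R * (y / y0) ^+ n.+1) = 2 * n.+1%:R * y0^-1 ^+ n.+1 * y ^+ n.+1.
  by rewrite exprMn; ring.
by rewrite /step_poly; lra.
Qed.

(** A bound linear in y and uniform in n: since y will be an integrable atom, it
    makes dominated convergence available on an infinite measure space. *)
Lemma step_poly_le_linear n (y : R) : 0 <= y <= 1 -> step_poly n y <= 2 / y0 * y.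
Proof.
move=> y01; have /andP[y_ge0 y_le1] := y01.
set r := y / y0.
have r0 : 0 <= r by rewrite divr_ge0 ?(ltW y0_gt0).
have -> : 2 / y0 * y = 2 * r by rewrite /r; ring.
have [r12|r12] := leP r 2^-1; last first.
  have /andP[_ s1] := step_poly_itv n y01; rewrite (le_trans s1)//.
  lra.
rewrite (le_trans (step_poly_le_geometric n y01))// ler_wpM2l// -/r.
rewrite exprS mulrCA ler_piMr//.
rewrite (@le_trans _ _ (n.+1%:R * (2^-1) ^+ n))//.
  by rewrite ler_wpM2l// lerXn2r ?nnegrE ?invr_ge0.
rewrite exprVn ler_pdivrMr ?exprn_gt0// mul1r -natrX ler_nat.
exact: ltn_expl.
Qed.

Let cvg_natS_geometric (r : R) : 0 <= r < 1 -> n.+1%:R * r ^+ n.+1 @[n --> \oo] --> 0.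
Proof.
move=> /andP[]; rewrite le_eqVlt => /predU1P[<- _|r0 r1].
  by under eq_fun do rewrite exprS mul0r mulr0; exact: cvg_cst.
pose a := - ln r; have a0 : 0 < a by rewrite oppr_gt0 ln_lt0// r0.
have c : a * n.+1%:R @[n --> \oo] --> +oo.
  apply: (@cvg_comp _ _ _ (fun n : nat => n.+1%:R : R) (fun x : R => a * x) _ (pinfty_nbhs R)).
    apply/cvgryPge => A; have := @cvgr_idn R; move=> /cvgryPge/(_ A).
    by apply: filterS => n; move=> /le_trans; apply; rewrite ler_nat.
  by apply: gt0_cvgMry => //; exact: cvg_id.
have := cvg_comp _ _ c (cvg_powR_expR0 (@ltr01 R)).
move=> /(cvgM (cvg_cst a^-1)); rewrite mulr0.
apply: cvg_trans; apply: near_eq_cvg; apply: nearW => n /=.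
rewrite powRr1; last by rewrite mulr_ge0// ltW.
rewrite mulrA mulrA mulVf ?gt_eqF// mul1r; congr (_ * _).
by rewrite mulrC -mulrN opprK expRM_natl lnK// posrE.
Qed.

Lemma cvg_step_poly (y : R) : 0 <= y <= 1 ->
  step_poly n y @[n --> \oo] --> ((y0 <= y)%R%:R : R).
Proof.
move=> y01; have /andP[y_ge0 y_le1] := y01.
have [yy|yy] := leP y0 y.
  rewrite -[X in _ --> X]subr0; apply: cvgB; first exact: cvg_cst.
  apply: (@squeeze_cvgr _ _ _ _ (cst 0) (fun n => expR (- n%:R))); last 2 first.
  - exact: cvg_cst.
  - exact: cvgn_expR.
  apply: nearW => n /=; have /andP[a0 a1] := pow_itv n.+1 y01.
  have b0 : 0 <= 1 - y ^+ n.+1 by rewrite subr_ge0.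
  rewrite exprn_ge0//=.
  apply: (@le_trans _ _ (expR (- (y ^+ n.+1)) ^+ step_exponent n)).
    by rewrite lerXn2r ?nnegrE ?expR_ge0// expR_ge1Dx.
  rewrite -expRM_natl ler_expR mulrN lerN2.
  apply: (@le_trans _ _ (n.+1%:R * y0^-1 ^+ n.+1 * y ^+ n.+1)); last first.
    by rewrite ler_wpM2r// step_exponent_ge.
  rewrite -mulrA -exprMn (@le_trans _ _ n.+1%:R)// ?ler_nat// ler_peMr//.
  by rewrite exprn_ege1// mulrC ler_pdivlMr// mul1r.
apply: (@squeeze_cvgr _ _ _ _ (cst 0) (fun n => 2 * (n.+1%:R * (y / y0) ^+ n.+1))).
- apply: nearW => n /=; rewrite step_poly_le_geometric// andbT.
  by have /andP[] := step_poly_itv n y01.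
- exact: cvg_cst.
- rewrite -[X in _ --> X](mulr0 2); apply: cvgM; first exact: cvg_cst.
  by apply: cvg_natS_geometric; rewrite divr_ge0 ?(ltW y0_gt0)//= ltr_pdivrMr// mul1r.
Qed.

(** Having no constant term, the polynomial maps an atom into the span of its
    positive powers. *)
Lemma step_polyP n : exists H : {poly R}, forall y, step_poly n y = y * H.[y].
Proof.
exists ('X^n * \sum_(i < step_exponent n) (1 - 'X^(n.+1)) ^+ i : {poly R})%R => y.
transitivity (1 ^+ step_exponent n - (1 - y ^+ n.+1) ^+ step_exponent n).
  by rewrite expr1n.
rewrite subrXX (_ : 1 - (1 - y ^+ n.+1) = y ^+ n.+1); last by ring.
rewrite hornerM hornerXn horner_sum mulrA -exprS; congr (_ * _).
apply: eq_bigr => i _; rewrite expr1n mul1r.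
by rewrite horner_exp hornerD hornerN hornerXn hornerC.
Qed.

End StepPolynomials.

(** * The exponential atoms and their density *)

Section HalfLine.
Context {R : realType}.
Local Notation GR := (measurableTypeR R).
Local Notation mu := (@lebesgue_measure R).

Lemma integral_halfline (a : R) (f : GR -> R) :
  (\int[mu]_x (\1_[set x | a <= x] x * f x)%:E = \int[mu]_(x in `[a, +oo[) (f x)%:E)%E.
Proof.
rewrite [RHS]integral_mkcond; apply: eq_integral => x _.
by rewrite patchE indicE set_itvcy; case: ifPn => _; rewrite ?mul1r ?mul0r.
Qed.

Lemma integrable_halfline (a : R) (f : GR -> R) :
  mu.-integrable `[a, +oo[ (EFin \o f) ->
  mu.-integrable setT (fun x => (\1_[set x | a <= x] x * f x)%:E).
Proof.
move=> intf; have H : mu.-integrable setT ((EFin \o f) \_ `[a, +oo[).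
  by apply: (proj1 (integrable_mkcond _ _) intf); exact: measurable_itv.
apply: (@eq_integrable _ _ _ mu setT measurableT _ _ _ H) => x _.
by rewrite patchE indicE set_itvcy/=; case: ifPn => _; rewrite ?mul1r ?mul0r.
Qed.

Lemma measurable_halfline (a : R) : measurable_fun setT (\1_[set x | a <= x] : GR -> R).
Proof. by apply: measurable_indic; rewrite -set_itvcy; exact: measurable_itv. Qed.

End HalfLine.

Section ExponentialSpan.
Context {R : realType}.
Variable alpha : R.
Hypothesis alpha_ge0 : 0 <= alpha.
Variable N : R.
Local Notation GR := (measurableTypeR R).
Local Notation mu := (@lebesgue_measure R).
Local Notation m := (laguerre_measure alpha).
Local Notation rho := (radial_weight alpha).

Definition radial_atom (x : GR) : R := \1_[set x | 0 <= x] x * expR (- (x ^+ 2)).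
Definition time_atom (t : GR) : R := \1_[set t | - N <= t] t * expR (- (t + N)).

Lemma radial_atom_exp j x :
  radial_atom x ^+ j.+1 = \1_[set x | 0 <= x] x * expR (- (j.+1%:R * x ^+ 2)).
Proof.
rewrite /radial_atom exprMn -expRM_natl mulrN indicE.
by case: (_ \in _); rewrite ?expr1n// expr0n mul0r.
Qed.

Lemma time_atom_exp k t :
  time_atom t ^+ k.+1 = \1_[set t | - N <= t] t * damping k.+1%:R N t.
Proof.
rewrite /time_atom exprMn -expRM_natl mulrN indicE /damping.
by case: (_ \in _); rewrite ?expr1n// expr0n mul0r.
Qed.

Lemma radial_atom_itv x : 0 <= radial_atom x <= 1.
Proof.
rewrite /radial_atom indicE; case: (_ \in _); last by rewrite mul0r lexx ler01.
by rewrite mul1r expR_ge0 expR_le1 oppr_le0 sqr_ge0.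
Qed.

Lemma time_atom_itv t : 0 <= time_atom t <= 1.
Proof.
rewrite /time_atom indicE; case: (boolP (_ \in _)); last by rewrite mul0r lexx ler01.
rewrite inE/= => Nt; rewrite mul1r expR_ge0 expR_le1 oppr_le0.
by rewrite -lerBlDr sub0r Nt.
Qed.

(** Each atom is strictly decreasing on its half-line and 0 before it, so its
    superlevel sets are bounded intervals. *)
Lemma radial_atom_ge p x : 0 <= p -> (expR (- (p ^+ 2)) <= radial_atom x) = (0 <= x <= p).
Proof.
move=> p0; rewrite /radial_atom indicE.
have [x0|x0] := leP 0 x.
  by rewrite mem_set//= mul1r ler_expR lerN2 ler_pXn2r.
by rewrite memNset/= ?mul0r ?leNgt ?expR_gt0//= x0.
Qed.

Lemma time_atom_ge q t : (expR (- (q + N)) <= time_atom t) = (- N <= t <= q).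
Proof.
rewrite /time_atom indicE.
have [t0|t0] := leP (- N) t.
  by rewrite mem_set//= mul1r ler_expR lerN2 lerD2r.
by rewrite memNset/= ?mul0r ?leNgt ?expR_gt0//= t0.
Qed.

Lemma measurable_radial_atom : measurable_fun setT radial_atom.
Proof.
apply: measurable_funM; first exact: measurable_halfline.
by apply: measurableT_comp => //; exact: measurableT_comp.
Qed.

Lemma measurable_time_atom : measurable_fun setT time_atom.
Proof.
apply: measurable_funM; first exact: measurable_halfline.
apply: measurableT_comp => //; apply: measurableT_comp => //.
exact: measurable_funD.
Qed.

Lemma radial_atom_weight j x :
  radial_atom x ^+ j.+1 * rho x = \1_[set x | 0 <= x] x *
    ((pi * Gamma (alpha + 1))^-1 * gaussian_moment alpha j.+1%:R x).
Proof.
rewrite radial_atom_exp /radial_weight /gaussian_moment !indicE.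
by case: (_ \in _); rewrite ?mul0r// !mul1r; ring.
Qed.

Lemma integral_radial_atom j :
  (\int[mu]_x (radial_atom x ^+ j.+1 * rho x)%:E =
   ((2 * pi * j.+1%:R `^ (alpha + 1))^-1)%:E)%E.
Proof.
under eq_integral do rewrite radial_atom_weight.
rewrite integral_halfline; under eq_integral do rewrite EFinM.
rewrite integralZl//; last exact: integrable_gaussian_moment.
rewrite integral_gaussian_moment// -EFinM; congr EFin.
have p0 : pi != 0 :> R by rewrite gt_eqF// pi_gt0.
have g0 : Gamma (alpha + 1) != 0 by rewrite gt_eqF// Gamma_gt0.
have c0 : j.+1%:R `^ (alpha + 1) != 0 by rewrite gt_eqF// powR_gt0.
move: (pi) (Gamma _) (_ `^ _) p0 g0 c0 => P G C p0 g0 c0.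
by field; rewrite p0 g0 c0.
Qed.

Lemma integral_time_atom k : (\int[mu]_t (time_atom t ^+ k.+1)%:E = (k.+1%:R^-1)%:E)%E.
Proof.
under eq_integral do rewrite time_atom_exp.
by rewrite integral_halfline integral_damping.
Qed.

(** Indices are shifted by 1 because the power 0 is not integrable. *)
Definition atom (j k : nat) : GR * GR -> R :=
  tensor (fun x => radial_atom x ^+ j.+1) (fun t => time_atom t ^+ k.+1).

Lemma measurable_atom j k : measurable_fun setT (atom j k).
Proof.
by apply: measurable_tensor; apply: measurable_funX;
  [exact: measurable_radial_atom|exact: measurable_time_atom].
Qed.

Lemma integral_atom j k : (\int[m]_z (atom j k z)%:E =
  ((2 * pi * j.+1%:R `^ (alpha + 1))^-1 * k.+1%:R^-1)%:E)%E.
Proof.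
rewrite ge0_integral_tensor.
- by rewrite integral_radial_atom integral_time_atom.
- by apply: measurable_funX; exact: measurable_radial_atom.
- by apply: measurable_funX; exact: measurable_time_atom.
- by move=> x; rewrite exprn_ge0//; have /andP[] := radial_atom_itv x.
- by move=> t; rewrite exprn_ge0//; have /andP[] := time_atom_itv t.
Qed.

Lemma atom_ge0 j k z : 0 <= atom j k z.
Proof.
have /andP[x0 _] := radial_atom_itv z.1; have /andP[t0 _] := time_atom_itv z.2.
by rewrite mulr_ge0// exprn_ge0.
Qed.

(** The span of the atoms is closed under products; in particular squares of atoms
    are atoms and have explicit integrals. *)
Lemma atomM j k j' k' z : atom j k z * atom j' k' z = atom (j + j').+1 (k + k').+1 z.
Proof.
by rewrite /atom /tensor/= mulrACA -!exprD !addSn !addnS.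
Qed.

Lemma integrable12_atom j k : integrable12 m (atom j k).
Proof.
split; first exact: measurable_atom.
  rewrite /nrm1; under eq_integral do rewrite ger0_norm ?atom_ge0//.
  by rewrite integral_atom ltry.
rewrite /nrm2; under eq_integral do rewrite expr2 atomM.
by rewrite integral_atom ltry.
Qed.

Definition atom_sum (l : seq (R * (nat * nat))) (z : GR * GR) : R :=
  \sum_(a <- l) a.1 * atom a.2.1 a.2.2 z.

Definition atom_span (u : GR * GR -> R) := exists l, u = atom_sum l.

Lemma atom_span0 : atom_span (fun=> 0).
Proof. by exists [::]; apply/funext => z; rewrite /atom_sum big_nil. Qed.

Lemma atom_spanZ a u : atom_span u -> atom_span (fun z => a * u z).
Proof.
move=> [l ->]; exists [seq (a * p.1, p.2) | p <- l]; apply/funext => z.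
by rewrite /atom_sum big_map mulr_sumr; apply: eq_bigr => p _; rewrite mulrA.
Qed.

Lemma atom_spanB u v : atom_span u -> atom_span v -> atom_span (fun z => u z - v z).
Proof.
move=> [l ->] /(atom_spanZ (-1))[l' E]; exists (l ++ l'); apply/funext => z.
by rewrite /atom_sum big_cat/= -/(atom_sum l' z) -E mulN1r.
Qed.

Lemma integrable12_atom_span u : atom_span u -> integrable12 m u.
Proof.
move=> [l ->]; elim: l => [|a l IH].
  split; rewrite /atom_sum.
  - by under eq_fun do rewrite big_nil; exact: measurable_cst.
  - by rewrite /nrm1 integral0_eq// => z _; rewrite big_nil normr0.
  - by rewrite /nrm2 integral0_eq// => z _; rewrite big_nil expr0n.
have -> : atom_sum (a :: l) = (fun z => a.1 * atom a.2.1 a.2.2 z + atom_sum l z).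
  by apply/funext => z; rewrite /atom_sum big_cons.
by apply: integrable12D => //; apply: integrable12Z; exact: integrable12_atom.
Qed.

Lemma measurable_atom_span u : atom_span u -> measurable_fun setT u.
Proof. by move=> /integrable12_atom_span[]. Qed.

Lemma atom_span_poly (P Q : {poly R}) :
  atom_span (tensor (fun x => radial_atom x * P.[radial_atom x])
                    (fun t => time_atom t * Q.[time_atom t])).
Proof.
exists [seq (P`_i * Q`_j, (i, j)) | i <- index_iota 0 (size P), j <- index_iota 0 (size Q)].
apply/funext => -[x t]; rewrite /atom_sum /tensor/= big_allpairs_dep/=.
rewrite big_mkord !horner_coef [LHS]mulrACA big_distrlr/= mulr_sumr.
apply: eq_bigr => i _; rewrite big_mkord mulr_sumr; apply: eq_bigr => j _.
by rewrite /atom /tensor/= !exprS; ring.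
Qed.

Definition window (p q : R) : set (GR * GR) :=
  [set z | 0 <= z.1 <= p /\ - N <= z.2 <= q].

Lemma windowE p q : window p q = `[0, p]%classic `*` `[- N, q]%classic.
Proof. by apply/seteqP; split => -[x t] /=; rewrite !in_itv/=. Qed.

Lemma measurable_window p q : measurable (window p q).
Proof. by rewrite windowE; exact: measurableX. Qed.

(** Compose the step polynomials with the atoms: a window is the intersection of a
    superlevel set in x and one in t. *)
Lemma approximable_window p q : approximable m atom_span (\1_(window p q) : GR * GR -> R).
Proof.
have [p0|p0] := ltP p 0.
  rewrite (_ : \1_(window p q) = fun=> 0); first exact/approximable_sub/atom_span0.
  apply/funext => z; rewrite indicE memNset// => -[/andP[z0 zp] _].
  by move: p0; rewrite ltNge (le_trans z0 zp).
have [qN|qN] := ltP q (- N).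
  rewrite (_ : \1_(window p q) = fun=> 0); first exact/approximable_sub/atom_span0.
  apply/funext => z; rewrite indicE memNset// => -[_ /andP[z0 zp]].
  by move: qN; rewrite ltNge (le_trans z0 zp).
pose y0 := expR (- (p ^+ 2)); pose z0 := expR (- (q + N)).
have y01 : 0 < y0 <= 1 by rewrite expR_gt0 expR_le1 oppr_le0 sqr_ge0.
have z01 : 0 < z0 <= 1 by rewrite expR_gt0 expR_le1 oppr_le0 -lerBlDr sub0r.
have /andP[y0_gt0 _] := y01; have /andP[z0_gt0 _] := z01.
pose v n : GR * GR -> R := tensor (fun x => step_poly y0 n (radial_atom x))
   (fun t => step_poly z0 n (time_atom t)).
have Vv n : atom_span (v n).
  have [P HP] := step_polyP y0 n; have [Q HQ] := step_polyP z0 n.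
  rewrite (_ : v n = tensor (fun x => radial_atom x * P.[radial_atom x])
                    (fun t => time_atom t * Q.[time_atom t])); first exact: atom_span_poly.
  by apply/funext => z; rewrite /v /tensor HP HQ.
apply: (@approximable_dominated _ _ _ m atom_span measurable_atom_span
  (fun z => (2 / y0) * (2 / z0) * atom 0 0 z) _ v).
- by apply: integrable12Z; exact: integrable12_atom.
- by apply: measurable_indic; exact: measurable_window.
- by move=> n; exact: measurable_atom_span.
- move=> n z; rewrite /v /tensor/= /atom /tensor !expr1.
  have x1 := radial_atom_itv z.1; have t1 := time_atom_itv z.2.
  have /andP[sx0 _] := step_poly_itv y0 n x1; have /andP[st0 _] := step_poly_itv z0 n t1.
  rewrite ger0_norm ?mulr_ge0// mulrACA ler_pM//; exact: step_poly_le_linear.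
- move=> z.
  rewrite (_ : \1_(window p q) z = (y0 <= radial_atom z.1)%R%:R * (z0 <= time_atom z.2)%R%:R).
    by apply: cvgM; apply: cvg_step_poly => //; [exact: radial_atom_itv|exact: time_atom_itv].
  rewrite radial_atom_ge// time_atom_ge indicE -natrM mulnb; congr (_%:R).
  by congr nat_of_bool; apply/idP/andP; rewrite inE.
- by move=> n; apply: approximable_sub; exact: Vv.
Qed.

(** A generating family stable under intersection whose traces on a window are
    differences of windows. *)
Definition quadrants : set (set (GR * GR)) :=
  [set `]p.1, +oo[%classic `*` `]p.2, +oo[%classic | p in [set: R * R]].

Lemma measurable_quadrants : @measurable _ (GR * GR)%type = <<s quadrants >>.
Proof.
apply/seteqP; split; last first.
  apply: smallest_sub; first exact: sigma_algebra_measurable.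
  by move=> _ [p _ <-]; exact: measurableX.
pose T := g_sigma_algebraType quadrants.
have natR (x : R) : exists n : nat, - n%:R < x.
  exists (Num.truncn `|x|).+1; rewrite ltrNl (le_lt_trans (ler_norm _))// normrN.
  exact: truncnS_gt.
have mfst : measurable_fun [set: T] (fst : T -> GR).
  apply: (@measurability _ _ _ _ _ _ (@RGenOInfty.G R)); first exact: RGenOInfty.measurableE.
  move=> _ [_ [x ->] <-]; rewrite setTI.
  rewrite (_ : _ @^-1` _ = \bigcup_n (`]x, +oo[%classic `*` `](- n%:R), +oo[%classic)).
    by apply: bigcup_measurable => n _; apply: sub_sigma_algebra; exists (x, - n%:R).
  apply/seteqP; split => [[y t]|[y t] [n _ []]]//= xy.
  by have [n nt] := natR t; exists n => //; split=> //=; rewrite in_itv/= nt.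
have msnd : measurable_fun [set: T] (snd : T -> GR).
  apply: (@measurability _ _ _ _ _ _ (@RGenOInfty.G R)); first exact: RGenOInfty.measurableE.
  move=> _ [_ [x ->] <-]; rewrite setTI.
  rewrite (_ : _ @^-1` _ = \bigcup_n (`](- n%:R), +oo[%classic `*` `]x, +oo[%classic)).
    by apply: bigcup_measurable => n _; apply: sub_sigma_algebra; exists (- n%:R, x).
  apply/seteqP; split => [[y t]|[y t] [n _ []]]//= xy.
  by have [n nt] := natR y; exists n => //; split=> //=; rewrite in_itv/= nt.
apply: smallest_sub; first exact: smallest_sigma_algebra.
rewrite subUset; split=> _ [A mA <-]; [exact: mfst|exact: msnd].
Qed.

(** The product of the two lowest atoms is bounded below on the window. *)
Lemma window_lty p q : (m (window p q) < +oo)%E.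
Proof.
pose C := (expR (- (p ^+ 2)) * expR (- (q + N)))^-1.
have C0 : 0 <= C by rewrite invr_ge0 mulr_ge0 ?expR_ge0.
have mW := measurable_window p q.
rewrite -(setIT (window p q)) -integral_indic//.
apply: (@le_lt_trans _ _ (\int[m]_z (C%:E * (atom 0 0 z)%:E))%E).
  apply: ge0_le_integral => //=.
  - by apply/measurable_EFinP; exact: measurable_indic.
  - by apply: measurable_funeM; apply/measurable_EFinP; exact: measurable_atom.
  - move=> z _; rewrite -EFinM lee_fin indicE.
    case: (boolP (z \in window p q)) => [|_]; last by rewrite mulr_ge0// atom_ge0.
    rewrite inE => -[xp tq]; have p0 : 0 <= p by have /andP[x0 /(le_trans x0)] := xp.
    rewrite /C mulrC ler_pdivlMr ?mulr_gt0 ?expR_gt0// mul1r /atom /tensor !expr1.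
    by apply: ler_pM; [exact: expR_ge0|exact: expR_ge0|rewrite radial_atom_ge|rewrite time_atom_ge].
rewrite ge0_integralZl//=.
- by rewrite integral_atom -EFinM ltry.
- by apply/measurable_EFinP; exact: measurable_atom.
- by move=> z _; rewrite lee_fin atom_ge0.
Qed.

Lemma approximable_bounded_window (p q M : R) (u : GR * GR -> R) : measurable_fun setT u ->
  (forall z, `|u z| <= M) -> (forall z, ~ window p q z -> u z = 0) ->
  approximable m atom_span u.
Proof.
have W_fin := window_lty p q.
move=> mu_ uM u0.
apply: (approximable_bounded measurable_atom_span atom_spanB atom_spanZ
  (measurable_window p q) W_fin _ atom_span0 mu_ uM u0).
apply: (approximable_dynkin measurable_atom_span atom_spanB atom_spanZ
  (measurable_window p q) W_fin measurable_quadrants).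
- move=> _ _ [[a b] _ <-] [[c d] _ <-]; exists (Num.max a c, Num.max b d) => //=.
  have rayI (x y : R) : `]x, +oo[ `&` `]y, +oo[ = `](Num.max x y), +oo[%classic.
    apply/seteqP; split => r /=; rewrite !in_itv/= !andbT gt_max; last by move/andP.
    by move=> [-> ->].
  by rewrite -setXI !rayI.
- exact: approximable_window.
move=> _ [[a b] _ <-] /=.
pose I a b := (\1_(window a b) : GR * GR -> R).
have mI c d : measurable_fun setT (I c d) by apply: measurable_indic; exact: measurable_window.
rewrite (_ : \1_(_ `&` _) = (fun z => (I p q z - I (Num.min a p) q z) -
    (I p (Num.min b q) z - I (Num.min a p) (Num.min b q) z))).
  apply: (approximableB measurable_atom_span atom_spanB).
  - exact: measurable_funB.
  - exact: measurable_funB.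
  - by apply: (approximableB measurable_atom_span atom_spanB) => //; exact: approximable_window.
  - by apply: (approximableB measurable_atom_span atom_spanB) => //; exact: approximable_window.
apply/funext => -[x t]; rewrite /I !indicE in_setI.
have inW c d : ((x, t) \in window c d) = (0 <= x <= c) && (- N <= t <= d).
  by apply/idP/andP; rewrite inE.
have -> : ((x, t) \in (`]a, +oo[%classic `*` `]b, +oo[%classic : set (GR * GR))) = (a < x) && (b < t).
  by apply/idP/andP; rewrite inE/= !in_itv/= !andbT.
rewrite !inW !le_min [a < x]ltNge [b < t]ltNge.
by case: (0 <= x); case: (- N <= t); case: (x <= p); case: (x <= a); case: (t <= q);
  case: (t <= b); rewrite /= ?subrr ?subr0.
Qed.

End ExponentialSpan.

(** * The transform of an atom *)

Lemma measurable_fun_prod_nat d d' (T : measurableType d) (T' : measurableType d')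
    (f : T * nat -> T') :
  (forall n, measurable_fun setT (fun x => f (x, n))) -> measurable_fun setT f.
Proof.
move=> mf _ B mB; rewrite setTI.
rewrite (_ : f @^-1` B = \bigcup_n (((fun x => f (x, n)) @^-1` B) `*` [set n])).
  apply: bigcup_measurable => n _; apply: measurableX => //.
  by rewrite -[X in measurable X]setTI; exact: mf.
apply/seteqP; split => [[x n] /= Bf|[x n] [k _ [/= Bf ->]]//].
by exists n.
Qed.

Section CharacterKernels.
Context {R : realType}.
Variable alpha : R.
Hypothesis alpha_ge0 : 0 <= alpha.
Local Notation GR := (measurableTypeR R).
Local Notation mu := (@lebesgue_measure R).
Local Notation m := (laguerre_measure alpha).

Definition cos_kernel (w : GR * nat) (z : GR * GR) : R :=
  radial_character alpha `|w.1| w.2 z.1 * cos (w.1 * z.2).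

Definition sin_kernel (w : GR * nat) (z : GR * GR) : R :=
  radial_character alpha `|w.1| w.2 z.1 * sin (w.1 * z.2).

Let bounded_kernel_of (g : GR -> R) : measurable_fun setT g -> (forall t, `|g t| <= 1) ->
  bounded_kernel (fun (w : GR * nat) (z : GR * GR) =>
    radial_character alpha `|w.1| w.2 z.1 * g (w.1 * z.2)).
Proof.
move=> mg g1 w; split.
  apply: measurable_funM.
    by apply: measurableT_comp => //; exact: measurable_radial_character.
  by apply: measurableT_comp => //; apply: measurable_funM => //; exact: measurable_snd.
have [C C0 HC] := radial_character_bounded alpha_ge0 w.2.
exists C => // z; rewrite normrM -[leRHS]mulr1 ler_pM//.
exact: HC.
Qed.

Lemma bounded_cos_kernel : bounded_kernel cos_kernel.
Proof.
apply: bounded_kernel_of => [|t]; last by rewrite ler_norml cos_geN1 cos_le1.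
by apply: continuous_measurable_fun; exact: continuous_cos.
Qed.

Lemma bounded_sin_kernel : bounded_kernel sin_kernel.
Proof.
apply: bounded_kernel_of => [|t]; last by rewrite ler_norml sin_geN1 sin_le1.
by apply: continuous_measurable_fun; exact: continuous_sin.
Qed.

Variable N : R.

(** The factor of the transform of an atom that comes from x; [cos_coef] and
    [sin_coef] are those that come from t. *)
Definition radial_coef (j : nat) (l : R) (n : nat) : R :=
  ((j.+1%:R - l / 2) / (j.+1%:R + l / 2)) ^+ n / (j.+1%:R + l / 2) `^ (alpha + 1) / (2 * pi).

Definition cos_coef (k : nat) (l : R) : R :=
  (k.+1%:R * cos (l * N) + l * sin (l * N)) / (k.+1%:R ^+ 2 + l ^+ 2).

Definition sin_coef (k : nat) (l : R) : R :=
  (l * cos (l * N) - k.+1%:R * sin (l * N)) / (k.+1%:R ^+ 2 + l ^+ 2).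

Let transform_atom_of (g : R -> R) (c : R) (j k : nat) (w : GR * nat) :
  measurable_fun setT (fun t : GR => g (w.1 * t)) ->
  mu.-integrable `[- N, +oo[ (fun t => (damping k.+1%:R N t * g (w.1 * t))%:E) ->
  (\int[mu]_(t in `[(- N)%R, +oo[) (damping k.+1%:R N t * g (w.1 * t))%:E = c%:E)%E ->
  transform m (fun (w : GR * nat) (z : GR * GR) =>
    radial_character alpha `|w.1| w.2 z.1 * g (w.1 * z.2)) (atom N j k) w =
  radial_coef j `|w.1| w.2 * c.
Proof.
move=> mg ig Ig; rewrite /transform.
pose p (x : GR) : R := radial_atom x ^+ j.+1 * radial_character alpha `|w.1| w.2 x.
pose q (t : GR) : R := time_atom N t ^+ k.+1 * g (w.1 * t).
pose f (x : R) : R := expR (- (j.+1%:R * x ^+ 2)) *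
  radial_character alpha `|w.1| w.2 x * x `^ (2 * alpha + 1).
have [ix Ix] := @radial_transform_gaussian R alpha alpha_ge0 j.+1%:R `|w.1| w.2 (ltr0Sn _ _) (normr_ge0 _).
have pE x : p x * radial_weight alpha x =
    \1_[set x | 0 <= x] x * ((pi * Gamma (alpha + 1))^-1 * f x).
  rewrite /p radial_atom_exp /radial_weight /f !indicE.
  by case: (_ \in _); rewrite ?mul0r// !mul1r; ring.
have qE t : q t = \1_[set t | - N <= t] t * (damping k.+1%:R N t * g (w.1 * t)).
  by rewrite /q time_atom_exp mulrA.
have mp : measurable_fun setT p.
  apply: measurable_funM; first by apply: measurable_funX; exact: measurable_radial_atom.
  exact: measurable_radial_character.
have mq : measurable_fun setT q.
  by apply: measurable_funM => //; apply: measurable_funX; exact: measurable_time_atom.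
have ip : mu.-integrable setT (fun x => (p x * radial_weight alpha x)%:E).
  under eq_fun do rewrite pE.
  apply: integrable_halfline.
  have := @integrableZl _ _ _ mu _ (measurable_itv `[0, +oo[) ((pi * Gamma (alpha + 1))^-1) (EFin \o f) ix.
  exact: eq_integrable.
have iq : mu.-integrable setT (fun t => (q t)%:E).
  by under eq_fun do rewrite qE; exact: integrable_halfline.
have [_ E] := @Rintegral_tensor R alpha p q mp mq ip iq.
transitivity (\int[m]_z tensor p q z).
  by apply: eq_Rintegral => z _; rewrite /atom /tensor /p /q; ring.
rewrite E; congr (_ * _).
  rewrite /Rintegral; under eq_integral do rewrite pE.
  rewrite integral_halfline; under eq_integral do rewrite EFinM.
  rewrite integralZl// Ix/= /radial_coef.
  have p0 : pi != 0 :> R by rewrite gt_eqF// pi_gt0.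
  have g0 : Gamma (alpha + 1) != 0 by rewrite gt_eqF// Gamma_gt0.
  move: (pi) (Gamma _) (_ `^ _) p0 g0 => P G C p0 g0.
  rewrite -!mulrA; move: (_ ^+ w.2) (C^-1) => A B.
  by field; rewrite p0 g0.
by rewrite /Rintegral; under eq_integral do rewrite qE; rewrite integral_halfline Ig.
Qed.

Lemma transform_cos_atom j k w : transform m cos_kernel (atom N j k) w =
  radial_coef j `|w.1| w.2 * cos_coef k w.1.
Proof.
have [i I] := @integral_damping_cos R k.+1%:R N (ltr0Sn _ _) w.1.
apply: (transform_atom_of (g := cos)) => //.
apply: continuous_measurable_fun => t; apply: continuous_comp; last exact: continuous_cos.
by apply: cvgM; [exact: cvg_cst|exact: cvg_id].
Qed.

Lemma transform_sin_atom j k w : transform m sin_kernel (atom N j k) w =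
  radial_coef j `|w.1| w.2 * sin_coef k w.1.
Proof.
have [i I] := @integral_damping_sin R k.+1%:R N (ltr0Sn _ _) w.1.
apply: (transform_atom_of (g := sin)) => //.
apply: continuous_measurable_fun => t; apply: continuous_comp; last exact: continuous_sin.
by apply: cvgM; [exact: cvg_cst|exact: cvg_id].
Qed.

Lemma transform_atom_sum (kern : GR * nat -> GR * GR -> R) l w : bounded_kernel kern ->
  transform m kern (atom_sum N l) w =
  \sum_(a <- l) a.1 * transform m kern (atom N a.2.1 a.2.2) w.
Proof.
move=> bk; elim: l => [|a l IH].
  rewrite big_nil /transform; transitivity (\int[m]_z (cst 0 z : R)).
    by apply: eq_Rintegral => z _; rewrite /atom_sum big_nil mul0r.
  by rewrite /Rintegral integral0.
have Ia := @integrable_transform _ _ _ _ _ m kern _ w bk (integrable12_atom alpha_ge0 N a.2.1 a.2.2).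
have Il : m.-integrable setT (fun z => (atom_sum N l z * kern w z)%:E).
  by apply: integrable_transform => //; apply: (integrable12_atom_span alpha_ge0 (N := N)); exists l.
have Iaa : m.-integrable setT (fun z => (a.1 * (atom N a.2.1 a.2.2 z * kern w z))%:E).
  by have := @integrableZl _ _ _ m _ measurableT a.1 _ Ia; exact: eq_integrable.
rewrite big_cons -IH /transform -RintegralZl// -RintegralD//.
by apply: eq_Rintegral => z _; rewrite /atom_sum big_cons; ring.
Qed.

End CharacterKernels.

(** * Parseval for the exponential atoms *)

Lemma integral_double_sum d (T : measurableType d) (R : realType)
    (m : {measure set T -> \bar R}) (I : Type) (s : seq I)
    (f : I -> I -> T -> R) (v : I -> I -> R) :
  (forall i j, m.-integrable setT (EFin \o f i j)) ->
  (forall i j, (\int[m]_x (f i j x)%:E = (v i j)%:E)%E) ->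
  (\int[m]_x (\sum_(i <- s) \sum_(j <- s) f i j x)%R%:E =
   (\sum_(i <- s) \sum_(j <- s) v i j)%R%:E)%E.
Proof.
move=> If fv.
have Isum i : m.-integrable setT (fun x => (\sum_(j <- s) f i j x)%R%:E).
  apply: (@eq_integrable _ _ _ m setT measurableT (fun x => \sum_(j <- s) (f i j x)%:E)%E).
    by move=> x _; rewrite sumEFin.
  by apply: integrable_sum => // j _; exact: If.
have E i : (\int[m]_x (\sum_(j <- s) f i j x)%R%:E = (\sum_(j <- s) v i j)%R%:E)%E.
  under eq_integral do rewrite -sumEFin.
  rewrite integral_sum//; last by move=> j; exact: If.
  by rewrite -sumEFin; apply: eq_bigr => j _; exact: fv.
under eq_integral do rewrite -sumEFin.
by rewrite integral_sum// -sumEFin; apply: eq_bigr => i _; exact: E.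
Qed.

Section AtomParseval.
Context {R : realType}.
Variable alpha : R.
Hypothesis alpha_ge0 : 0 <= alpha.
Variable N : R.
Local Notation GR := (measurableTypeR R).
Local Notation mu := (@lebesgue_measure R).
Local Notation m := (laguerre_measure alpha).
Local Notation g := (plancherel_measure alpha).
Local Notation Tcos := (transform m (cos_kernel alpha)).
Local Notation Tsin := (transform m (sin_kernel alpha)).
Local Notation w_ := (multiplicity alpha).

(** A combination of two Poisson kernels, which is why its integral over l is
    explicit. *)
Definition time_gram (j k : nat) (l : R) : R :=
  (j.+1%:R + k.+1%:R)^-1 * (j.+1%:R / (j.+1%:R ^+ 2 + l ^+ 2) + k.+1%:R / (k.+1%:R ^+ 2 + l ^+ 2)).

Let den_gt0 k (l : R) : 0 < k.+1%:R ^+ 2 + l ^+ 2.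
Proof. by rewrite ltr_pwDl ?exprn_gt0// sqr_ge0. Qed.

(** The phase l N cancels by cos^2 + sin^2 = 1, and the remaining fraction
    (J K + l^2) / ((J^2 + l^2) (K^2 + l^2)) decomposes into partial fractions. *)
Lemma time_gramE j k l : cos_coef N j l * cos_coef N k l + sin_coef N j l * sin_coef N k l =
  time_gram j k l.
Proof.
rewrite /cos_coef /sin_coef /time_gram.
have E := cos2Dsin2 (l * N); move: (cos _) (sin _) E => c s E.
have d1 := den_gt0 j l; have d2 := den_gt0 k l.
have d3 : 0 < j.+1%:R + k.+1%:R :> R by rewrite addr_gt0.
move: (j.+1%:R : R) (k.+1%:R : R) d1 d2 d3 => J K d1 d2 d3.
transitivity ((J * K + l ^+ 2) * (c ^+ 2 + s ^+ 2) / ((J ^+ 2 + l ^+ 2) * (K ^+ 2 + l ^+ 2))).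
  by field; rewrite (gt_eqF d1) (gt_eqF d2).
by rewrite E; field; rewrite (gt_eqF d1) (gt_eqF d2) (gt_eqF d3).
Qed.

Lemma integral_time_gram j k :
  mu.-integrable setT (EFin \o time_gram j k) /\
  (\int[mu]_l (time_gram j k l)%:E = (2 * pi / (j.+1%:R + k.+1%:R))%:E)%E.
Proof.
pose P i (l : R) := i.+1%:R / (i.+1%:R ^+ 2 + l ^+ 2) : R.
have P0 i l : 0 <= P i l by rewrite divr_ge0// ltW.
have mP i : measurable_fun setT (P i : GR -> R).
  apply: continuous_measurable_fun => l; apply: cvgM; first exact: cvg_cst.
  apply: cvgV; first by rewrite gt_eqF.
  by apply: cvgD; [exact: cvg_cst|exact: exprn_continuous].
have IP i : (\int[mu]_l (P i l)%:E = pi%:E)%E by exact: integral_poisson_kernel.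
have iP i : mu.-integrable setT (EFin \o P i).
  apply/integrableP; split; first exact/measurable_EFinP.
  by under eq_integral do rewrite /= ger0_norm//; rewrite IP ltry.
have iPP : mu.-integrable setT (fun l => (P j l + P k l)%:E).
  by apply: eq_integrable (integrableD _ (iP j) (iP k)).
split.
  by have := @integrableZl _ _ _ mu _ measurableT ((j.+1%:R + k.+1%:R)^-1) _ iPP; exact: eq_integrable.
rewrite /time_gram; under eq_integral do rewrite EFinM.
rewrite integralZl//.
have -> : (\int[mu]_l (P j l + P k l)%:E = \int[mu]_l (P j l)%:E + \int[mu]_l (P k l)%:E)%E.
  by rewrite -integralD_EFin.
rewrite !IP -EFinD -EFinM; congr EFin.
by rewrite mulrC; congr (_ / _); rewrite mulr_natl mulr2n.
Qed.

(** With h = l/2, the ratios (J-h)/(J+h) and (K-h)/(K+h) have modulus less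
    than 1, and (J+h) (K+h) (1 - their product) = l (J+K): the binomial series
    applies and produces exactly the power of l that the dual weight cancels. *)
Lemma cvg_radial_gram j k l : 0 < l ->
  \sum_(0 <= n < M) (w_ n * (radial_coef alpha j l n * radial_coef alpha k l n)) @[M --> \oo] -->
  (l * (j.+1%:R + k.+1%:R)) `^ (- (alpha + 1)) / (2 * pi) ^+ 2.
Proof.
move=> l0; set J := j.+1%:R; set K := k.+1%:R; pose h := l / 2.
have h0 : 0 < h by rewrite divr_gt0.
have J0 : 0 < J by []. have K0 : 0 < K by [].
have Jh : 0 < J + h by rewrite addr_gt0. have Kh : 0 < K + h by rewrite addr_gt0.
pose x := (J - h) / (J + h); pose y := (K - h) / (K + h).
have bound i : 0 < i -> `|(i - h) / (i + h)| < 1.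
  move=> i0; have ih : 0 < i + h by rewrite addr_gt0.
  rewrite normrM normfV [`|i + h|]gtr0_norm// ltr_pdivrMr// mul1r.
  by rewrite ltr_norml; lra.
have xy1 : `|x * y| < 1.
  rewrite normrM mulr_ilt1//; exact: bound.
pose c := ((J + h) `^ (alpha + 1))^-1 * ((K + h) `^ (alpha + 1))^-1 / (2 * pi) ^+ 2.
have -> : (l * (J + K)) `^ (- (alpha + 1)) / (2 * pi) ^+ 2 = c * (1 - x * y) `^ (- (alpha + 1)).
  have -> : l * (J + K) = (J + h) * (K + h) * (1 - x * y).
    have gen (u v e : R) : u + e != 0 -> v + e != 0 -> 2 * e * (u + v) =
        (u + e) * (v + e) * (1 - (u - e) / (u + e) * ((v - e) / (v + e))).
      by move=> uc vc; field; rewrite uc vc.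
    have -> : l = 2 * h by rewrite /h; field.
    by apply: gen; rewrite gt_eqF.
  have xy0 : 0 <= 1 - x * y by rewrite subr_ge0 (le_trans (ler_norm _))// ltW.
  rewrite powRM ?mulr_ge0 ?(ltW Jh) ?(ltW Kh)// powRM ?(ltW Jh) ?(ltW Kh)//.
  by rewrite !powRN /c; ring.
have := multiplicity_series alpha_ge0 xy1.
move=> /(cvgM (cvg_cst c)); apply: cvg_trans; apply: near_eq_cvg; apply: nearW => M /=.
rewrite /series/= mulr_sumr; apply: eq_bigr => n _.
rewrite /radial_coef -/J -/K -/h -/x -/y [(x * y) ^+ n]exprMn /c -[((2 * pi) ^+ 2)^-1]exprVn; ring.
Qed.

Lemma measurable_radial_coef j n :
  measurable_fun setT (fun l : GR => radial_coef alpha j `|l| n).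
Proof.
have d0 (l : R) : 0 < j.+1%:R + `|l| / 2 by rewrite ltr_pwDl// divr_ge0.
have cd : continuous (fun l : R => j.+1%:R + `|l| / 2).
  move=> l; apply: cvgD; first exact: cvg_cst.
  by apply: cvgM; [exact: norm_continuous|exact: cvg_cst].
apply: continuous_measurable_fun => l; apply: cvgM; last exact: cvg_cst.
apply: cvgM.
  apply: (cvg_comp (fun l : R => (j.+1%:R - `|l| / 2) / (j.+1%:R + `|l| / 2)) (fun x => x ^+ n));
    last exact: exprn_continuous.
  apply: cvgM; last by apply: cvgV; [rewrite gt_eqF|exact: cd].
  apply: cvgB; first exact: cvg_cst.
  by apply: cvgM; [exact: norm_continuous|exact: cvg_cst].
apply: cvgV; first by rewrite gt_eqF// powR_gt0.
apply: (cvg_comp (fun l : R => j.+1%:R + `|l| / 2) (fun x => x `^ (alpha + 1))); first exact: cd.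
exact: continuous_powR_gt0.
Qed.

Let continuous_cosN : continuous (fun l : R => cos (l * N)).
Proof.
move=> l; apply: continuous_comp; last exact: continuous_cos.
by apply: cvgM; [exact: cvg_id|exact: cvg_cst].
Qed.

Let continuous_sinN : continuous (fun l : R => sin (l * N)).
Proof.
move=> l; apply: continuous_comp; last exact: continuous_sin.
by apply: cvgM; [exact: cvg_id|exact: cvg_cst].
Qed.

Let continuous_inv_den k : continuous (fun l : R => (k.+1%:R ^+ 2 + l ^+ 2)^-1).
Proof.
move=> l; apply: cvgV; first by rewrite gt_eqF.
by apply: cvgD; [exact: cvg_cst|exact: exprn_continuous].
Qed.

Lemma measurable_cos_coef k : measurable_fun setT (cos_coef N k : GR -> R).
Proof.
apply: continuous_measurable_fun => l; apply: cvgM; last exact: continuous_inv_den.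
apply: cvgD; apply: cvgM; [exact: cvg_cst|exact: continuous_cosN|exact: cvg_id|exact: continuous_sinN].
Qed.

Lemma measurable_sin_coef k : measurable_fun setT (sin_coef N k : GR -> R).
Proof.
apply: continuous_measurable_fun => l; apply: cvgM; last exact: continuous_inv_den.
apply: cvgB; apply: cvgM; [exact: cvg_id|exact: continuous_cosN|exact: cvg_cst|exact: continuous_sinN].
Qed.

Lemma transform_cos_sum l : Tcos (atom_sum N l) = fun w : GR * nat =>
  \sum_(a <- l) a.1 * (radial_coef alpha a.2.1 `|w.1| w.2 * cos_coef N a.2.2 w.1).
Proof.
apply/funext => w; rewrite (transform_atom_sum alpha_ge0); last exact: bounded_cos_kernel.
by apply: eq_bigr => a _; rewrite transform_cos_atom.
Qed.

Lemma transform_sin_sum l : Tsin (atom_sum N l) = fun w : GR * nat =>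
  \sum_(a <- l) a.1 * (radial_coef alpha a.2.1 `|w.1| w.2 * sin_coef N a.2.2 w.1).
Proof.
apply/funext => w; rewrite (transform_atom_sum alpha_ge0); last exact: bounded_sin_kernel.
by apply: eq_bigr => a _; rewrite transform_sin_atom.
Qed.

Lemma measurable_transform_sum l : measurable_fun setT (Tcos (atom_sum N l)) /\
  measurable_fun setT (Tsin (atom_sum N l)).
Proof.
rewrite transform_cos_sum transform_sin_sum; split; apply: measurable_fun_prod_nat => n /=;
  apply: measurable_sum => a; apply: measurable_funM => //; apply: measurable_funM.
- exact: measurable_radial_coef.
- exact: measurable_cos_coef.
- exact: measurable_radial_coef.
- exact: measurable_sin_coef.
Qed.

Lemma transform_sum_sqr s l n :
  Tcos (atom_sum N s) (l, n) ^+ 2 + Tsin (atom_sum N s) (l, n) ^+ 2 =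
  \sum_(a <- s) \sum_(b <- s) (a.1 * b.1 * time_gram a.2.2 b.2.2 l) *
    (radial_coef alpha a.2.1 `|l| n * radial_coef alpha b.2.1 `|l| n).
Proof.
rewrite transform_cos_sum transform_sin_sum !expr2 !big_distrlr/= -big_split/=.
apply: eq_bigr => a _; rewrite -big_split/=; apply: eq_bigr => b _.
by rewrite -time_gramE; ring.
Qed.

Lemma nrm2_atom_sum s : (nrm2 m (atom_sum N s) =
  (\sum_(a <- s) \sum_(b <- s) a.1 * b.1 *
    ((2 * pi * (a.2.1.+1%:R + b.2.1.+1%:R) `^ (alpha + 1))^-1 / (a.2.2.+1%:R + b.2.2.+1%:R)))%R%:E)%E.
Proof.
rewrite /nrm2.
under eq_integral do rewrite /atom_sum expr2 big_distrlr/=.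
pose f (a b : R * (nat * nat)) z := a.1 * b.1 * (atom N (a.2.1 + b.2.1).+1 (a.2.2 + b.2.2).+1 z).
transitivity (\int[m]_z (\sum_(a <- s) \sum_(b <- s) f a b z)%R%:E)%E.
  apply: eq_integral => z _; congr EFin; apply: eq_bigr => a _; apply: eq_bigr => b _.
  by rewrite /f -atomM; ring.
have i j k : m.-integrable setT (fun z => (atom N j k z)%:E).
  apply/integrableP; split; first by apply/measurable_EFinP; exact: measurable_atom.
  under eq_integral do rewrite /= ger0_norm ?atom_ge0//.
  by rewrite integral_atom// ltry.
apply: integral_double_sum => a b.
  have := @integrableZl _ _ _ m _ measurableT (a.1 * b.1) _ (i (a.2.1 + b.2.1).+1 (a.2.2 + b.2.2).+1).
  exact: eq_integrable.
rewrite /f; under eq_integral do rewrite EFinM.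
rewrite integralZl// integral_atom// -EFinM -!natrD !addSn !addnS//.
Qed.

(** Expand both sides into double sums over pairs of atoms.  For fixed l the sum
    over m converges by [cvg_radial_gram]; what remains is an integral over l of
    [time_gram], matching the integral of a product of atoms. *)
Lemma parseval_atom_sum s :
  energy m g (cos_kernel alpha) (sin_kernel alpha) (atom_sum N s) = nrm2 m (atom_sum N s).
Proof.
have [mc ms] := measurable_transform_sum s.
pose S (w : GR * nat) : R := Tcos (atom_sum N s) w ^+ 2 + Tsin (atom_sum N s) w ^+ 2.
have S0 w : 0 <= S w by rewrite addr_ge0 ?sqr_ge0.
have mS : measurable_fun setT S by apply: measurable_funD; exact: measurable_funX.
have mSn n : measurable_fun setT (fun l : GR => S (l, n)).
  by apply: measurableT_comp => //; apply/measurable_fun_pair => /=.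
pose f n (l : GR) : R := w_ n * (S (l, n) * dual_weight alpha l).
have f0 n l : 0 <= f n l.
  by rewrite mulr_ge0 ?multiplicity_ge0// mulr_ge0// dual_weight_ge0.
have mf n : measurable_fun setT (f n).
  apply: measurable_funM => //; apply: measurable_funM => //.
  exact: measurable_dual_weight.
rewrite /energy ge0_integral_plancherel_measure; last 2 first.
- exact/measurable_EFinP.
- by move=> w; rewrite lee_fin S0.
transitivity (\sum_(0 <= n <oo) \int[mu]_l (f n l)%:E)%E.
  apply: eq_eseriesr => n _; rewrite -ge0_integralZl//=.
  - apply/measurable_EFinP; apply: measurable_funM; first exact: mSn.
    exact: measurable_dual_weight.
  - by move=> l _; rewrite lee_fin mulr_ge0// ?S0// dual_weight_ge0.
  - by rewrite lee_fin multiplicity_ge0.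
rewrite -integral_nneseries//=; last 2 first.
- by move=> n; exact/measurable_EFinP.
- by move=> n l _; rewrite lee_fin.
pose G (l : GR) : R := \sum_(a <- s) \sum_(b <- s) a.1 * b.1 *
  ((a.2.1.+1%:R + b.2.1.+1%:R) `^ (- (alpha + 1)) / (2 * pi) ^+ 2) * time_gram a.2.2 b.2.2 l.
have mG : measurable_fun setT G.
  apply: measurable_sum => a; apply: measurable_sum => b; apply: measurable_funM => //.
  have [i _] := integral_time_gram a.2.2 b.2.2.
  by apply/measurable_EFinP; exact: (measurable_int mu i).
have seriesE l : l != 0 -> (\sum_(0 <= n <oo) (f n l)%:E = (G l)%:E)%E.
  move=> l0.
  have nl0 : 0 < `|l| by rewrite normr_gt0.
  apply/cvg_lim => //.
  suff : \sum_(0 <= n < M) f n l @[M --> \oo] --> G l.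
    by move=> H; under eq_fun do rewrite sumEFin; apply: cvg_EFin; [exact: nearW|exact: H].
  pose t (a b : R * (nat * nat)) := a.1 * b.1 * time_gram a.2.2 b.2.2 l * dual_weight alpha l.
  have E M : \sum_(0 <= n < M) f n l = \sum_(a <- s) \sum_(b <- s) t a b *
      \sum_(0 <= n < M) w_ n * (radial_coef alpha a.2.1 `|l| n * radial_coef alpha b.2.1 `|l| n).
    rewrite /f; under eq_bigr do rewrite /S transform_sum_sqr.
    transitivity (\sum_(0 <= n < M) \sum_(a <- s) \sum_(b <- s) t a b *
        (w_ n * (radial_coef alpha a.2.1 `|l| n * radial_coef alpha b.2.1 `|l| n))).
      apply: eq_bigr => n _; rewrite mulr_suml mulr_sumr; apply: eq_bigr => a _.
      rewrite mulr_suml mulr_sumr; apply: eq_bigr => b _.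
      by rewrite /t; ring.
    rewrite exchange_big/=; apply: eq_bigr => a _; rewrite exchange_big/=.
    by apply: eq_bigr => b _; rewrite mulr_sumr.
  under eq_fun do rewrite E.
  have -> : G l = \sum_(a <- s) \sum_(b <- s) t a b *
      ((`|l| * (a.2.1.+1%:R + b.2.1.+1%:R)) `^ (- (alpha + 1)) / (2 * pi) ^+ 2).
    apply: eq_bigr => a _; apply: eq_bigr => b _.
    rewrite /t /dual_weight powRM// 2!powRN.
    have d0 : `|l| `^ (alpha + 1) != 0 by rewrite gt_eqF// powR_gt0.
    move: (`|l| `^ _) d0 => D d0; rewrite -powRN.
    move: (_ `^ _) (((2 * pi) ^+ 2)^-1) => X Y.
    by field.
  apply: cvg_big => [|a _]; first by move=> x; apply: cvgD; [exact: cvg_fst|exact: cvg_snd].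
  apply: cvg_big => [|b _]; first by move=> x; apply: cvgD; [exact: cvg_fst|exact: cvg_snd].
  by apply: cvgM; [exact: cvg_cst|exact: cvg_radial_gram].
have mser : measurable_fun setT (fun l : GR => \sum_(0 <= n <oo) (f n l)%:E)%E.
  apply: ge0_emeasurable_sum => [n l _ _|n _]; first by rewrite lee_fin.
  exact/measurable_EFinP.
transitivity (\int[mu]_l (G l)%:E)%E.
  (* At l = 0 the dual weight vanishes and the series does not sum to G; a point
   is negligible. *)
have mT0 : measurable ([set: GR] `\ 0) by apply: measurableD => //; exact: measurable_set1.
  rewrite -[LHS](@integral_setD1 _ _ 0)//; last exact: measurable_funTS.
  rewrite -[RHS](@integral_setD1 _ _ 0)//; last first.
    by apply: measurable_funTS; exact/measurable_EFinP.
  by apply: eq_integral => l; rewrite inE/= => -[_ /eqP l0]; exact: seriesE.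
rewrite nrm2_atom_sum.
apply: integral_double_sum => a b; have [i I] := integral_time_gram a.2.2 b.2.2.
  have := @integrableZl _ _ _ mu _ measurableT (a.1 * b.1 *
   ((a.2.1.+1%:R + b.2.1.+1%:R) `^ (- (alpha + 1)) / (2 * pi) ^+ 2)) _ i.
  exact: eq_integrable.
under eq_integral do rewrite EFinM.
rewrite integralZl// I -EFinM; congr EFin; rewrite powRN.
have p0 : pi != 0 :> R by rewrite gt_eqF// pi_gt0.
have g0 : (a.2.1.+1%:R + b.2.1.+1%:R) `^ (alpha + 1) != 0 by rewrite gt_eqF// powR_gt0.
have k0 : a.2.2.+1%:R + b.2.2.+1%:R != 0 :> R by rewrite -natrD pnatr_eq0.
move: (_ `^ _) (a.2.2.+1%:R + b.2.2.+1%:R) (pi) g0 k0 p0 => G0 k P g0 k0 p0.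
by field; rewrite g0 k0 p0.
Qed.

End AtomParseval.

(** * Plancherel bounds for real functions *)

Lemma integrable12_le d (T : measurableType d) (R : realType)
    (m : {measure set T -> \bar R}) (u D : T -> R) : measurable_fun setT u ->
  integrable12 m D -> (forall z, `|u z| <= `|D z|) -> integrable12 m u.
Proof.
move=> mu [mD D1 D2] uD; split=> //.
- apply: le_lt_trans D1; apply: ge0_le_integral => //=.
  + by apply/measurable_EFinP; exact: measurableT_comp.
  + by apply/measurable_EFinP; exact: measurableT_comp.
  + by move=> z _; rewrite lee_fin.
- apply: le_lt_trans D2; apply: ge0_le_integral => //=.
  + by move=> z _; rewrite lee_fin sqr_ge0.
  + by apply/measurable_EFinP; exact: measurable_funX.
  + by apply/measurable_EFinP; exact: measurable_funX.
  + move=> z _; rewrite lee_fin -[u z ^+ 2]real_normK ?num_real// -[D z ^+ 2]real_normK ?num_real//.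
    by rewrite lerXn2r ?nnegrE.
Qed.

Section PlancherelFrame.
Context {R : realType}.
Variable alpha : R.
Hypothesis alpha_ge0 : 0 <= alpha.
Local Notation GR := (measurableTypeR R).
Local Notation m := (laguerre_measure alpha).
Local Notation g := (plancherel_measure alpha).
Local Notation frame := (frame m g (cos_kernel alpha) (sin_kernel alpha)).

Lemma ge0_eq_integral_hypergroup (f h : GR * GR -> \bar R) :
  measurable_fun setT f -> measurable_fun setT h ->
  (forall z, 0 <= f z)%E -> (forall z, 0 <= h z)%E ->
  (forall z, 0 <= z.1 -> f z = h z) -> (\int[m]_z f z = \int[m]_z h z)%E.
Proof.
move=> mf mh f0 h0 fh; rewrite !ge0_integral_laguerre_measure//.
apply: eq_integral => x _; apply: eq_integral => t _.
have [x0|x0] := leP 0 x; first by rewrite fh.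
by rewrite /radial_weight indicE memNset ?mul0r ?mule0//= leNgt x0.
Qed.

(** Bounded functions supported in a window; n serves for the bound and for the
    three sides, which keeps the class closed under differences. *)
Definition truncated (u : GR * GR -> R) := measurable_fun setT u /\
  exists n : nat, (forall z, `|u z| <= n%:R) /\
    forall z, ~ window n%:R n%:R n%:R z -> u z = 0.

Lemma window_le n k (z : GR * GR) : (n <= k)%N -> window (n%:R : R) n%:R n%:R z -> window k%:R k%:R k%:R z.
Proof.
rewrite -(ler_nat R) => nk [/andP[x0 xn] /andP[t0 tn]]; split.
  by rewrite x0/= (le_trans xn).
by rewrite (le_trans tn)// andbT (le_trans _ t0)// lerN2.
Qed.

Lemma truncatedB u v : truncated u -> truncated v -> truncated (fun z => u z - v z).
Proof.
move=> [mu [n [un u0]]] [mv [k [vk v0]]]; split; first exact: measurable_funB.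
exists (n + k)%N; split=> z.
  by rewrite (le_trans (ler_normB _ _))// natrD lerD.
move=> nW; rewrite u0 ?v0 ?subrr//.
- by apply: contra_not nW => /window_le; apply; exact: leq_addl.
- by apply: contra_not nW => /window_le; apply; exact: leq_addr.
Qed.

Lemma integrable12_truncated u : truncated u -> integrable12 m u.
Proof.
move=> [mu [n [un u0]]]; have mW := measurable_window n%:R n%:R n%:R.
apply: (@integrable12_le _ _ _ m u (fun z => n%:R * \1_(window n%:R n%:R n%:R) z)) => //.
  by apply: integrable12Z; apply: integrable12_indic => //; exact: window_lty.
move=> z; rewrite [leRHS]ger0_norm ?mulr_ge0 ?indicE//.
case: (boolP (z \in window n%:R n%:R n%:R)) => zW; first by rewrite mulr1; exact: un.
by rewrite u0 ?normr0 ?mulr0//; move/negP: zW; apply: contra_not => /mem_set.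
Qed.

Lemma frame_truncated u : truncated u -> frame 4 u.
Proof.
move=> tu; have [mu [n [un u0]]] := tu.
have -> : 4 = 4 * 1 :> R by rewrite mulr1.
apply: (@frame_closure _ _ _ _ _ m g _ _ (bounded_cos_kernel alpha_ge0)
  (bounded_sin_kernel alpha_ge0) (atom_span n%:R)) => //.
- exact: atom_spanB.
- by move=> v; exact: integrable12_atom_span.
- move=> _ [l ->]; have [mc ms] := measurable_transform_sum alpha_ge0 n%:R l.
  by split=> //; rewrite mul1e parseval_atom_sum.
- exact: integrable12_truncated.
- exact: (@approximable_bounded_window R alpha alpha_ge0 n%:R n%:R n%:R n%:R).
Qed.

(** Dominated convergence, after replacing u by 0 where x < 0, a set that the
    measure does not see. *)
Lemma approximable_truncated u : integrable12 m u -> approximable m truncated u.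
Proof.
move=> Iu e e0; have [mu _ _] := Iu.
pose A n : set (GR * GR) := window n%:R n%:R n%:R `&` (fun z => `|u z|) @^-1` `]-oo, n%:R].
have mA n : measurable (A n).
  apply: measurableI; first exact: measurable_window.
  rewrite -[X in measurable X]setTI.
  have mnu : measurable_fun setT (fun z => `|u z|) by exact: measurableT_comp.
  by apply: mnu => //; exact: measurable_itv.
pose v n z := u z * \1_(A n) z.
pose u' z := u z * \1_(hypergroup : set (GR * GR)) z.
have mu' : measurable_fun setT u'.
  by apply: measurable_funM => //; apply: measurable_indic; exact: measurable_hypergroup.
have mv n : measurable_fun setT (v n).
  by apply: measurable_funM => //; exact: measurable_indic.
have I_u : integrable12 m (fun z => `|u z|).
  by apply: (integrable12_le _ Iu); [exact: measurableT_comp|move=> z; rewrite normr_id].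
have vu n z : `|v n z| <= `|u z|.
  by rewrite normrM ler_piMr// indicE; case: (_ \in _); rewrite ?normr1 ?normr0.
have cv z : v n z @[n --> \oo] --> u' z.
  rewrite /u' /v indicE.
  have [z1|z1] := leP 0 z.1; last first.
    rewrite memNset ?mulr0; last by rewrite /hypergroup/= leNgt z1.
    apply: cvg_near_cst; apply: nearW => n; rewrite indicE memNset ?mulr0//.
    by move=> [[/andP[z0 _] _] _]; move: z1; rewrite ltNge z0.
  rewrite mem_set// mulr1; apply: cvg_near_cst.
  exists (Num.truncn (z.1 + `|z.2| + `|u z|)).+1 => // n /= nz.
  have nz' : z.1 + `|z.2| + `|u z| <= n%:R.
    by rewrite ltW// (lt_le_trans (truncnS_gt _))// ler_nat.
  rewrite indicE mem_set ?mulr1//; split.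
    have n2 : 0 <= `|z.2| by []. have nu : 0 <= `|u z| by [].
    split; first by rewrite z1/=; lra.
    by rewrite -ler_norml; lra.
  have n2 : 0 <= `|z.2| by [].
  by rewrite /= in_itv/=; lra.
(* v n tends to u', which agrees with u on the carrier of the measure. *)
have [n [n1 n2]] := dominated_nrm_lt I_u mu' mv vu cv e0.
exists (v n); split.
- split=> //; exists n; split=> z.
    rewrite /v indicE; case: (boolP (z \in A n)) => [|_]; last by rewrite mulr0 normr0.
    by rewrite inE => -[_ /=]; rewrite in_itv/= mulr1.
  by move=> nW; rewrite /v indicE memNset ?mulr0// => -[].
- rewrite (_ : nrm1 _ _ = nrm1 m (fun z => u' z - v n z))//.
  apply: ge0_eq_integral_hypergroup.
  + by apply/measurable_EFinP; apply: measurableT_comp => //; exact: measurable_funB.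
  + by apply/measurable_EFinP; apply: measurableT_comp => //; exact: measurable_funB.
  + by move=> z; rewrite lee_fin.
  + by move=> z; rewrite lee_fin.
  + by move=> z z0; rewrite /u' indicE mem_set// mulr1.
- rewrite (_ : nrm2 _ _ = nrm2 m (fun z => u' z - v n z))//.
  apply: ge0_eq_integral_hypergroup.
  + by apply/measurable_EFinP; apply: measurable_funX => //; exact: measurable_funB.
  + by apply/measurable_EFinP; apply: measurable_funX => //; exact: measurable_funB.
  + by move=> z; rewrite lee_fin sqr_ge0.
  + by move=> z; rewrite lee_fin sqr_ge0.
  + by move=> z z0; rewrite /u' indicE mem_set// mulr1.
Qed.

(** Two closures, each costing a factor 4: from the atoms to truncated functions,
    then to L1 /\ L2. *)
Lemma plancherel_frame u : integrable12 m u -> frame 16 u.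
Proof.
move=> Iu; have -> : 16 = 4 * 4 :> R by rewrite -natrM.
apply: (@frame_closure _ _ _ _ _ m g _ _ (bounded_cos_kernel alpha_ge0)
  (bounded_sin_kernel alpha_ge0) truncated) => //.
- exact: truncatedB.
- exact: integrable12_truncated.
- exact: frame_truncated.
- exact: approximable_truncated.
Qed.

End PlancherelFrame.

(** * Complex functions and the L2 transform *)

Section ComplexSquareIntegral.
Context d (T : measurableType d) (R : realType).
Variable mu : {measure set T -> \bar R}.
Implicit Types F G H : T -> R[i].
Local Open Scope ereal_scope.

Definition sqnorm (z : R[i]) : R := (complex.Re z ^+ 2 + complex.Im z ^+ 2)%R.

Lemma sqnorm_ge0 z : (0 <= sqnorm z)%R. Proof. by rewrite addr_ge0 ?sqr_ge0. Qed.

(** The square of the L2 norm, see [complex_Lnorm2E]. *)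
Definition csq F := \int[mu]_x (sqnorm (F x))%:E.

Lemma csq_ge0 F : 0 <= csq F.
Proof. by apply: integral_ge0 => x _; rewrite lee_fin sqnorm_ge0. Qed.

Lemma measurable_sqnorm F : complex_measurable_fun F ->
  measurable_fun setT (fun x => sqnorm (F x)).
Proof. by move=> [mr mi]; apply: measurable_funD; exact: measurable_funX. Qed.

Lemma complex_Lnorm2E F : complex_Lnorm mu 2%:E F = csq F `^ (2^-1).
Proof.
rewrite /complex_Lnorm unlock; congr (_ `^ _); apply: eq_integral => x _ /=.
rewrite /sqnorm; case: (F x) => a b /=; rewrite ger0_norm ?sqrtr_ge0//.
by rewrite powR_mulrn ?sqrtr_ge0// sqr_sqrtr// addr_ge0 ?sqr_ge0.
Qed.

Lemma complex_measurable_funB F G : complex_measurable_fun F -> complex_measurable_fun G ->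
  complex_measurable_fun (fun x => F x - G x)%R.
Proof.
move=> [Fr Fi] [Gr Gi]; split.
  have -> : (fun x => complex.Re (F x - G x))%R = (fun x => complex.Re (F x) - complex.Re (G x))%R.
    by apply/funext => x; case: (F x); case: (G x).
  exact: measurable_funB.
have -> : (fun x => complex.Im (F x - G x))%R = (fun x => complex.Im (F x) - complex.Im (G x))%R.
  by apply/funext => x; case: (F x); case: (G x).
exact: measurable_funB.
Qed.

Lemma sqnorm_leD (x y z : R[i]) : x = (y + z)%R -> (sqnorm x <= 2 * sqnorm y + 2 * sqnorm z)%R.
Proof.
move=> ->; case: y => a b; case: z => a' b'; rewrite /sqnorm/= -subr_ge0.
rewrite (_ : _ - _ = (a - a') ^+ 2 + (b - b') ^+ 2)%R ?addr_ge0 ?sqr_ge0//; ring.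
Qed.

Lemma csq_leD F G H : complex_measurable_fun F -> complex_measurable_fun G ->
  complex_measurable_fun H -> (forall x, F x = G x + H x)%R ->
  csq F <= 2%:E * csq G + 2%:E * csq H.
Proof.
move=> mF mG mH FGH; apply: integral_le2D; try exact: measurable_sqnorm;
  try (by move=> x; exact: sqnorm_ge0).
by move=> x; exact: sqnorm_leD.
Qed.

Lemma csqE F : complex_measurable_fun F ->
  csq F = nrm2 mu (fun x => complex.Re (F x)) + nrm2 mu (fun x => complex.Im (F x)).
Proof.
move=> [mr mi]; rewrite /csq /nrm2 -ge0_integralD//=.
- by move=> x _; rewrite lee_fin sqr_ge0.
- by apply/measurable_EFinP; exact: measurable_funX.
- by move=> x _; rewrite lee_fin sqr_ge0.
- by apply/measurable_EFinP; exact: measurable_funX.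
Qed.

Lemma csq_lty F : complex_Lnorm mu 2%:E F < +oo -> csq F < +oo.
Proof.
rewrite complex_Lnorm2E => H; rewrite ltey; apply/eqP => E.
by move: H; rewrite E poweRyr ?invr_neq0// ltxx.
Qed.

Lemma cvg_csq0 (u : nat -> T -> R[i]) :
  complex_Lnorm mu 2%:E (u n) @[n --> \oo] --> 0 ->
  forall e : R, (0 < e)%R -> \forall n \near \oo, csq (u n) < e%:E.
Proof.
move=> u0 e e0.
have se : (0 < Num.sqrt e)%R by rewrite sqrtr_gt0.
have : \forall n \near \oo, complex_Lnorm mu 2%:E (u n) < (Num.sqrt e)%:E.
  by apply: (u0 [set y | y < (Num.sqrt e)%:E]); apply: open_ereal_lt'; rewrite lte_fin.
apply: filterS => n; rewrite complex_Lnorm2E.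
have := csq_ge0 (u n); case: (csq (u n)) => [x| |]//.
  rewrite lee_fin => x0; rewrite poweR_EFin !lte_fin powR12_sqrt//.
  by rewrite ltr_sqrt.
by rewrite poweRyr ?invr_neq0.
Qed.

Lemma complex_Lp12 F : complex_Lp mu 1%:E F -> complex_Lp mu 2%:E F ->
  integrable12 mu (fun x => complex.Re (F x)) /\ integrable12 mu (fun x => complex.Im (F x)).
Proof.
move=> [mF F1] [_ /csq_lty F2]; have [mr mi] := mF.
have n0 : forall z : R[i], (`|complex.Re z| <= ComplexField.Normc.normc z /\ `|complex.Im z| <= ComplexField.Normc.normc z)%R.
  by case=> a b /=; rewrite -!sqrtr_sqr; split; apply: ler_wsqrtr; rewrite ?lerDl ?lerDr sqr_ge0.
have mn : measurable_fun setT (fun x => ComplexField.Normc.normc (F x)).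
  rewrite (_ : (fun x => _) = (fun x => Num.sqrt (sqnorm (F x)))).
    apply: (@measurableT_comp _ _ _ _ _ _ (Num.sqrt : measurableTypeR R -> measurableTypeR R)).
      by apply: continuous_measurable_fun; exact: sqrt_continuous.
    exact: measurable_sqnorm.
  by apply/funext => x; rewrite /sqnorm; case: (F x).
move: F1; rewrite /complex_Lnorm Lnorm1 => F1.
move: F2; rewrite csqE// => F2.
have le1 (h : T -> R) : measurable_fun setT h ->
    (forall x, `|h x| <= ComplexField.Normc.normc (F x))%R -> nrm1 mu h < +oo.
  move=> mh hF; apply: le_lt_trans F1; apply: ge0_le_integral => //=.
  - by apply/measurable_EFinP; exact: measurableT_comp.
  - by apply/measurable_EFinP; exact: measurableT_comp.
  - by move=> x _; rewrite lee_fin (le_trans (hF x))// ler_norm.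
split; split=> //.
- by apply: le1 => // x; have [] := n0 (F x).
- by apply: le_lt_trans F2; rewrite leeDl ?nrm2_ge0.
- by apply: le1 => // x; have [] := n0 (F x).
- by apply: le_lt_trans F2; rewrite leeDr ?nrm2_ge0.
Qed.

End ComplexSquareIntegral.

Section ReflectionInvariance.
Context {R : realType}.
Variable alpha : R.
Local Notation GR := (measurableTypeR R).
Local Notation mu := (@lebesgue_measure R).

Lemma ge0_integral_opp (f : GR -> \bar R) : measurable_fun setT f -> (forall x, 0 <= f x)%E ->
  (\int[mu]_x f (- x)%R = \int[mu]_x f x)%E.
Proof.
move=> mf f0.
rewrite -[LHS]/(\int[mu]_(x in (-%R : GR -> GR) @^-1` setT) (f \o (-%R : GR -> GR)) x)%E.
rewrite -ge0_integral_pushforward//=.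
by apply: eq_measure_integral => //= A mA _; exact: lebesgue_measureN.
Qed.

Lemma ge0_integral_plancherel_opp (h : GR * nat -> \bar R) : measurable_fun setT h ->
  (forall w, 0 <= h w)%E ->
  (\int[plancherel_measure alpha]_w h ((- w.1)%R, w.2) = \int[plancherel_measure alpha]_w h w)%E.
Proof.
move=> mh h0.
have mopp : measurable_fun setT (fun w : GR * nat => (- w.1, w.2) : GR * nat).
  by apply: measurable_fun_pair => /=; [exact: measurableT_comp|exact: measurable_snd].
rewrite ge0_integral_plancherel_measure//; last exact: measurableT_comp mh mopp.
rewrite ge0_integral_plancherel_measure//; apply: eq_eseriesr => n _; congr (_ * _)%E.
rewrite -[RHS]ge0_integral_opp.
- by apply: eq_integral => l _; rewrite /dual_weight normrN.
- apply: emeasurable_funM.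
    by apply: measurableT_comp => //; apply: measurable_fun_pair => /=.
  by apply/measurable_EFinP; exact: measurable_dual_weight.
- by move=> l; rewrite mule_ge0// lee_fin dual_weight_ge0.
Qed.

End ReflectionInvariance.

Section ComplexTransform.
Context {R : realType}.
Variable alpha : R.
Hypothesis alpha_ge0 : 0 <= alpha.
Local Notation GR := (measurableTypeR R).
Local Notation m := (laguerre_measure alpha).
Local Notation g := (plancherel_measure alpha).
Local Notation Tcos := (transform m (cos_kernel alpha)).
Local Notation Tsin := (transform m (sin_kernel alpha)).
Local Notation energy := (energy m g (cos_kernel alpha) (sin_kernel alpha)).
Implicit Types f : GR * GR -> R[i].

Definition complex12 f :=
  integrable12 m (fun z => complex.Re (f z)) /\ integrable12 m (fun z => complex.Im (f z)).

(** The transform uses the character of -l, whose phase is the conjugate one,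
    whence the signs. *)
Lemma laguerre_character_neg (w : R * nat) (z : R * R) (c : R[i]) :
  c * laguerre_character alpha (- w.1, w.2) z =
  Complex (complex.Re c * cos_kernel alpha w z + complex.Im c * sin_kernel alpha w z)
          (complex.Im c * cos_kernel alpha w z - complex.Re c * sin_kernel alpha w z).
Proof.
case: c => u v; rewrite /laguerre_character /cos_kernel /sin_kernel /radial_character/=.
rewrite normrN mulNr cosN sinN /real_complex_def; set r := _ * _.[_].
by simpc; congr Complex; ring.
Qed.

Lemma fourier_laguerreE f w : complex12 f ->
  fourier_laguerre alpha f w =
  Complex (Tcos (fun z => complex.Re (f z)) w + Tsin (fun z => complex.Im (f z)) w)
          (Tcos (fun z => complex.Im (f z)) w - Tsin (fun z => complex.Re (f z)) w).
Proof.
move=> [Iu Iv].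
have bc := bounded_cos_kernel alpha_ge0; have bs := bounded_sin_kernel alpha_ge0.
rewrite /fourier_laguerre /complex_integral; congr Complex.
  rewrite /transform -RintegralD//=; try exact: integrable_transform.
  by apply: eq_Rintegral => z _; rewrite laguerre_character_neg.
rewrite /transform -RintegralB//=; try exact: integrable_transform.
by apply: eq_Rintegral => z _; rewrite laguerre_character_neg.
Qed.

Lemma complex12_measurable f : complex12 f -> complex_measurable_fun f.
Proof. by move=> [[mr _ _] [mi _ _]]. Qed.

Lemma measurable_fourier_laguerre f : complex12 f ->
  complex_measurable_fun (fourier_laguerre alpha f : GR * nat -> R[i]).
Proof.
move=> If; have [Iu Iv] := If.
have [cu su _ _] := plancherel_frame alpha_ge0 Iu.
have [cv sv _ _] := plancherel_frame alpha_ge0 Iv.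
split.
  under eq_fun do rewrite fourier_laguerreE//=.
  exact: measurable_funD.
under eq_fun do rewrite fourier_laguerreE//=.
exact: measurable_funB.
Qed.

Lemma transform_cos_opp u w : Tcos u (- w.1, w.2) = Tcos u w.
Proof.
by apply: eq_Rintegral => z _; rewrite /cos_kernel/= normrN mulNr cosN.
Qed.

Lemma transform_sin_opp u w : integrable12 m u -> Tsin u (- w.1, w.2) = - Tsin u w.
Proof.
move=> Iu; rewrite -[RHS]mulN1r /transform -RintegralZl//; last first.
  by apply: integrable_transform => //; exact: bounded_sin_kernel.
by apply: eq_Rintegral => z _; rewrite /sin_kernel/= normrN mulNr sinN; ring.
Qed.

(** Averaging |F(l)|^2 and |F(-l)|^2 cancels the cross terms between the cosine
    and the sine transforms of the real and imaginary parts. *)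
Lemma csq_fourier_laguerre f : complex12 f ->
  csq g (fourier_laguerre alpha f) =
  (energy (fun z => complex.Re (f z)) + energy (fun z => complex.Im (f z)))%E.
Proof.
move=> If; have [Iu Iv] := If; have mF := measurable_fourier_laguerre If.
have [cu su _ _] := plancherel_frame alpha_ge0 Iu.
have [cv sv _ _] := plancherel_frame alpha_ge0 Iv.
set u := (fun z => complex.Re (f z)) in Iu cu su *.
set v := (fun z => complex.Im (f z)) in Iv cv sv *.
have mh : measurable_fun setT (fun w : GR * nat => sqnorm (fourier_laguerre alpha f w)).
  exact: measurable_sqnorm.
have mE (a b : GR * nat -> R) : measurable_fun setT a -> measurable_fun setT b ->
    measurable_fun setT (fun w => (a w ^+ 2 + b w ^+ 2)%:E).
  move=> ma mb; apply/measurable_EFinP.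
  by apply: measurable_funD; exact: measurable_funX.
have mopp : measurable_fun setT (fun w : GR * nat => (- w.1, w.2) : GR * nat).
  by apply: measurable_fun_pair => /=; [exact: measurableT_comp|exact: measurable_snd].
pose h (w : GR * nat) := sqnorm (fourier_laguerre alpha f w).
have hE w : (2^-1 * h w + 2^-1 * h ((- w.1)%R, w.2) =
    (Tcos u w ^+ 2 + Tsin u w ^+ 2) + (Tcos v w ^+ 2 + Tsin v w ^+ 2))%R.
  rewrite /h !fourier_laguerreE// /sqnorm/= !transform_cos_opp !transform_sin_opp//.
  by field.
have h0 w : (0 <= (2^-1 * h w)%:E)%E by rewrite lee_fin mulr_ge0// sqnorm_ge0.
have mh2 : measurable_fun setT (fun w : GR * nat => (2^-1 * h w)%:E).
  by apply/measurable_EFinP; exact: measurable_funM.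
transitivity (\int[g]_w (2^-1 * h w)%:E + \int[g]_w (2^-1 * h ((- w.1)%R, w.2))%:E)%E.
  rewrite (ge0_integral_plancherel_opp alpha mh2 h0) -ge0_integralD//=.
  by apply: eq_integral => w _; rewrite -EFinD; congr EFin; rewrite /h; field.
rewrite -ge0_integralD//=; last exact: (measurableT_comp mh2 mopp).
under eq_integral do rewrite -EFinD hE EFinD.
rewrite ge0_integralD//; try exact: mE;
  by move=> w _; rewrite lee_fin addr_ge0 ?sqr_ge0.
Qed.

Lemma csq_fourier_laguerre_le f : complex12 f ->
  (csq g (fourier_laguerre alpha f) <= 16%:E * csq m f)%E.
Proof.
move=> If; have [Iu Iv] := If.
have [_ _ Eu _] := plancherel_frame alpha_ge0 Iu.
have [_ _ Ev _] := plancherel_frame alpha_ge0 Iv.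
rewrite csq_fourier_laguerre// csqE; last exact: complex12_measurable.
by rewrite ge0_muleDr ?nrm2_ge0// leeD.
Qed.

Lemma csq_le_fourier_laguerre f : complex12 f ->
  (csq m f <= 16%:E * csq g (fourier_laguerre alpha f))%E.
Proof.
move=> If; have [Iu Iv] := If.
have [_ _ _ Eu] := plancherel_frame alpha_ge0 Iu.
have [_ _ _ Ev] := plancherel_frame alpha_ge0 Iv.
rewrite csq_fourier_laguerre// csqE; last exact: complex12_measurable.
by rewrite ge0_muleDr ?energy_ge0// leeD.
Qed.

Lemma complex12B f h : complex12 f -> complex12 h -> complex12 (fun z => f z - h z).
Proof.
move=> [fr fi] [hr hi]; split.
  have -> : (fun z => complex.Re (f z - h z)) = (fun z => complex.Re (f z) - complex.Re (h z)).
    by apply/funext => x; case: (f x); case: (h x).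
  exact: integrable12B.
have -> : (fun z => complex.Im (f z - h z)) = (fun z => complex.Im (f z) - complex.Im (h z)).
  by apply/funext => x; case: (f x); case: (h x).
exact: integrable12B.
Qed.

Lemma fourier_laguerreB f h w : complex12 f -> complex12 h ->
  fourier_laguerre alpha (fun z => f z - h z) w =
  fourier_laguerre alpha f w - fourier_laguerre alpha h w.
Proof.
move=> If Ih; have [fr fi] := If; have [hr hi] := Ih.
have bc := bounded_cos_kernel alpha_ge0; have bs := bounded_sin_kernel alpha_ge0.
rewrite !fourier_laguerreE//; last exact: complex12B.
have -> : (fun z => complex.Re (f z - h z)) = (fun z => complex.Re (f z) - complex.Re (h z)).
  by apply/funext => x; case: (f x); case: (h x).
have -> : (fun z => complex.Im (f z - h z)) = (fun z => complex.Im (f z) - complex.Im (h z)).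
  by apply/funext => x; case: (f x); case: (h x).
rewrite !transformB//; simpc; congr Complex; ring.
Qed.

End ComplexTransform.

Section TransformL2.
Context {R : realType}.
Variable alpha : R.
Hypothesis alpha_ge0 : 0 <= alpha.
Local Notation GR := (measurableTypeR R).
Local Notation m := (laguerre_measure alpha).
Local Notation g := (plancherel_measure alpha).
Variables (f : GR * GR -> R[i]) (F : GR * nat -> R[i]).
Hypotheses (Lf : complex_Lp m 2%:E f) (fF : is_fourier_laguerre_L2 alpha f F).

Lemma csq_subC d (T : measurableType d) (mu : {measure set T -> \bar R}) (G H : T -> R[i]) :
  csq mu (fun x => G x - H x) = csq mu (fun x => H x - G x).
Proof.
apply: eq_integral => x _; case: (G x) => a b; case: (H x) => c e.
by rewrite /sqnorm/=; congr EFin; ring.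
Qed.

Lemma transform_approx (e : R) : 0 < e -> exists h : GR * GR -> R[i],
  [/\ complex12 alpha h, (csq m (fun z => (h z - f z)%R) < e%:E)%E &
      (csq g (fun w => (fourier_laguerre alpha h w - F w)%R) < e%:E)%E].
Proof.
move=> e0; have [_ [u [u1 u2 /cvg_csq0/(_ _ e0) uf /cvg_csq0/(_ _ e0) uF]]] := fF.
have /filter_ex[n [un Un]] : \forall n \near \oo,
    (csq m (fun z => (u n z - f z)%R) < e%:E)%E /\
    (csq g (fun w => (fourier_laguerre alpha (u n) w - F w)%R) < e%:E)%E by exact: filterI uf uF.
by exists (u n); split => //; exact: complex_Lp12.
Qed.

(** Both bounds of this section transfer from L1 /\ L2 to the L2 limit, with a
    factor 4 from using the squared triangle inequality on each side. *)
Lemma csq_le_transform : (csq m f <= 64%:E * csq g F)%E.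
Proof.
have [mf _] := Lf; have [[mF _] _] := fF.
apply/lee_addgt0Pr => e e0.
have e' : 0 < e / 66 by rewrite divr_gt0.
have [h [Ih hf hF]] := transform_approx e'.
have mh := complex12_measurable Ih; have mH := measurable_fourier_laguerre alpha_ge0 Ih.
have fh z : f z = h z + (f z - h z) by rewrite addrC subrK.
have HF w : fourier_laguerre alpha h w = F w + (fourier_laguerre alpha h w - F w).
  by rewrite addrC subrK.
have H1 := csq_leD m mf mh (complex_measurable_funB mf mh) fh.
have H2 := csq_leD g mH mF (complex_measurable_funB mH mF) HF.
apply: (le_trans H1); rewrite csq_subC.
apply: (@le_trans _ _ (2%:E * (16%:E * (2%:E * csq g F + 2%:E * (e / 66)%:E)) + 2%:E * (e / 66)%:E))%E.
  apply: leeD; last by apply: lee_wpmul2l => //; exact: ltW.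
  apply: lee_wpmul2l => //; apply: (le_trans (csq_le_fourier_laguerre alpha_ge0 Ih)).
  apply: lee_wpmul2l => //; apply: (le_trans H2); apply: leeD2l.
  by apply: lee_wpmul2l => //; exact: ltW.
rewrite ge0_muleDr ?mule_ge0 ?csq_ge0 ?lee_fin ?(ltW e')//.
rewrite ge0_muleDr ?mule_ge0 ?csq_ge0 ?lee_fin ?(ltW e')//.
rewrite !muleA -!EFinM -addeA -EFinD leeD//.
- by rewrite (_ : 2 * 16 * 2 = 64) //; ring.
- by rewrite lee_fin le_eqVlt; apply/orP; left; apply/eqP; field.
Qed.

Lemma csq_transform_sub_le h : complex12 alpha h ->
  (csq g (fun w => (F w - fourier_laguerre alpha h w)%R) <=
   64%:E * csq m (fun z => (f z - h z)%R))%E.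
Proof.
move=> Ih; have [mf _] := Lf; have [[mF _] _] := fF.
apply/lee_addgt0Pr => e e0.
have e' : 0 < e / 66 by rewrite divr_gt0.
have [u [Iu uf uF]] := transform_approx e'.
have mh := complex12_measurable Ih; have mH := measurable_fourier_laguerre alpha_ge0 Ih.
have mu := complex12_measurable Iu; have mU := measurable_fourier_laguerre alpha_ge0 Iu.
have mFH := complex_measurable_funB mF mH; have mUH := complex_measurable_funB mU mH.
have mFU := complex_measurable_funB mF mU.
have muh := complex_measurable_funB mu mh; have muf := complex_measurable_funB mu mf.
have mfh := complex_measurable_funB mf mh.
have H1 := @csq_leD _ _ _ g _ _ _ mFH mUH mFU.
have {}H1 := H1 (fun w => esym (etrans (addrC _ _) (subrKA _ _ _))).
have H2 := @csq_leD _ _ _ m _ _ _ muh muf mfh (fun z => esym (subrKA _ _ _)).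
have H3 := csq_fourier_laguerre_le alpha_ge0 (complex12B Iu Ih).
have E : csq g (fourier_laguerre alpha (fun z => u z - h z)) =
    csq g (fun w => (fourier_laguerre alpha u w - fourier_laguerre alpha h w)%R).
  by apply: eq_integral => w _; rewrite fourier_laguerreB.
apply: (le_trans H1); rewrite [X in (_ + 2%:E * X)%E]csq_subC -E.
apply: (@le_trans _ _ (2%:E * (16%:E * (2%:E * (e / 66)%:E + 2%:E * csq m (fun z => (f z - h z)%R))) + 2%:E * (e / 66)%:E))%E.
  apply: leeD; last by apply: lee_wpmul2l => //; exact: ltW.
  apply: lee_wpmul2l => //; apply: (le_trans H3).
  apply: lee_wpmul2l => //; apply: (le_trans H2); apply: leeD2r.
  by apply: lee_wpmul2l => //; exact: ltW.
rewrite addeC ge0_muleDr ?mule_ge0 ?csq_ge0 ?lee_fin ?(ltW e')//.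
rewrite ge0_muleDr ?mule_ge0 ?csq_ge0 ?lee_fin ?(ltW e')//.
rewrite !muleA -!EFinM addeA -EFinD addeC leeD//.
- by rewrite (_ : 2 * 16 * 2 = 64) //; ring.
- by rewrite lee_fin le_eqVlt; apply/orP; left; apply/eqP; field.
Qed.

End TransformL2.

(** * Volumes of balls *)

Section BallVolumes.
Context {R : realType}.
Variable alpha : R.
Hypothesis alpha_ge0 : 0 <= alpha.
Local Notation GR := (measurableTypeR R).
Local Notation mu := (@lebesgue_measure R).
Local Notation m := (laguerre_measure alpha).
Local Notation g := (plancherel_measure alpha).

Lemma measurable_hypergroup_norm :
  measurable_fun setT (hypergroup_norm : GR * GR -> GR).
Proof.
apply: (measurableT_comp (measurable_powR _)).
by apply: measurable_funD; [|apply: measurable_funM => //]; apply: measurable_funX.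
Qed.

Lemma measurable_dual_norm : measurable_fun setT (dual_norm alpha : GR * nat -> GR).
Proof.
apply: measurable_fun_prod_nat => n; apply: measurable_funM => //=.
by apply: measurable_funM => //; exact: measurableT_comp.
Qed.

Definition hypergroup_ball (r : R) : set (GR * GR) := [set z | hypergroup_norm z <= r].
Definition dual_ball (s : R) : set (GR * nat) := [set w | dual_norm alpha w <= s].

Lemma measurable_hypergroup_ball r : measurable (hypergroup_ball r).
Proof.
rewrite -[X in measurable X]setTI.
rewrite (_ : hypergroup_ball r = (hypergroup_norm : GR * GR -> GR) @^-1` `]-oo, r]%classic).
  exact: measurable_hypergroup_norm.
by apply/seteqP; split => z /=; rewrite in_itv.
Qed.

Lemma measurable_dual_ball s : measurable (dual_ball s).
Proof.
rewrite -[X in measurable X]setTI.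
rewrite (_ : dual_ball s = (dual_norm alpha : GR * nat -> GR) @^-1` `]-oo, s]%classic).
  exact: measurable_dual_norm.
by apply/seteqP; split => z /=; rewrite in_itv.
Qed.

Lemma hypergroup_ball_box r z : 0 < r -> hypergroup_ball r z ->
  `|z.1| <= r /\ `|z.2| <= r ^+ 2 / 2.
Proof.
rewrite /hypergroup_ball/= /hypergroup_norm; move: z => [x t]/= r0 H.
have x4 : 0 <= x ^+ 4 by rewrite exprn_even_ge0.
have t2 : 0 <= 4 * t ^+ 2 by rewrite mulr_ge0// sqr_ge0.
have q0 : 0 <= x ^+ 4 + 4 * t ^+ 2 by apply: addr_ge0.
have {H} : x ^+ 4 + 4 * t ^+ 2 <= r ^+ 4.
  rewrite -(@ler_pXn2r _ 4) ?nnegrE ?powR_ge0 ?(ltW r0)// in H.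
  rewrite -[leLHS]powR_mulrn ?powR_ge0// -powRrM mulVf// powRr1// in H.
move=> H; split.
  rewrite -(@ler_pXn2r _ 4) ?nnegrE ?(ltW r0)// -normrX ger0_norm//; lra.
rewrite -(@ler_pXn2r _ 2) ?nnegrE ?divr_ge0 ?sqr_ge0//.
rewrite real_normK ?num_real// expr_div_n -exprM ler_pdivlMr//; lra.
Qed.

(** L_m(0) grows like m^alpha: the factor 1 + alpha/(m+1) of the recurrence is at
    most ((m+1)/m)^alpha, because 1 - 1/x <= exp (-1/x). *)
Lemma multiplicity_le n : multiplicity alpha n <= (1 + alpha) * n.+1%:R `^ alpha.
Proof.
case: n => [|n].
  by rewrite (multiplicity0 alpha_ge0) mulr1n powR1 mulr1 lerDl.
have a1 : 0 <= 1 + alpha by rewrite addr_ge0.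
apply: (@le_trans _ _ ((1 + alpha) * n.+1%:R `^ alpha)); last first.
  by rewrite ler_wpM2l// ge0_ler_powR ?nnegrE// ler_nat.
elim: n => [|n IH].
  by rewrite (multiplicityS alpha_ge0) (multiplicity0 alpha_ge0) mulr1n powR1 mulr1 mul1r divr1.
rewrite (multiplicityS alpha_ge0); set x : R := n.+2%:R.
have x0 : 0 < x by rewrite ltr0n.
apply: (@le_trans _ _ ((1 + alpha) * n.+1%:R `^ alpha * (1 + alpha / x))).
  by rewrite ler_wpM2r// addr_ge0// divr_ge0.
rewrite -mulrA ler_wpM2l//.
have -> : n.+1%:R = (1 - x^-1) * x :> R.
  by rewrite mulrBl mulVf ?gt_eqF// mul1r /x -[n.+2%:R]natr1 addrK.
have y0 : 0 <= 1 - x^-1 by rewrite subr_ge0 invf_le1// ler1n.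
rewrite powRM// mulrAC ler_piMl ?powR_ge0//.
apply: (@le_trans _ _ (expR (- x^-1 * alpha) * expR (alpha / x))); last first.
  by rewrite -expRD mulNr [x^-1 * _]mulrC addNr expR0.
apply: ler_pM; rewrite ?powR_ge0 ?addr_ge0 ?divr_ge0 ?expR_ge1Dx//.
rewrite expRM ge0_ler_powR ?nnegrE ?expR_ge0//.
exact: expR_ge1Dx.
Qed.

Lemma sum_inv_sqr_le n : \sum_(0 <= k < n) (k.+1%:R ^- 2 : R) <= 2.
Proof.
case: n => [|n]; first by rewrite big_geq.
apply: (@le_trans _ _ (2 - n.+1%:R^-1)); last by rewrite gerBl.
elim: n => [|n IH]; first by rewrite big_nat1 expr1n invr1; lra.
rewrite big_nat_recr//= (le_trans (lerD IH (lexx _)))//.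
rewrite -[n.+2%:R]natr1; set x : R := n.+1%:R.
have x0 : 0 < x by rewrite ltr0n.
rewrite -subr_ge0 (_ : _ - _ = (x * (x + 1) ^+ 2)^-1); last first.
  by field; rewrite !gt_eqF// addr_gt0.
by rewrite invr_ge0 mulr_ge0 ?sqr_ge0// ltW.
Qed.

Lemma integral_indic_scaled (c : R) (A : set GR) : measurable A -> 0 <= c ->
  (\int[mu]_x (c * \1_A x)%:E = c%:E * mu A)%E.
Proof.
move=> mA c0; under eq_integral do rewrite EFinM.
rewrite ge0_integralZl//=; first by rewrite integral_indic// setIT.
- by apply/measurable_EFinP; exact: measurable_indic.
Qed.

(** The ball lies in the box |x| <= r, |t| <= r^2/2, on which the density is at
    most its value at x = r. *)
Lemma hypergroup_ball_volume r : 0 < r ->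
  (m (hypergroup_ball r) <= ((pi * Gamma (alpha + 1))^-1 * r `^ (2 * alpha + 4))%:E)%E.
Proof.
move=> r0; pose c := r `^ (2 * alpha + 1) / (pi * Gamma (alpha + 1)).
have mB := measurable_hypergroup_ball r.
have pG : 0 <= pi * Gamma (alpha + 1) by rewrite mulr_ge0 ?pi_ge0 ?Gamma_ge0.
have c0 : 0 <= c by rewrite divr_ge0 ?powR_ge0.
have -> : m (hypergroup_ball r) = m (hypergroup_ball r `&` hypergroup).
  by rewrite /= /laguerre_measure -setIA setIid.
pose p := \1_(`[0, r] : set GR) : GR -> R.
pose q := \1_(`[- (r ^+ 2 / 2), r ^+ 2 / 2] : set GR) : GR -> R.
have mp : measurable_fun setT p by exact: measurable_indic.
have mq : measurable_fun setT q by exact: measurable_indic.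
rewrite -[X in m X]setIT -integral_indic//; last exact: measurableI mB measurable_hypergroup.
apply: (@le_trans _ _ (\int[m]_z (tensor p q z)%:E)%E).
  apply: ge0_le_integral => //=.
  - apply/measurable_EFinP; apply: measurable_indic.
    exact: measurableI mB measurable_hypergroup.
  - by apply/measurable_EFinP; exact: measurable_tensor.
  - move=> z _; rewrite lee_fin indicE.
    case: (boolP (z \in _)) => [|_]; last by rewrite mulr_ge0 ?indicE.
    rewrite inE => -[zB zH]; have [zr zt] := hypergroup_ball_box r0 zB.
    rewrite /tensor /p /q !indicE !mem_set ?mulr1//=; first by rewrite in_itv/= -ler_norml.
    by rewrite in_itv/= zH (le_trans (ler_norm _)).
rewrite ge0_integral_tensor//.
- have -> : (\int[mu]_t (q t)%:E = (r ^+ 2)%:E)%E.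
    rewrite integral_indic// setIT. rewrite /= lebesgue_measure_itv/= lte_fin ifT -?EFinD.
      by congr EFin; field.
    have r2 : 0 < r ^+ 2 by rewrite exprn_gt0.
    lra.
  apply: (@le_trans _ _ ((c * r)%:E * (r ^+ 2)%:E)%E).
    apply: lee_wpmul2r; first by rewrite lee_fin sqr_ge0.
    rewrite -(_ : (\int[mu]_x (c * p x)%:E = (c * r)%:E)%E); last first.
      by rewrite integral_indic_scaled//= lebesgue_measure_itv/= lte_fin r0 oppr0 adde0 EFinM.
    apply: ge0_le_integral => //=.
    + by move=> x _; rewrite lee_fin mulr_ge0 ?radial_weight_ge0// /p indicE.
    + by apply/measurable_EFinP; apply: measurable_funM => //; exact: measurable_radial_weight.
    + by apply/measurable_EFinP; exact: measurable_funM.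
    + move=> x _; rewrite lee_fin /p indicE.
      case: (boolP (x \in _)) => [|_]; last by rewrite mul0r mulr0.
      rewrite inE/= in_itv/= mul1r mulr1 => /andP[x0 xr].
      rewrite /radial_weight indicE mem_set// mul1r ler_wpM2r ?invr_ge0//.
      by rewrite ge0_ler_powR ?nnegrE ?addr_ge0 ?mulr_ge0 ?(ltW r0).
  rewrite -EFinM lee_fin /c le_eqVlt; apply/orP; left; apply/eqP.
  have -> : 2 * alpha + 4 = (2 * alpha + 1) + 3%:R by ring.
  rewrite [in RHS]powRD; last by apply/implyP => _; rewrite gt_eqF.
  by rewrite powR_mulrn ?(ltW r0)//; ring.
Qed.

(** The slice at m is contained in |l| <= s / (2 (m+1)) and has dual measure of
    order (s / (m+1))^(alpha+2); against a multiplicity of order (m+1)^alpha this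
    leaves the convergent series of 1 / (m+1)^2. *)
Lemma dual_ball_volume s : 0 < s ->
  (g (dual_ball s) <= (2 * (1 + alpha) * s `^ (alpha + 2))%:E)%E.
Proof.
move=> s0; have mB := measurable_dual_ball s.
have a1 : 0 <= 1 + alpha by rewrite addr_ge0.
rewrite -[X in g X]setIT -integral_indic//.
rewrite ge0_integral_plancherel_measure; last 2 first.
- by apply/measurable_EFinP; exact: measurable_indic.
- by move=> w; rewrite lee_fin indicE.
pose S n : R := (1 + alpha) * s `^ (alpha + 2) * n.+1%:R ^- 2.
have term n : ((multiplicity alpha n)%:E *
    \int[mu]_l ((\1_(dual_ball s) (l, n))%:E * (dual_weight alpha l)%:E) <= (S n)%:E)%E.
  pose d := s / (2 * n.+1%:R).
  have n0 : 0 < n.+1%:R :> R by rewrite ltr0n.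
  have d0 : 0 < d by rewrite divr_gt0// mulr_gt0.
  apply: (@le_trans _ _ ((multiplicity alpha n)%:E * (d `^ (alpha + 1) * (2 * d))%:E)%E).
    apply: lee_wpmul2l; first by rewrite lee_fin multiplicity_ge0.
    rewrite -(_ : (\int[mu]_x (d `^ (alpha + 1) * \1_(`[- d, d] : set GR) x)%:E = (d `^ (alpha + 1) * (2 * d))%:E)%E); last first.
      rewrite integral_indic_scaled ?powR_ge0//= lebesgue_measure_itv/= lte_fin ifT; last lra.
      by rewrite -EFinD -EFinM; congr EFin; ring.
    apply: ge0_le_integral => //=.
    + by move=> l _; rewrite mule_ge0// lee_fin ?dual_weight_ge0// indicE.
    + apply: emeasurable_funM; last by apply/measurable_EFinP; exact: measurable_dual_weight.
      apply/measurable_EFinP; apply: (measurableT_comp (measurable_indic mB)).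
      by apply: measurable_fun_pair => /=.
    + by apply/measurable_EFinP; apply: measurable_funM => //; exact: measurable_indic.
    + move=> l _; rewrite -EFinM lee_fin !indicE.
      case: (boolP ((l, n) \in _)) => [|_]; last by rewrite mul0r mulr_ge0 ?powR_ge0.
      rewrite inE/= /dual_ball/= /dual_norm/= mul1r => H.
      have ld : `|l| <= d.
        rewrite /d ler_pdivlMr ?mulr_gt0// (le_trans _ H)//.
        rewrite [4 * _]mulrC -mulrA ler_wpM2l// -[n.+1%:R]natr1.
        rewrite -subr_ge0 (_ : _ - _ = 2 * n%:R + 2 * alpha); last by field.
        by rewrite addr_ge0// mulr_ge0.
      rewrite mem_set ?mulr1/=; last by rewrite in_itv/= -ler_norml.
      by rewrite /dual_weight ge0_ler_powR ?nnegrE ?addr_ge0// ltW.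
  rewrite -EFinM lee_fin /S.
  apply: (@le_trans _ _ ((1 + alpha) * n.+1%:R `^ alpha * (d `^ (alpha + 1) * (2 * d)))).
    by rewrite ler_wpM2r ?multiplicity_le// !mulr_ge0 ?powR_ge0// ltW.
  rewrite -!mulrA ler_wpM2l//.
  have -> : d `^ (alpha + 1) * (2 * d) = 2 * d `^ (alpha + 2).
    rewrite mulrCA; congr (_ * _).
    have -> : alpha + 2 = (alpha + 1) + 1 by ring.
    rewrite [in RHS]powRD; last by apply/implyP => _; rewrite gt_eqF.
    by rewrite [in RHS]powRr1// ltW.
  have -> : n.+1%:R `^ alpha = n.+1%:R `^ (alpha + 2) / n.+1%:R ^+ 2 :> R.
    rewrite [in RHS]powRD; last by apply/implyP => _; rewrite gt_eqF.
    by rewrite powR_mulrn ?(ltW n0)// mulfK// expf_neq0// gt_eqF.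
  rewrite mulrAC [leRHS]mulrC [leLHS]mulrC ler_wpM2l ?invr_ge0 ?sqr_ge0//.
  rewrite mulrCA -powRM ?(ltW n0) ?(ltW d0)//.
  have -> : s = 2 * (n.+1%:R * d).
    by rewrite /d; field; rewrite gt_eqF.
  have nd0 : 0 <= n.+1%:R * d by rewrite mulr_ge0// ltW.
  rewrite [leRHS]powRM// ler_wpM2r ?powR_ge0// le1r_powR ?ler1n//.
  by rewrite -lerBlDr (le_trans _ alpha_ge0)//; lra.
apply: lime_le.
  apply: is_cvg_ereal_nneg_natsum_cond => n _ _; rewrite mule_ge0 ?lee_fin ?multiplicity_ge0//.
  by apply: integral_ge0 => l _; rewrite mule_ge0// lee_fin ?dual_weight_ge0// indicE.
apply: nearW => n; apply: (@le_trans _ _ (\sum_(0 <= k < n) (S k)%:E)%E).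
  by apply: lee_sum => k _; exact: term.
rewrite sumEFin lee_fin -mulr_sumr -[2 * (1 + alpha) * _]mulrA [leRHS]mulrC.
by rewrite ler_wpM2l ?sum_inv_sqr_le// mulr_ge0 ?powR_ge0.
Qed.

End BallVolumes.

(** * The estimate at a fixed radius *)

(** Cauchy-Schwarz on a set of finite measure, from 2 |u| <= k + u^2 / k with the
    optimal constant k. *)
Lemma nrm1_indic_sqr_le d (T : measurableType d) (R : realType)
    (mu : {measure set T -> \bar R}) (A : set T) (V x : R) (u : T -> R) :
  measurable A -> measurable_fun setT u -> 0 < V -> (mu A <= V%:E)%E ->
  (forall z, z \notin A -> u z = 0) -> nrm2 mu u = x%:E ->
  exists2 N : R, nrm1 mu u = N%:E & 0 <= N /\ N ^+ 2 <= V * x.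
Proof.
move=> mA mu_ V0 AV u0 ux.
have x0 : 0 <= x by rewrite -lee_fin -ux nrm2_ge0.
have young k : 0 < k -> (2%:E * nrm1 mu u <= (k * V + x / k)%:E)%E.
  move=> k0; apply: (@le_trans _ _ (k%:E * mu A + k^-1%:E * nrm2 mu u)%E); last first.
    by rewrite ux EFinD !EFinM [(x%:E * _)%E]muleC leeD2r// lee_wpmul2l// lee_fin ltW.
  have -> : mu A = (\int[mu]_z (\1_A z)%:E)%E by rewrite integral_indic// setIT.
  have mi : measurable_fun setT (fun z : T => (\1_A z : R)%:E).
    by apply/measurable_EFinP; exact: measurable_indic.
  have mn : measurable_fun setT (fun z : T => (`|u z|)%:E).
    by apply/measurable_EFinP; exact: measurableT_comp.
  have m2 : measurable_fun setT (fun z : T => (u z ^+ 2)%:E).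
    by apply/measurable_EFinP; exact: measurable_funX.
  have i0 z : (0 <= (\1_A z : R)%:E)%E by rewrite lee_fin indicE.
  have s0 z : (0 <= (u z ^+ 2)%:E)%E by rewrite lee_fin sqr_ge0.
  have k1 : 0 <= k^-1 by rewrite invr_ge0 ltW.
  rewrite /nrm1 /nrm2 -!ge0_integralZl//=; try by rewrite lee_fin ltW.
  rewrite -ge0_integralD//=; try exact: measurable_funeM;
    try by move=> z _; rewrite mule_ge0// lee_fin ltW.
  apply: ge0_le_integral => //=.
  - exact: measurable_funeM.
  - by apply: emeasurable_funD; exact: measurable_funeM.
  - move=> z _; rewrite -!EFinM -EFinD lee_fin indicE.
    case: (boolP (z \in A)) => zA; last first.
      by rewrite u0// normr0 !mulr0 expr0n/= mulr0 addr0.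
    rewrite mulr1 -[u z ^+ 2]real_normK ?num_real//; move: (`|u z|) => y.
    rewrite -subr_ge0 (_ : _ - _ = (k - y) ^+ 2 / k) ?divr_ge0 ?sqr_ge0 ?(ltW k0)//.
    by field; rewrite gt_eqF.
have : nrm1 mu u \is a fin_num.
  rewrite ge0_fin_numE ?nrm1_ge0//.
  have := young 1 ltr01; have := nrm1_ge0 mu u.
  case: (nrm1 mu u) => [y| |]//= _; first by rewrite ltry.
  by rewrite mulry gtr0_sg// mul1e.
move=> /fineK; set N := fine _ => NE; exists N => //.
have N0 : 0 <= N by rewrite fine_ge0// nrm1_ge0.
split=> //; move: N0; rewrite le_eqVlt => /predU1P[<-|N0].
  by rewrite expr0n/= mulr_ge0// ltW.
(* k = N / V minimises k V + x / k when N^2 = V x. *)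
have := young (N / V) (divr_gt0 N0 V0).
rewrite -NE -EFinM lee_fin divfK ?gt_eqF// => H.
have {}H : N <= x / (N / V) by lra.
move: H; rewrite invf_div mulrA ler_pdivlMr//.
by rewrite expr2 mulrC [x * V]mulrC.
Qed.

Section Restriction.
Context d (T : measurableType d) (R : realType).
Implicit Types (A : set T) (f : T -> R[i]).

Lemma sqnorm_scale (c : R) (z : R[i]) : sqnorm (real_complex R c * z) = c ^+ 2 * sqnorm z.
Proof. by case: z => u v; rewrite /sqnorm/real_complex_def; simpc; rewrite /=; ring. Qed.

Definition restrict A f z : R[i] := real_complex R (\1_A z) * f z.

Lemma restrictRe A f z : complex.Re (restrict A f z) = \1_A z * complex.Re (f z).
Proof. by rewrite /restrict /real_complex_def; case: (f z) => u v; simpc. Qed.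

Lemma restrictIm A f z : complex.Im (restrict A f z) = \1_A z * complex.Im (f z).
Proof. by rewrite /restrict /real_complex_def; case: (f z) => u v; simpc. Qed.

Lemma sqnorm_restrict A f z : sqnorm (restrict A f z) = \1_A z * sqnorm (f z).
Proof. by rewrite sqnorm_scale indicE; case: (z \in A); rewrite ?expr1n ?expr0n. Qed.

Lemma measurable_restrict A f : measurable A -> complex_measurable_fun f ->
  complex_measurable_fun (restrict A f).
Proof.
move=> mA [mr mi]; split.
  under eq_fun do rewrite restrictRe.
  by apply: measurable_funM => //; exact: measurable_indic.
under eq_fun do rewrite restrictIm.
by apply: measurable_funM => //; exact: measurable_indic.
Qed.

Lemma restrictC A f z : f z - restrict A f z = restrict (~` A) f z.
Proof.
rewrite /restrict /real_complex_def !indicE in_setC.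
by case: (f z) => u v; case: (z \in A) => /=; simpc; rewrite ?subrr.
Qed.

Lemma csq_restrict_le (mu : {measure set T -> \bar R}) A f : measurable A ->
  complex_measurable_fun f -> (csq mu (restrict A f) <= csq mu f)%E.
Proof.
move=> mA mf; apply: ge0_le_integral => //=.
- by move=> z _; rewrite lee_fin sqnorm_ge0.
- by apply/measurable_EFinP; apply: measurable_sqnorm; exact: measurable_restrict.
- by apply/measurable_EFinP; exact: measurable_sqnorm.
- by move=> z _; rewrite lee_fin sqnorm_restrict ler_piMl ?sqnorm_ge0 ?indicE ?lern1 ?leq_b1.
Qed.

Lemma csq_split (mu : {measure set T -> \bar R}) A f : measurable A ->
  complex_measurable_fun f ->
  (csq mu f = csq mu (restrict A f) + csq mu (restrict (~` A) f))%E.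
Proof.
move=> mA mf; have mC := measurableC mA.
rewrite /csq -ge0_integralD//=.
- apply: eq_integral => z _; rewrite -EFinD !sqnorm_restrict !indicE in_setC.
  by case: (z \in A); rewrite ?mul1r ?mul0r ?addr0 ?add0r.
- by move=> z _; rewrite lee_fin sqnorm_ge0.
- by apply/measurable_EFinP; apply: measurable_sqnorm; exact: measurable_restrict.
- by move=> z _; rewrite lee_fin sqnorm_ge0.
- by apply/measurable_EFinP; apply: measurable_sqnorm; exact: measurable_restrict.
Qed.

Lemma csq_weight_le (mu : {measure set T -> \bar R}) A (h : T -> R) (c : R) f :
  measurable A -> complex_measurable_fun f -> measurable_fun setT h -> 0 < c ->
  (forall z, A z -> c <= h z ^+ 2) ->
  (csq mu (restrict A f) <= c^-1%:E * csq mu (fun z => (real_complex R (h z) * f z)%R))%E.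
Proof.
move=> mA mf mh c0 ch.
have mhf : measurable_fun setT (fun z => (h z) ^+ 2 * sqnorm (f z)).
  by apply: measurable_funM; [exact: measurable_funX|exact: measurable_sqnorm].
have -> : csq mu (fun z => (real_complex R (h z) * f z)%R) =
    (\int[mu]_z ((h z) ^+ 2 * sqnorm (f z))%:E)%E.
  by apply: eq_integral => z _; rewrite sqnorm_scale.
rewrite -ge0_integralZl//=.
- apply: ge0_le_integral => //=.
  + by move=> z _; rewrite lee_fin sqnorm_ge0.
  + by apply/measurable_EFinP; apply: measurable_sqnorm; exact: measurable_restrict.
  + by apply: measurable_funeM; exact/measurable_EFinP.
  + move=> z _; rewrite -EFinM lee_fin sqnorm_restrict indicE mulrA.
    rewrite ler_wpM2r ?sqnorm_ge0//; case: (boolP (z \in A)) => [|_].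
      by rewrite inE => /ch; rewrite mulrC ler_pdivlMr// mul1r.
    by rewrite mulr_ge0 ?sqr_ge0// invr_ge0 ltW.
- exact/measurable_EFinP.
- by move=> z _; rewrite lee_fin mulr_ge0 ?sqr_ge0 ?sqnorm_ge0.
- by rewrite lee_fin invr_ge0 ltW.
Qed.

End Restriction.

Section MainEstimate.
Context {R : realType}.
Variable alpha : R.
Hypothesis alpha_ge0 : 0 <= alpha.
Local Notation GR := (measurableTypeR R).
Local Notation m := (laguerre_measure alpha).
Local Notation g := (plancherel_measure alpha).
Implicit Types f : GR * GR -> R[i].

Let ball_coef : R := (pi * Gamma (alpha + 1))^-1.

Let ball_coef_gt0 : 0 < ball_coef.
Proof. by rewrite invr_gt0 mulr_gt0 ?pi_gt0 ?Gamma_gt0. Qed.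

Let ball_le r : 0 < r -> (m (hypergroup_ball r) <= (ball_coef * r `^ (2 * alpha + 4))%:E)%E.
Proof. exact: hypergroup_ball_volume. Qed.

Let volume_gt0 r : 0 < r -> 0 < ball_coef * r `^ (2 * alpha + 4).
Proof. by move=> r0; rewrite mulr_gt0// powR_gt0. Qed.

Lemma complex12_restrict_ball f r : 0 < r -> complex_measurable_fun f ->
  (csq m f < +oo)%E -> complex12 alpha (restrict (hypergroup_ball r) f).
Proof.
move=> r0 mf Xf; have mB := @measurable_hypergroup_ball R r.
have mf1 := measurable_restrict mB mf; have [mr mi] := mf1.
have := le_lt_trans (csq_restrict_le m mB mf) Xf.
rewrite csqE// => Xf1.
have part (u : GR * GR -> R) : measurable_fun setT u ->
    (forall z, z \notin hypergroup_ball r -> u z = 0) -> (nrm2 m u < +oo)%E -> integrable12 m u.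
  move=> mu u0 ux; split=> //.
  have /fineK/esym xE : nrm2 m u \is a fin_num by rewrite ge0_fin_numE ?nrm2_ge0.
  have [N -> _] := nrm1_indic_sqr_le mB mu (volume_gt0 r0) (ball_le r0) u0 xE.
  by rewrite ltry.
split; apply: part => //.
- by move=> z zB; rewrite restrictRe indicE (negbTE zB) mul0r.
- by apply: le_lt_trans Xf1; rewrite leeDl ?nrm2_ge0.
- by move=> z zB; rewrite restrictIm indicE (negbTE zB) mul0r.
- by apply: le_lt_trans Xf1; rewrite leeDr ?nrm2_ge0.
Qed.

(** The exponent of [radial_character_le_exp] is at most s r^2 / 4, so the kernel
    is bounded by exp(1/2) over the ball; Cauchy-Schwarz does the rest. *)
Let kernel_transform_le (kern : GR * nat -> GR * GR -> R) (u : GR * GR -> R) r s (x : R) w :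
  bounded_kernel kern -> (forall z, `|kern w z| <= expR (w.2%:R * (`|w.1| * z.1 ^+ 2))) ->
  0 < r -> s * r ^+ 2 <= 1 -> dual_ball alpha s w -> integrable12 m u ->
  (forall z, z \notin hypergroup_ball r -> u z = 0) -> nrm2 m u = x%:E ->
  (transform m kern u w) ^+ 2 <= expR 1 * (ball_coef * r `^ (2 * alpha + 4) * x).
Proof.
move=> bk kle r0 sr wE Iu u0 ux; have [mu _ _] := Iu.
have mB := @measurable_hypergroup_ball R r.
have [N nN [N0 N2]] := nrm1_indic_sqr_le mB mu (volume_gt0 r0) (ball_le r0) u0 ux.
have H z : `|u z * kern w z| <= expR (2^-1) * `|u z|.
  case: (boolP (z \in hypergroup_ball r)) => [|/u0 ->]; last by rewrite mul0r normr0 mulr0.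
  rewrite inE => zB; rewrite normrM mulrC ler_wpM2r//.
  apply: (le_trans (kle z)); rewrite ler_expR.
  have [zr _] := hypergroup_ball_box r0 zB.
  have z2 : z.1 ^+ 2 <= r ^+ 2.
    by rewrite -[z.1 ^+ 2]real_normK ?num_real// lerXn2r ?nnegrE ?(ltW r0).
  have ms : w.2%:R * `|w.1| <= s / 4.
    move: wE; rewrite /dual_ball/= /dual_norm => wE.
    rewrite ler_pdivlMr// (le_trans _ wE)// (_ : _ * 4 = 4 * `|w.1| * w.2%:R); last by ring.
    by rewrite ler_wpM2l ?mulr_ge0// lerDl divr_ge0// addr_ge0.
  rewrite mulrA (le_trans (ler_pM _ _ ms z2))// ?sqr_ge0 ?mulr_ge0//.
  by move: sr; rewrite mulrAC; set y := s * _; lra.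
have := transform_le_nrm1 bk Iu (expR_ge0 _) H.
rewrite nN -EFinM lee_fin => TN.
rewrite -real_normK ?num_real// (le_trans (_ : _ <= (expR 2^-1 * N) ^+ 2))//.
  by rewrite lerXn2r ?nnegrE// mulr_ge0 ?expR_ge0.
rewrite exprMn -expRM_natl (_ : 2 * 2^-1 = 1); last by field.
by rewrite ler_wpM2l ?expR_ge0.
Qed.

Let transform_ball_le f r s (X : R) w : 0 < r -> s * r ^+ 2 <= 1 ->
  complex_measurable_fun f -> csq m f = X%:E -> dual_ball alpha s w ->
  sqnorm (fourier_laguerre alpha (restrict (hypergroup_ball r) f) w) <=
  4 * expR 1 * ball_coef * r `^ (2 * alpha + 4) * X.
Proof.
move=> r0 sr mf fX wE; have mB := @measurable_hypergroup_ball R r.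
have Xf : (csq m f < +oo)%E by rewrite fX ltry.
have I1 := complex12_restrict_ball r0 mf Xf; have [Iu Iv] := I1.
have : (csq m (restrict (hypergroup_ball r) f) <= X%:E)%E by rewrite -fX; exact: csq_restrict_le.
rewrite (csqE m (complex12_measurable I1)).
rewrite fourier_laguerreE// /sqnorm/=.
set u := (fun z => complex.Re _) in Iu *; set v := (fun z => complex.Im _) in Iv *.
have u0 z : z \notin hypergroup_ball r -> u z = 0.
  by move=> zB; rewrite /u restrictRe indicE (negbTE zB) mul0r.
have v0 z : z \notin hypergroup_ball r -> v z = 0.
  by move=> zB; rewrite /v restrictIm indicE (negbTE zB) mul0r.
have [_ _ u2] := Iu; have [_ _ v2] := Iv.
have /fineK/esym xE : nrm2 m u \is a fin_num by rewrite ge0_fin_numE ?nrm2_ge0.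
have /fineK/esym yE : nrm2 m v \is a fin_num by rewrite ge0_fin_numE ?nrm2_ge0.
rewrite xE yE -EFinD lee_fin; move: (fine (nrm2 m u)) (fine (nrm2 m v)) xE yE => x y xE yE xyX.
have ck z : `|cos_kernel alpha w z| <= expR (w.2%:R * (`|w.1| * z.1 ^+ 2)).
  rewrite /cos_kernel normrM -[leRHS]mulr1; apply: ler_pM => //.
    exact: radial_character_le_exp.
  by rewrite ler_norml cos_geN1 cos_le1.
have sk z : `|sin_kernel alpha w z| <= expR (w.2%:R * (`|w.1| * z.1 ^+ 2)).
  rewrite /sin_kernel normrM -[leRHS]mulr1; apply: ler_pM => //.
    exact: radial_character_le_exp.
  by rewrite ler_norml sin_geN1 sin_le1.
have bc := bounded_cos_kernel alpha_ge0; have bs := bounded_sin_kernel alpha_ge0.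
have Cu := kernel_transform_le bc ck r0 sr wE Iu u0 xE.
have Cv := kernel_transform_le bc ck r0 sr wE Iv v0 yE.
have Su := kernel_transform_le bs sk r0 sr wE Iu u0 xE.
have Sv := kernel_transform_le bs sk r0 sr wE Iv v0 yE.
pose Y := expR 1 * (ball_coef * r `^ (2 * alpha + 4)).
have Y0 : 0 <= Y by rewrite mulr_ge0 ?expR_ge0// ltW// volume_gt0.
have YE t : expR 1 * (ball_coef * r `^ (2 * alpha + 4) * t) = Y * t by rewrite /Y; ring.
have -> : 4 * expR 1 * ball_coef * r `^ (2 * alpha + 4) * X = 4 * (Y * X) by rewrite /Y; ring.
move: Cu Cv Su Sv; rewrite !YE.
move: (transform m (cos_kernel alpha) u w) (transform m (cos_kernel alpha) v w)
  (transform m (sin_kernel alpha) u w) (transform m (sin_kernel alpha) v w).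
move=> p p' q q' Hp Hp' Hq Hq'.
have YX : Y * x + Y * y <= Y * X by rewrite -mulrDr ler_wpM2l.
apply: (@le_trans _ _ (2 * (p ^+ 2 + q' ^+ 2) + 2 * (p' ^+ 2 + q ^+ 2))); last lra.
rewrite -subr_ge0 (_ : _ - _ = (p - q') ^+ 2 + (p' + q) ^+ 2) ?addr_ge0 ?sqr_ge0//; ring.
Qed.

(** The powers of r and s from the two volumes combine into
    (s r^2)^(alpha + 2) <= s r^2. *)
Let dual_ball_energy_le f r s (X : R) : 0 < r -> 0 < s -> s * r ^+ 2 <= 1 ->
  complex_measurable_fun f -> csq m f = X%:E ->
  (csq g (restrict (dual_ball alpha s) (fourier_laguerre alpha (restrict (hypergroup_ball r) f)))
   <= (8 * expR 1 * ball_coef * (1 + alpha) * (s * r ^+ 2) * X)%:E)%E.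
Proof.
move=> r0 s0 sr mf fX; have mE := @measurable_dual_ball R alpha s.
have X0 : 0 <= X by rewrite -lee_fin -fX csq_ge0.
pose c := 4 * expR 1 * ball_coef * r `^ (2 * alpha + 4) * X.
have c0 : 0 <= c by rewrite !mulr_ge0 ?expR_ge0 ?powR_ge0// ltW.
have Xf : (csq m f < +oo)%E by rewrite fX ltry.
have I1 := complex12_restrict_ball r0 mf Xf.
apply: (@le_trans _ _ (\int[g]_w (c%:E * (\1_(dual_ball alpha s) w)%:E))%E).
  apply: ge0_le_integral => //=.
  - by move=> z _; rewrite lee_fin sqnorm_ge0.
  - apply/measurable_EFinP; apply: measurable_sqnorm; apply: measurable_restrict => //.
    exact: measurable_fourier_laguerre.
  - by apply: measurable_funeM; apply/measurable_EFinP; exact: measurable_indic.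
  - move=> w _; rewrite -EFinM lee_fin sqnorm_restrict indicE.
    case: (boolP (w \in _)) => [|_]; last by rewrite mul0r mulr0.
    by rewrite inE mul1r mulr1 => wE; exact: (transform_ball_le r0 sr mf fX wE).
rewrite ge0_integralZl//=; last by apply/measurable_EFinP; exact: measurable_indic.
rewrite integral_indic// setIT.
apply: (@le_trans _ _ (c%:E * (2 * (1 + alpha) * s `^ (alpha + 2))%:E)%E).
  by rewrite lee_wpmul2l ?dual_ball_volume.
rewrite -EFinM lee_fin /c.
have -> : r `^ (2 * alpha + 4) = (r ^+ 2) `^ (alpha + 2).
  by rewrite -powR_mulrn ?(ltW r0)// -powRrM; congr (_ `^ _); ring.
have e1 : (s * r ^+ 2) `^ (alpha + 2) <= s * r ^+ 2.
  have p0 : 0 < s * r ^+ 2 by rewrite mulr_gt0// exprn_gt0.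
  by rewrite ge1r_powR ?p0 // -[leLHS]add0r lerD// ler1n.
rewrite (_ : _ * (_ * _) = 8 * expR 1 * ball_coef * (1 + alpha) * ((s * r ^+ 2) `^ (alpha + 2)) * X).
  by rewrite ler_wpM2r// ler_wpM2l// !mulr_ge0 ?expR_ge0 ?addr_ge0// ltW.
by rewrite [in RHS]powRM ?sqr_ge0 ?(ltW s0)//; ring.
Qed.

Variables a b : R.
Hypotheses (a_gt0 : 0 < a) (b_gt0 : 0 < b).

Lemma space_tail_le f r : 0 < r -> complex_measurable_fun f ->
  (csq m (restrict (~` hypergroup_ball r) f) <=
   (r `^ (- (2 * a)))%:E * csq m (fun z => (real_complex R (hypergroup_norm z `^ a) * f z)%R))%E.
Proof.
move=> r0 mf; rewrite powRN; apply: csq_weight_le => //.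
- by apply: measurableC; exact: measurable_hypergroup_ball.
- exact: (measurableT_comp (measurable_powR _) measurable_hypergroup_norm).
- exact: powR_gt0.
move=> z /negP; rewrite /hypergroup_ball/= -ltNge => rz.
rewrite -powR_mulrn ?powR_ge0// -powRrM mulrC.
by rewrite ge0_ler_powR ?nnegrE ?(ltW r0) ?(ltW rz)// ?mulr_ge0// ?(ltW a_gt0) ?powR_ge0.
Qed.

Lemma dual_tail_le (F : GR * nat -> R[i]) s : 0 < s -> complex_measurable_fun F ->
  (csq g (restrict (~` dual_ball alpha s) F) <=
   (s `^ (- b))%:E * csq g (fun w => (real_complex R (dual_norm alpha w `^ (b / 2)) * F w)%R))%E.
Proof.
move=> s0 mF; rewrite powRN; apply: csq_weight_le => //.
- by apply: measurableC; exact: measurable_dual_ball.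
- exact: (measurableT_comp (measurable_powR _) (measurable_dual_norm alpha)).
- exact: powR_gt0.
move=> w /negP; rewrite /dual_ball/= -ltNge => sw.
rewrite -powR_mulrn ?powR_ge0// -powRrM divfK//.
by rewrite ge0_ler_powR ?nnegrE ?(ltW s0) ?(ltW b_gt0)// ?(le_trans (ltW s0) (ltW sw))// ltW.
Qed.

(** Outside the dual ball F is a tail.  Inside, it is the transform of f cut off to
    the ball, up to the tail of f, and the energy of that transform is at most
    half of the left-hand side, into which it is absorbed. *)
Lemma dilated_uncertainty : exists2 K : R, 0 < K &
  forall (f : GR * GR -> R[i]) (F : GR * nat -> R[i]),
    complex_Lp m 2%:E f -> is_fourier_laguerre_L2 alpha f F ->
    forall r : R, 0 < r ->
    (csq m f <=
      (K * r `^ (- (2 * a)))%:E * csq m (fun z => (real_complex R (hypergroup_norm z `^ a) * f z)%R) +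
      (K * r `^ (2 * b))%:E * csq g (fun w => (real_complex R (dual_norm alpha w `^ (b / 2)) * F w)%R))%E.
Proof.
have [K1 [K10 K1E]] : exists K1 : R, 0 <= K1 /\ K1 = 8 * expR 1 * ball_coef * (1 + alpha).
  by eexists; split; last reflexivity; rewrite !mulr_ge0 ?expR_ge0 ?addr_ge0// ltW.
(* The constant of the L2 Plancherel bounds, kept abstract in the computations. *)
have [k [k0 kE]] : exists k : R, 0 <= k /\ k = 64 by exists 64.
(* Small enough for the energy in the dual ball to cost at most half of X. *)
pose e := (1 + 4 * k * K1)^-1.
have d0 : 0 < 1 + 4 * k * K1 by rewrite ltr_pwDl// !mulr_ge0.
have e0 : 0 < e by rewrite invr_gt0.
have e1 : e <= 1 by rewrite invf_le1// lerDl !mulr_ge0.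
have Ke : 2 * k * K1 * e <= 2^-1.
  rewrite /e ler_pdivrMr//; move: d0; rewrite (_ : 4 * k * K1 = 2 * (2 * k * K1)); last by ring.
  by move: (2 * k * K1) => y; lra.
pose K := 1 + (4 * k ^+ 2 + 2 * k * e `^ (- b)).
have K2 : 0 <= 4 * k ^+ 2 by rewrite mulr_ge0 ?sqr_ge0.
have K3 : 0 <= 2 * k * e `^ (- b) by rewrite !mulr_ge0 ?powR_ge0.
have K0 : 0 < K by rewrite ltr_pwDl// addr_ge0.
exists K => // f F Lf fF r r0; have [mf Xf] := Lf; have [[mF /csq_lty FF] _] := fF.
move/csq_lty: Xf => Xf.
pose s := e / r ^+ 2.
have r2 : 0 < r ^+ 2 by rewrite exprn_gt0.
have s0 : 0 < s by rewrite divr_gt0.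
have sr : s * r ^+ 2 = e by rewrite divfK// gt_eqF.
have sr1 : s * r ^+ 2 <= 1 by rewrite sr.
have mB := @measurable_hypergroup_ball R r.
have mE := @measurable_dual_ball R alpha s.
have I1 := complex12_restrict_ball r0 mf Xf.
set A := csq m (fun z => (real_complex R (hypergroup_norm z `^ a) * f z)%R).
set B := csq g (fun w => (real_complex R (dual_norm alpha w `^ (b / 2)) * F w)%R).
have tA : (csq m (restrict (~` hypergroup_ball r) f) <= (r `^ (- (2 * a)))%:E * A)%E.
  exact: space_tail_le.
have tB : (csq g (restrict (~` dual_ball alpha s) F) <= (e `^ (- b) * r `^ (2 * b))%:E * B)%E.
  have -> : e `^ (- b) * r `^ (2 * b) = s `^ (- b).
    have -> : s = e * r `^ (- 2).
      by rewrite /s powRN powR_mulrn ?(ltW r0).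
    rewrite powRM ?(ltW e0) ?powR_ge0// -powRrM; congr (_ * _ `^ _); ring.
  exact: dual_tail_le.
have [X XE] : exists X, csq m f = X%:E.
  by exists (fine (csq m f)); rewrite fineK// ge0_fin_numE ?csq_ge0.
have X0 : 0 <= X by rewrite -lee_fin -XE csq_ge0.
have [Y YE] : exists Y, csq m (restrict (~` hypergroup_ball r) f) = Y%:E.
  exists (fine (csq m (restrict (~` hypergroup_ball r) f))).
  rewrite fineK// ge0_fin_numE ?csq_ge0// (le_lt_trans _ Xf)// csq_restrict_le//.
  exact: measurableC.
have Y0 : 0 <= Y by rewrite -lee_fin -YE csq_ge0.
have [Q QE] : exists Q, csq g (restrict (~` dual_ball alpha s) F) = Q%:E.
  exists (fine (csq g (restrict (~` dual_ball alpha s) F))).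
  rewrite fineK// ge0_fin_numE ?csq_ge0// (le_lt_trans _ FF)// csq_restrict_le//.
  exact: measurableC.
have Q0 : 0 <= Q by rewrite -lee_fin -QE csq_ge0.
have bE := dual_ball_energy_le r0 s0 sr1 mf XE; rewrite -K1E sr in bE.
have H1 := csq_le_transform alpha_ge0 Lf fF; rewrite -kE in H1.
have H2 := csq_transform_sub_le alpha_ge0 Lf fF I1; rewrite -kE in H2.
have mh := measurable_fourier_laguerre alpha_ge0 I1.
have H3 : (csq g (restrict (dual_ball alpha s) F) <= (2 * (K1 * e * X) + 2 * (k * Y))%:E)%E.
  set h := fourier_laguerre alpha _ in mh H2 bE.
  have mFh := complex_measurable_funB mF mh.
  have D w : restrict (dual_ball alpha s) F w =
      restrict (dual_ball alpha s) h w + restrict (dual_ball alpha s) (fun w => F w - h w) w.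
    by rewrite /restrict -mulrDr addrC subrK.
  apply: (le_trans (csq_leD g (measurable_restrict mE mF) (measurable_restrict mE mh)
    (measurable_restrict mE mFh) D)).
  rewrite (_ : (2 * _ + _)%:E = 2%:E * (K1 * e * X)%:E + 2%:E * (k * Y)%:E)%E//.
  apply: leeD; apply: lee_wpmul2l => //.
  apply: (le_trans (csq_restrict_le g mE mFh)); apply: (le_trans H2).
  have -> : csq m (fun z => (f z - restrict (hypergroup_ball r) f z)%R) = Y%:E.
    by rewrite -YE; apply: eq_integral => z _; rewrite restrictC.
  by rewrite EFinM.
have XYQ : X <= 4 * k ^+ 2 * Y + 2 * k * Q.
  have XF : (X%:E <= (k * (2 * (K1 * e * X) + 2 * (k * Y) + Q))%:E)%E.
    rewrite -XE; apply: (le_trans H1).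
    rewrite EFinM lee_wpmul2l ?lee_fin//.
    by rewrite (csq_split g mE mF) QE EFinD leeD2r.
  move: XF; rewrite lee_fin.
  rewrite (_ : k * _ = (2 * k * K1 * e) * X + 2 * (k ^+ 2 * Y) + k * Q); last by ring.
  have -> : 4 * k ^+ 2 * Y + 2 * k * Q = 4 * (k ^+ 2 * Y) + 2 * (k * Q) by ring.
  have : 2 * k * K1 * e * X <= 2^-1 * X by rewrite ler_wpM2r.
  move: (2 * k * K1 * e * X) (k ^+ 2 * Y) (k * Q) => y1 y2 y3; lra.
rewrite XE; apply: (@le_trans _ _ ((4 * k ^+ 2)%:E * Y%:E + (2 * k)%:E * Q%:E)%E).
  by rewrite -!EFinM -EFinD lee_fin.
have k20 : 0 <= 2 * k by rewrite mulr_ge0.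
rewrite -YE -QE; apply: leeD.
  apply: (@le_trans _ _ ((4 * k ^+ 2)%:E * ((r `^ (- (2 * a)))%:E * A))%E).
    by rewrite lee_wpmul2l ?lee_fin.
  rewrite muleA -EFinM lee_wpmul2r ?csq_ge0// lee_fin ler_wpM2r ?powR_ge0//.
  by rewrite /K addrCA lerDl addr_ge0.
apply: (@le_trans _ _ ((2 * k)%:E * ((e `^ (- b) * r `^ (2 * b))%:E * B))%E).
  by rewrite lee_wpmul2l ?lee_fin.
rewrite muleA -EFinM lee_wpmul2r ?csq_ge0// lee_fin mulrA ler_wpM2r ?powR_ge0//.
by rewrite /K addrA lerDr addr_ge0.
Qed.

End MainEstimate.

(** * Optimising the radius *)

(** Covers the degenerate case where a weighted norm vanishes. *)
Lemma csq_weight_eq0 d (T : measurableType d) (R : realType)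
    (mu : {measure set T -> \bar R}) (h : T -> R) (f : T -> R[i]) :
  measurable_fun setT h -> complex_measurable_fun f -> mu [set z | h z = 0] = 0%E ->
  csq mu (fun z => (real_complex R (h z) * f z)%R) = 0%E -> csq mu f = 0%E.
Proof.
move=> mh mf h0 H.
have mhf : measurable_fun setT (fun z => (h z ^+ 2 * sqnorm (f z))%:E).
  apply/measurable_EFinP.
  by apply: measurable_funM; [exact: measurable_funX|exact: measurable_sqnorm].
have ms : measurable_fun setT (fun z => (sqnorm (f z))%:E).
  by apply/measurable_EFinP; exact: measurable_sqnorm.
have mh0 : measurable [set z | h z = 0].
  by rewrite -[X in measurable X]setTI; exact: (mh measurableT [set 0]).
have ae1 : ae_eq mu setT (fun z => (h z ^+ 2 * sqnorm (f z))%:E) (cst 0%E).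
  apply/(ae_eq_integral_abs mu measurableT mhf); rewrite -[RHS]H.
  by apply: eq_integral => z _; rewrite sqnorm_scale gee0_abs// lee_fin mulr_ge0 ?sqr_ge0 ?sqnorm_ge0.
have ae2 : {ae mu, forall z, h z != 0}.
  exists [set z | h z = 0]; split => //.
  by move=> z /negP; rewrite negbK => /eqP.
rewrite /csq (ae_eq_integral (cst 0%E))//; first by rewrite integral0.
move: ae1 ae2; apply: filterS2 => z /(_ I) [] /eqP; rewrite mulf_eq0 expf_eq0/=.
by move=> /orP[-> //|/eqP -> _ _].
Qed.

Lemma measure_eq0_of_powR_le d (T : measurableType d) (R : realType)
    (mu : {measure set T -> \bar R}) (A : set T) (c p : R) : 0 < c -> 0 < p ->
  (forall r, 0 < r -> (mu A <= (c * r `^ p)%:E)%E) -> mu A = 0%E.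
Proof.
move=> c0 p0 H; apply/eqP; rewrite eq_le measure_ge0 andbT.
apply/lee_addgt0Pr => e e0; rewrite add0e.
have ec : 0 < e / c by rewrite divr_gt0.
apply: (le_trans (H ((e / c) `^ p^-1) (powR_gt0 _ ec))).
by rewrite -powRrM mulVf ?gt_eqF// powRr1 ?(ltW ec)// mulrC divfK// gt_eqF.
Qed.

(** The optimal r, up to a constant, equates the two terms:
    r = (A / B)^(1 / (2 (a + b))).  Exponential coordinates for A, B and r make
    the exponents linear. *)
Lemma optimise_dilation (R : realType) (a b K X A B : R) :
  0 < a -> 0 < b -> 0 < K -> 0 <= X -> 0 < A -> 0 < B ->
  (forall r, 0 < r -> X <= K * r `^ (- (2 * a)) * A + K * r `^ (2 * b) * B) ->
  X `^ ((a + b) / 2) <= (2 * K) `^ ((a + b) / 2) * A `^ (b / 2) * B `^ (a / 2).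
Proof.
move=> a0 b0 K0 X0 A0 B0 H.
have ab0 : 0 < a + b by rewrite addr_gt0.
rewrite -(lnK A0) -(lnK B0) in H *.
move: (ln A) (ln B) H => p q H.
pose t := (p - q) / (2 * (a + b)).
have ab1 : a + b != 0 by rewrite gt_eqF.
pose E := expR ((b * p + a * q) / (a + b)).
have E1 : expR t `^ (- (2 * a)) * expR p = E.
  by rewrite -expRM -expRD; congr expR; rewrite /t; field.
have E2 : expR t `^ (2 * b) * expR q = E.
  by rewrite -expRM -expRD; congr expR; rewrite /t; field.
have XE : X <= K * E + K * E.
  by rewrite -{1}E1 -E2 !mulrA; exact: H (expR_gt0 t).
have {}XE : X <= 2 * K * E by rewrite -mulrA; move: XE; set y := K * E; lra.
have K2 : 0 <= 2 * K by rewrite mulr_ge0// ltW.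
apply: (@le_trans _ _ ((2 * K * E) `^ ((a + b) / 2))).
  by rewrite ge0_ler_powR ?nnegrE ?mulr_ge0 ?expR_ge0 ?divr_ge0// ltW.
rewrite (powRM _ K2 (expR_ge0 _)) -[leRHS]mulrA; apply: ler_wpM2l; first exact: powR_ge0.
rewrite -!expRM -expRD ler_expR le_eqVlt; apply/orP; left; apply/eqP.
by field.
Qed.

Theorem theorem1p6 (R : realType) (alpha a b : R)
    (halpha : 0 <= alpha) (ha : 0 < a) (hb : 0 < b) :
  exists2 c : R, 0 < c &
    forall (f : R * R -> R[i]) (F : R * nat -> R[i]),
      complex_Lp (laguerre_measure alpha) 2%:E f ->
      is_fourier_laguerre_L2 alpha f F ->
      (complex_Lnorm (laguerre_measure alpha) 2%:E f `^ (a + b)%R <=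
       c%:E
       * complex_Lnorm (laguerre_measure alpha) 2%:E
           (fun z => (real_complex R (hypergroup_norm z `^ a) * f z)%R) `^ b
       * complex_Lnorm (plancherel_measure alpha) 2%:E
           (fun w => (real_complex R (dual_norm alpha w `^ (b / 2)) * F w)%R) `^ a)%E.
Proof.
have [K K0 HK] := dilated_uncertainty halpha ha hb.
have ab0 : 0 < a + b by rewrite addr_gt0.
exists ((2 * K) `^ ((a + b) / 2)); first by apply: powR_gt0; exact: mulr_gt0.
move=> f F Lf fF; have {}HK := HK f F Lf fF.
have [mf /csq_lty Xf] := Lf; have [[mF _] _] := fF.
rewrite !complex_Lnorm2E.
have mha : measurable_fun setT (fun z : measurableTypeR R * measurableTypeR R =>
    hypergroup_norm z `^ a : measurableTypeR R).
  exact: (measurableT_comp (measurable_powR a) measurable_hypergroup_norm).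
have mhb : measurable_fun setT (fun w : measurableTypeR R * nat =>
    dual_norm alpha w `^ (b / 2) : measurableTypeR R).
  exact: (measurableT_comp (measurable_powR _) (measurable_dual_norm alpha)).
(* Both weights vanish only on null sets, so f = 0 if a weighted norm is 0. *)
have null_m : laguerre_measure alpha [set z | hypergroup_norm z `^ a = 0] = 0%E.
  apply: (@measure_eq0_of_powR_le _ _ _ _ _ (pi * Gamma (alpha + 1))^-1 (2 * alpha + 4)).
  - by rewrite invr_gt0 mulr_gt0 ?pi_gt0 ?Gamma_gt0.
  - by rewrite ltr_wpDl// mulr_ge0.
  move=> r r0; apply: le_trans (hypergroup_ball_volume halpha r0).
  apply: le_measure; rewrite ?inE.
  - rewrite -[X in measurable X]setTI.
    exact: (mha measurableT [set 0] (measurable_set1 _)).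
  - exact: measurable_hypergroup_ball.
  - by move=> z /= /powR_eq0_eq0; rewrite /hypergroup_ball/= => ->; exact: ltW.
have null_g : plancherel_measure alpha [set w | dual_norm alpha w `^ (b / 2) = 0] = 0%E.
  apply: (@measure_eq0_of_powR_le _ _ _ _ _ (2 * (1 + alpha)) (alpha + 2)).
  - by rewrite mulr_gt0// ltr_pwDl.
  - by rewrite ltr_wpDl.
  move=> r r0; apply: le_trans (dual_ball_volume halpha r0).
  apply: le_measure; rewrite ?inE.
  - rewrite -[X in measurable X]setTI.
    exact: (mhb measurableT [set 0] (measurable_set1 _)).
  - exact: measurable_dual_ball.
  - by move=> w /= /powR_eq0_eq0; rewrite /dual_ball/= => ->; exact: ltW.
have A_eq0 : csq (laguerre_measure alpha) (fun z => (real_complex R (hypergroup_norm z `^ a) * f z)%R) = 0%E ->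
    csq (laguerre_measure alpha) f = 0%E.
  exact: csq_weight_eq0 mha mf null_m.
have B_eq0 : csq (plancherel_measure alpha) (fun w => (real_complex R (dual_norm alpha w `^ (b / 2)) * F w)%R) = 0%E ->
    csq (laguerre_measure alpha) f = 0%E.
  move=> B0; apply/eqP; rewrite eq_le csq_ge0 andbT.
  by rewrite (le_trans (csq_le_transform halpha Lf fF))// (csq_weight_eq0 mhb mF null_g B0) ?mule0.
have A0 := csq_ge0 (laguerre_measure alpha)
  (fun z => (real_complex R (hypergroup_norm z `^ a) * f z)%R).
have B0 := csq_ge0 (plancherel_measure alpha)
  (fun w => (real_complex R (dual_norm alpha w `^ (b / 2)) * F w)%R).
move: (csq (laguerre_measure alpha) (fun z => real_complex R (hypergroup_norm z `^ a) * f z)%R) HK A_eq0 A0 => A.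
move: (csq (plancherel_measure alpha) (fun w => real_complex R (dual_norm alpha w `^ (b / 2)) * F w)%R) B_eq0 B0 => B.
move=> B_eq0 B0 HK A_eq0 A0.
move: Xf (csq_ge0 (laguerre_measure alpha) f) HK A_eq0 B_eq0.
move: (csq (laguerre_measure alpha) f) => [X| |]// _ X0 HK A_eq0 B_eq0.
have [->|Xneq0] := eqVneq X 0.
  have p0 (t : R) : 0 < t -> (0%:E `^ t = 0%:E :> \bar R)%E.
    by move=> t0; rewrite poweR_EFin powR0// gt_eqF.
  rewrite p0 ?invr_gt0// p0//.
  by rewrite !mule_ge0 ?poweR_ge0// lee_fin powR_ge0.
have c0 : 0 < (2 * K) `^ ((a + b) / 2) by apply: powR_gt0; exact: mulr_gt0.
have A_gt0 : (0 < A)%E.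
  rewrite lt_neqAle A0 andbT; apply/eqP => /esym /A_eq0 [] /eqP.
  by rewrite (negbTE Xneq0).
have B_gt0 : (0 < B)%E.
  rewrite lt_neqAle B0 andbT; apply/eqP => /esym /B_eq0 [] /eqP.
  by rewrite (negbTE Xneq0).
have pos (Z : \bar R) (t : R) : (0 < Z)%E -> (0 < (Z `^ 2^-1) `^ t)%E.
  move=> Z0; apply: poweR_gt0; exact: poweR_gt0.
(* If a weighted norm is infinite, the other being positive, there is nothing
   to prove. *)
have yb : forall t : R, 0 < t -> ((+oo `^ 2^-1) `^ t = +oo :> \bar R)%E.
  by move=> t t0; rewrite poweRyr ?invr_neq0// poweRyr// gt_eqF.
move: A A_gt0 {A0 A_eq0} HK => [A| |]// A_gt0 HK; last first.
  by rewrite yb// mulry gtr0_sg// mul1e gt0_mulye ?leey// pos.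
move: B B_gt0 {B0 B_eq0} HK => [B| |]// B_gt0 HK; last first.
  rewrite yb// gt0_muley ?leey// mule_gt0 ?lte_fin//.
  exact: (pos A%:E b A_gt0).
rewrite !poweR_EFin -!EFinM lee_fin -!powRrM.
rewrite [2^-1 * (a + b)]mulrC [2^-1 * b]mulrC [2^-1 * a]mulrC.
by apply: optimise_dilation.
Qed.
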